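(* Let $k\ge2$ be an integer and let $\varepsilon>0$. There exists a constant $C>0$ such that, for every $\gamma\in(0,1)$, there exists $\Delta_0\in\mathbb{N}$ with the following property. Let $\Delta\ge\Delta_0$, $n\in\mathbb{N}$, and let $q,\ell\in\mathbb{N}$ with $\ell\le q$ be such that $$q\ge(1+\varepsilon)\left(\frac{k-1}{\gamma}\,\frac{\Delta}{\log\Delta}\right)^{\frac{1}{k-1}}\qquad\text{and}\qquad \ell\ge\Delta^{\frac{\gamma}{k-1}}+C(\log n)^{\frac1k}.$$ Let $\mathcal{H}$ be an $n$-vertex $k$-uniform uncrowded hypergraph of maximum degree at most $\Delta$. Suppose that, for each vertex $v\in V(\mathcal{H})$, we independently sample a set $L(v)\subseteq[q]$ of size $\ell$ uniformly at random. Then, with probability at least $1-1/n$, $\mathcal{H}$ admits an $L$-coloring.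
   Context: $[q]=\{1,\dots,q\}$. A hypergraph is a pair $(V,E)$ with $V$ a finite set and $E\subseteq 2^V$; it is $k$-uniform if every edge has exactly $k$ elements. The degree of a vertex is the number of edges containing it. For $r\ge2$, an $r$-cycle consists of $r$ distinct edges $e_0,\dots,e_{r-1}$ for which there are distinct vertices $v_1,\dots,v_r$ with $v_i\in e_i\cap e_{i+1}$ for $1\le i\le r$ (indices modulo $r$). A hypergraph is uncrowded if it contains no $r$-cycle for $2\le r\le4$. An $L$-coloring of $\mathcal{H}$ is a function $\Phi$ on $V(\mathcal{H})$ with $\Phi(v)\in L(v)$ for every $v$ such that no edge is monochromatic. $\log$ is the natural logarithm. *)

(* Defs.v *)
From mathcomp Require Import all_boot all_order all_algebra.
From mathcomp Require Import reals exp.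

Set Implicit Arguments.
Unset Strict Implicit.
Unset Printing Implicit Defensive.

Import Order.TTheory GRing.Theory Num.Theory.

Local Open Scope ring_scope.

Section Hypergraph.
Variable V : finType.

(* The vertex set is the whole type V, so n-vertex means #|V| = n. *)
Definition hypergraph := {set {set V}}.

Implicit Types H : hypergraph.

Definition uniform (k : nat) H := [forall e in H, #|e| == k].

Definition degree H (v : V) : nat := #|[set e in H | v \in e]|.

Definition max_degree H : nat := \max_(v : V) degree H v.

(* Indices run over Z/r (ordS is the cyclic successor); the index r of v_r
   is represented by 0. *)
Definition has_cycle (r : nat) H : Prop :=
  exists (e : 'I_r -> {set V}) (v : 'I_r -> V),
    [/\ injective e, injective v, forall i, e i \in H
      & forall i, v i \in e i :&: e (ordS i)].

Definition uncrowded H : Prop :=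
  forall r : nat, (2 <= r <= 4)%N -> ~ has_cycle r H.

Section Coloring.
Variable q : nat.
Implicit Types (L : {ffun V -> {set 'I_q}}) (Phi : {ffun V -> 'I_q}).

Definition monochromatic Phi (e : {set V}) :=
  [forall x in e, forall y in e, Phi x == Phi y].

Definition list_coloring H L Phi :=
  [forall v, Phi v \in L v] && [forall e in H, ~~ monochromatic Phi e].

Definition list_colorable H L := [exists Phi, list_coloring H L Phi].

End Coloring.
End Hypergraph.

Section RandomLists.
Variable R : realType.
Variables (V : finType) (q l : nat).

(* Probability mass function of a uniformly random l-subset of the q colors. *)
Definition unif_subset (S : {set 'I_q}) : R :=
  if #|S| == l then 'C(q, l)%:R^-1 else 0.

(* Independence over the vertices: the joint law is the product law. *)
Definition random_lists (L : {ffun V -> {set 'I_q}}) : R :=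
  \prod_(v : V) unif_subset (L v).

Definition Pr_lists (A : pred {ffun V -> {set 'I_q}}) : R :=
  \sum_(L | A L) random_lists L.

Lemma unif_subset_sum1 : (l <= q)%N -> \sum_S unif_subset S = 1.
Proof.
move=> le_lq; rewrite /unif_subset -big_mkcond /= sumr_const.
have -> : #|[pred S : {set 'I_q} | #|S| == l]| = 'C(q, l).
  by rewrite -[in RHS](card_ord q) -card_draws; apply: eq_card => S; rewrite !inE.
by rewrite -[LHS]mulr_natl divff // pnatr_eq0 -lt0n bin_gt0.
Qed.

Lemma random_lists_sum1 : (l <= q)%N -> Pr_lists predT = 1.
Proof.
move=> le_lq; rewrite /Pr_lists /random_lists.
rewrite -(bigA_distr_bigA (fun (_ : V) S => unif_subset S)) /=.
by rewrite big1 // => v _; exact: unif_subset_sum1.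
Qed.

End RandomLists.

(* Main.v *)
(** Write r = k - 1. For a vertex v and a color c of L(v), the number of edges
    at v whose other vertices all have c in their list is concentrated around
    Delta (l/q)^r <= l^r log l / (1 + eps). Discarding from each list the few
    colors for which it is too large costs a fraction of the list, except with
    probability exp(- c l^k log l) << 1/n^2, so it suffices to color from
    lists of size l with color degrees at most (1 - eps) l^r log l, while the
    degrees are polynomial in l.

    This is done by a semi-random nibble. Each round activates every remaining
    color at every uncolored vertex independently with probability theta/l;
    a color survives at v unless some edge at v has all its other vertices
    colored or activated with it, and a vertex takes an activated surviving
    color. Since there are no 2-, 3- or 4-cycles, the events around v are
    independent once the activations at v are fixed, and the local lemma keeps
    the process on track: when a fraction t of the vertices is colored, an edge
    at v alive in color c has j other vertices colored c with the frequency
    of a binomial law of parameters r and t. A list then loses a fraction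
    d(lam t^r) of its colors, so its final size is l exp(- lam) with
    lam = (1 - eps) log l, still a power of l. When 1 - t is below 1 / log l,
    the local lemma applied to uniform choices from the remaining lists completes
    the coloring. *)

Require Import Defs.
From mathcomp Require Import all_boot all_order all_algebra.
From mathcomp Require Import reals sequences exp ring lra zify.

Set Implicit Arguments.
Unset Strict Implicit.
Unset Printing Implicit Defensive.

Import Order.TTheory GRing.Theory Num.Theory.

Local Open Scope ring_scope.

(** * Finite product probability spaces *)

(** The obstacle is that v itself correlates the fates of its neighbors. Survival at a neighbor u is
    therefore replaced by [kept [set v]], which ignores the edges through v: this costs a factor
    1/(1 - alpha) in probability and leaves an event that reads only trials on [reach v u]. The
    colors activated at v, fewer than s, are left out of the count at u. Extra coins make every
    listed color survive with probability exactly kappa, and lists are cut to a common size, so that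
    three numbers lam, t, l describe a state. The scales are powers of eta, a small negative power
    of l: theta = eta^2 and relative error xi = eta^3. A round errs by order theta^2 log l, below
    xi, while theta N is at most of order log l, so the accumulated error xi N is at most of order
    eta log l. The exponent 1/k of log n comes from treating the bad colors of a list jointly: z l
    given colors are all bad with probability exp(- c l^r log l z l), whereas a single color only
    gives l^r log l in the exponent. *)

Record product_law (R : realType) (I T : finType) := ProductLaw {
  mass :> I -> T -> R;
  mass_ge0 : forall i t, 0 <= mass i t;
  mass_sum1 : forall i, \sum_t mass i t = 1 }.

Section ProductSpace.
Variables (R : realType) (I T : finType) (P : product_law R I T).
Local Notation Omega := {ffun I -> T}.
Implicit Types (S : {set I}) (f g : Omega -> R) (A B : pred Omega).

Definition weight (om : Omega) : R := \prod_i P i (om i).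

Definition Ex f : R := \sum_om weight om * f om.

Definition Pr A : R := Ex (fun om => (A om)%:R).

Definition depends_on (U : Type) (f : Omega -> U) S :=
  forall om om' : Omega, {in S, om =1 om'} -> f om = f om'.

Lemma weight_ge0 om : 0 <= weight om.
Proof. by apply: prodr_ge0 => i _; exact: mass_ge0. Qed.

Lemma weight_sum1 : \sum_om weight om = 1.
Proof.
rewrite -(bigA_distr_bigA (fun i t => P i t)) /=.
by rewrite big1 // => i _; exact: mass_sum1.
Qed.

Lemma eq_Ex f g : f =1 g -> Ex f = Ex g.
Proof. by move=> e; apply: eq_bigr => om _; rewrite e. Qed.

Lemma le_Ex f g : (forall om, f om <= g om) -> Ex f <= Ex g.
Proof. by move=> le; apply: ler_sum => om _; rewrite ler_wpM2l ?weight_ge0. Qed.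

Lemma Ex_ge0 f : (forall om, 0 <= f om) -> 0 <= Ex f.
Proof. by move=> f0; apply: sumr_ge0 => om _; rewrite mulr_ge0 ?weight_ge0. Qed.

Lemma Ex_cst c : Ex (fun=> c) = c.
Proof. by rewrite /Ex -mulr_suml weight_sum1 mul1r. Qed.

Lemma ExD f g : Ex (fun om => f om + g om) = Ex f + Ex g.
Proof. by rewrite -big_split; apply: eq_bigr => om _; rewrite mulrDr. Qed.

Lemma ExZ c f : Ex (fun om => c * f om) = c * Ex f.
Proof. by rewrite /Ex mulr_sumr; apply: eq_bigr => om _; rewrite mulrCA. Qed.

Lemma ExZr c f : Ex (fun om => f om * c) = Ex f * c.
Proof. by rewrite mulrC -ExZ; apply: eq_Ex => om; rewrite mulrC. Qed.

Lemma Ex_sum (J : finType) (Q : pred J) (F : J -> Omega -> R) :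
  Ex (fun om => \sum_(j | Q j) F j om) = \sum_(j | Q j) Ex (F j).
Proof. by rewrite exchange_big; apply: eq_bigr => om _; rewrite mulr_sumr. Qed.

Lemma Pr_ge0 A : 0 <= Pr A.
Proof. by apply: Ex_ge0 => om; rewrite ler0n. Qed.

Lemma Pr_predT : Pr predT = 1.
Proof. exact: Ex_cst. Qed.

Lemma sub_Pr A B : subpred A B -> Pr A <= Pr B.
Proof.
move=> sAB; apply: le_Ex => om; rewrite ler_nat.
by case: (A om) (sAB om) => // ->.
Qed.

Lemma eq_Pr A B : A =1 B -> Pr A = Pr B.
Proof. by move=> e; apply: eq_Ex => om; rewrite e. Qed.

Lemma Pr_le1 A : Pr A <= 1.
Proof. by rewrite -Pr_predT; apply: sub_Pr. Qed.

Lemma PrC A : Pr (predC A) = 1 - Pr A.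
Proof.
rewrite -Pr_predT; apply/eqP; rewrite eq_sym subr_eq; apply/eqP.
by rewrite -ExD; apply: eq_Ex => om /=; case: (A om); rewrite ?addr0 ?add0r.
Qed.

Lemma Pr_split A B : Pr A = Pr (predI A B) + Pr (predI A (predC B)).
Proof.
rewrite -ExD; apply: eq_Ex => om /=.
by case: (A om); case: (B om); rewrite ?addr0 ?add0r.
Qed.

Lemma Pr_union (J : finType) (Q : pred J) (A : J -> pred Omega) :
  Pr (fun om => [exists j, Q j && A j om]) <= \sum_(j | Q j) Pr (A j).
Proof.
rewrite -Ex_sum; apply: le_Ex => om; case: existsP => [[j /andP[Qj Aj]]|_].
  by rewrite (bigD1 j) //= Aj lerDl sumr_ge0.
by rewrite sumr_ge0.
Qed.

Lemma Pr_le_sum (J : finType) (Q : pred J) (A : pred Omega) (B : J -> pred Omega) :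
  (forall om, A om -> exists2 j, Q j & B j om) ->
  Pr A <= \sum_(j | Q j) Pr (B j).
Proof.
move=> sA; apply: le_trans (Pr_union _ _); apply: sub_Pr => om /sA[j Qj Bj].
by apply/existsP; exists j; rewrite Qj.
Qed.

Lemma Pr_or A B : Pr (predU A B) <= Pr A + Pr B.
Proof.
rewrite -ExD; apply: le_Ex => om /=; rewrite -natrD ler_nat.
by case: (A om); case: (B om).
Qed.

Lemma exp_markov (A : pred Omega) f (d : R) :
  (forall om, A om -> d <= f om) ->
  Pr A <= Ex (fun om => expR (f om)) * expR (- d).
Proof.
move=> dA; rewrite -ExZr; apply: le_Ex => om.
case: (boolP (A om)) => [/dA dle|_]; last by rewrite mulr_ge0 ?expR_ge0.
by rewrite -expRD -[1%:R]expR0 ler_expR subr_ge0.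
Qed.

(** Inserting g as an extra factor at coordinate i keeps the integrand a product over coordinates,
    so the sum factors and every other coordinate contributes 1. *)
Lemma Ex_coord i (g : T -> R) : Ex (fun om => g (om i)) = \sum_t P i t * g t.
Proof.
pose F j t := P j t * (if j == i then g t else 1).
have -> : Ex (fun om => g (om i)) = \sum_(om : Omega) \prod_j F j (om j).
  rewrite /Ex; apply: eq_bigr => om _; rewrite big_split /=; congr (_ * _).
  by rewrite -big_mkcond big_pred1_eq.
rewrite -(bigA_distr_bigA F) (bigD1 i) //= [X in _ * X]big1 ?mulr1 => [|j /negPf ne].
  by apply: eq_bigr => t _; rewrite /F eqxx.
by rewrite -(mass_sum1 P j); apply: eq_bigr => t _; rewrite /F ne mulr1.
Qed.

Lemma Pr_coord i (Q : pred T) : Pr (fun om => Q (om i)) = \sum_(t | Q t) P i t.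
Proof.
rewrite /Pr (Ex_coord i (fun t => (Q t)%:R)) [RHS]big_mkcond.
by apply: eq_bigr => t _; case: (Q t); rewrite ?mulr1 ?mulr0.
Qed.

Definition splice S (om om' : Omega) : Omega :=
  [ffun i => if i \in S then om' i else om i].

(* Exchanging the coordinates in S of two independent samples is a
   measure-preserving involution. *)
Lemma Ex_indep f g S1 S2 : depends_on f S1 -> depends_on g S2 ->
  [disjoint S1 & S2] -> Ex (fun om => f om * g om) = Ex f * Ex g.
Proof.
move=> df dg dis; rewrite /Ex mulr_suml.
under [RHS]eq_bigr => om _ do rewrite mulr_sumr.
rewrite pair_big /=.
pose h (p : Omega * Omega) := (splice S2 p.1 p.2, splice S2 p.2 p.1).
have hK : involutive h.
  by case=> a b; congr (_, _); apply/ffunP=> i; rewrite !ffunE; case: (i \in S2).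
rewrite (reindex_inj (inv_inj hK)) /=.
have wtM a b : weight (splice S2 a b) * weight (splice S2 b a) = weight a * weight b.
  rewrite /weight -!big_split /=; apply: eq_bigr => i _; rewrite !ffunE.
  by case: ifP => _ //; rewrite mulrC.
transitivity (\sum_(p : Omega * Omega)
    weight (splice S2 p.1 p.2) * weight (splice S2 p.2 p.1) * (f p.1 * g p.1)).
  rewrite (eq_bigr (fun p => (weight p.1 * (f p.1 * g p.1)) * weight p.2)) => [|p _].
    rewrite -(pair_big predT predT
      (fun a b => (weight a * (f a * g a)) * weight b)) /=.
    by apply: eq_bigr => a _; rewrite -mulr_sumr weight_sum1 mulr1.
  by rewrite wtM mulrAC.
apply: eq_bigr => -[a b] _ /=; rewrite mulrACA.
rewrite (df (splice S2 a b) a) => [|i iS]; last first.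
  by rewrite ffunE (disjointFr dis iS).
rewrite (dg (splice S2 b a) a) => [|i iS]; last by rewrite ffunE iS.
by rewrite mulrACA.
Qed.

Lemma depends_on_comp (U U' : Type) (f : Omega -> U) (h : U -> U') S :
  depends_on f S -> depends_on (fun om => h (f om)) S.
Proof. by move=> df om om' e; rewrite (df _ _ e). Qed.

Lemma depends_on_coord i S : i \in S -> depends_on (fun om : Omega => om i) S.
Proof. by move=> iS om om' e; apply: e. Qed.

Lemma depends_on2 (U1 U2 U : Type) (f1 : Omega -> U1) (f2 : Omega -> U2)
  (h : U1 -> U2 -> U) S :
  depends_on f1 S -> depends_on f2 S -> depends_on (fun om => h (f1 om) (f2 om)) S.
Proof. by move=> d1 d2 om om' e; rewrite (d1 _ _ e) (d2 _ _ e). Qed.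

Lemma depends_on_forall (J : finType) (f : J -> Omega -> bool) S :
  (forall j, depends_on (f j) S) -> depends_on (fun om => [forall j, f j om]) S.
Proof. by move=> df om om' e; apply: eq_forallb => j; apply: df. Qed.

Lemma depends_on_prod (J : finType) (r : seq J) (F : J -> Omega -> R)
  (S : J -> {set I}) :
  (forall j, j \in r -> depends_on (F j) (S j)) ->
  depends_on (fun om => \prod_(j <- r) F j om) (\bigcup_(j <- r) S j).
Proof.
move=> dF om om' e; rewrite !big_seq; apply: eq_bigr => j jr.
apply: (dF j jr) => i iS; apply: e.
by rewrite (big_rem j jr) inE iS.
Qed.

Lemma Ex_prod (J : finType) (Q : {set J}) (F : J -> Omega -> R) (S : J -> {set I}) :
  {in Q, forall j, depends_on (F j) (S j)} ->
  {in Q &, forall j j', j != j' -> [disjoint S j & S j']} ->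
  Ex (fun om => \prod_(j in Q) F j om) = \prod_(j in Q) Ex (F j).
Proof.
move=> dF dis.
have H (r : seq J) : uniq r -> {subset r <= Q} ->
    Ex (fun om => \prod_(j <- r) F j om) = \prod_(j <- r) Ex (F j).
  elim: r => [|j r IH] /=.
    by move=> _ _; rewrite big_nil -[RHS](Ex_cst 1); apply: eq_Ex => om; rewrite big_nil.
  move=> /andP[jr ur] srQ; have jQ : j \in Q by apply: srQ; rewrite mem_head.
  have srQ' : {subset r <= Q} by move=> x xr; apply: srQ; rewrite inE xr orbT.
  rewrite big_cons -IH // -(Ex_indep (S1 := S j) (S2 := \bigcup_(j <- r) S j)).
  - by apply: eq_Ex => om; rewrite big_cons.
  - exact: dF.
  - by apply: depends_on_prod => x xr; apply: dF; apply: srQ'.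
  rewrite disjoint_sym big_seq.
  apply: (big_ind (fun X : {set I} => [disjoint X & S j])) => [|X Y dX dY|x xr].
  - by rewrite disjoints_subset sub0set.
  - by rewrite -setI_eq0 setIUl setU_eq0 !setI_eq0 dX.
  - by apply: dis; [exact: srQ'|exact: jQ|apply: contraNneq jr => <-].
rewrite -[RHS]big_enum -H ?enum_uniq //.
  by apply: eq_Ex => om; rewrite big_enum.
by move=> x; rewrite mem_enum.
Qed.

Lemma Pr_indep A B S1 S2 : depends_on A S1 -> depends_on B S2 ->
  [disjoint S1 & S2] -> Pr (predI A B) = Pr A * Pr B.
Proof.
move=> dA dB dis; rewrite /Pr -(Ex_indep (S1 := S1) (S2 := S2)) //.
- by apply: eq_Ex => om /=; rewrite -natrM mulnb.
- by move=> om om' e; rewrite (dA _ _ e).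
- by move=> om om' e; rewrite (dB _ _ e).
Qed.

Lemma Pr_forall (J : finType) (Q : {set J}) (A : J -> pred Omega) (S : J -> {set I}) :
  {in Q, forall j, depends_on (A j) (S j)} ->
  {in Q &, forall j j', j != j' -> [disjoint S j & S j']} ->
  Pr (fun om => [forall j in Q, A j om]) = \prod_(j in Q) Pr (A j).
Proof.
move=> dA dis; rewrite -(Ex_prod (S := S)) //; last first.
  by move=> j jQ om om' e; rewrite (dA j jQ _ _ e).
apply: eq_Ex => om; case: forall_inP => [all_A|nall].
  by rewrite big1 // => j jQ; rewrite all_A.
have [j jQ nA] : exists2 j, j \in Q & ~~ A j om.
  by apply/exists_inP; rewrite -negb_forall_in; apply/forall_inP.
by rewrite (bigD1 j) //= (negPf nA) mul0r.
Qed.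

(** Positive mass at every coordinate turns the support of the law into a hard constraint on the
    witness: in the final completion it forces the sampled colors into the lists. *)
Lemma Pr_gt0_witness A : 0 < Pr A -> exists om, A om /\ forall i, 0 < P i (om i).
Proof.
move=> PA.
have [om Aom wom] : exists2 om, A om & weight om != 0.
  apply/exists_inP; apply: contraLR PA => /exists_inPn H; rewrite -leNgt.
  rewrite /Pr /Ex big1 // => om _; have := H om; rewrite unfold_in.
  by case: (A om) => [/(_ isT)|]; rewrite ?mulr0 // negbK => /eqP ->; rewrite mul0r.
exists om; split=> // i; rewrite lt0r mass_ge0 andbT.
by apply: contraNneq wom => w0; rewrite /weight (bigD1 i) //= w0 mul0r.
Qed.

End ProductSpace.

(** * The local lemma and Chernoff bounds *)

Section LocalLemma.
Variables (R : realType) (I T : finType) (P : product_law R I T).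
Variables (J : finType) (A : J -> pred {ffun I -> T}) (S : J -> {set I}) (p : J -> R).

Let avoid (X : {set J}) : pred {ffun I -> T} := fun om => [forall j in X, ~~ A j om].

Lemma depends_on_avoid X : (forall j, depends_on (A j) (S j)) ->
  depends_on (avoid X) (\bigcup_(j in X) S j).
Proof.
move=> dA om om' e; apply: eq_forallb => j.
case jX : (j \in X) => //=; rewrite (dA j om om') // => i iS.
by apply: e; apply/bigcupP; exists j.
Qed.

(** By induction on the size of X, conditioning on [avoid X] at most doubles the bound p j. Split X
    into X1, whose scopes meet that of j, and the rest X2. The event j is independent of [avoid X2],
    and a union bound over X1 loses at most 2 * 1/4 of the probability of [avoid X2], so that one
    half remains. The clause i == j gives p j <= 1/4 even for an empty scope, which keeps [avoid X]
    of positive probability. *)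
Lemma local_lemma :
  (forall j, depends_on (A j) (S j)) ->
  (forall j, Pr P (A j) <= p j) ->
  (forall j, \sum_(i | (i == j) || ~~ [disjoint S i & S j]) p i <= 1 / 4) ->
  exists om, (forall j, ~~ A j om) /\ forall i, 0 < P i (om i).
Proof.
move=> dA pA p4.
have p0 j : 0 <= p j by apply: le_trans (pA j); exact: Pr_ge0.
have pj4 j : p j <= 1 / 4.
  by apply: le_trans (p4 j); rewrite (bigD1 j) ?eqxx //= lerDl sumr_ge0.
have claim n : forall X : {set J}, (#|X| <= n)%N -> 0 < Pr P (avoid X) /\
    forall j, Pr P (predI (A j) (avoid X)) <= 2 * p j * Pr P (avoid X).
  elim: n => [|n IH] X.
    rewrite leqn0 cards_eq0 => /eqP ->.
    have a0 : avoid set0 =1 predT by move=> om; apply/forall_inP => j; rewrite inE.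
    rewrite (eq_Pr _ a0) Pr_predT; split=> // j; rewrite mulr1.
    rewrite (_ : Pr P _ = Pr P (A j)); last first.
      by apply: eq_Pr => om /=; rewrite a0 andbT.
    have := pA j; have := p0 j; lra.
  move=> cX.
  have IH1 (Y : {set J}) : (#|Y| < #|X|)%N -> 0 < Pr P (avoid Y) /\
      forall j, Pr P (predI (A j) (avoid Y)) <= 2 * p j * Pr P (avoid Y).
    by move=> cY; apply: IH; rewrite -ltnS (leq_trans cY).
  split.
    have [->|[j jX]] := set_0Vmem X.
      have -> : Pr P (avoid set0) = Pr P predT.
        by apply: eq_Pr => om; apply/forall_inP => j; rewrite inE.
      by rewrite Pr_predT.
    have [|pos bnd] := IH1 (X :\ j); first by rewrite [in X in (_ < X)%N](cardsD1 j) jX.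
    have -> : Pr P (avoid X) = Pr P (predI (avoid (X :\ j)) (predC (A j))).
      apply: eq_Pr => om /=; apply/forall_inP/andP => [H|[/forall_inP H nA] i iX].
        by split; [apply/forall_inP => i; rewrite inE => /andP[_]; exact: H|exact: H].
      by have [->//|ij] := eqVneq i j; apply: H; rewrite !inE ij.
    have := Pr_split P (avoid (X :\ j)) (A j).
    have := bnd j; rewrite (_ : Pr P (predI (A j) _) = Pr P (predI (avoid (X :\ j)) (A j))).
      by have := pj4 j; nra.
    by apply: eq_Pr => om /=; rewrite andbC.
  move=> j; pose X1 := X :&: [set i | ~~ [disjoint S i & S j]]; pose X2 := X :\: X1.
  have sub2 : subpred (avoid X) (avoid X2).
    move=> om /forall_inP H; apply/forall_inP => i; rewrite inE => /andP[_]; exact: H.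
  have ind : Pr P (predI (A j) (avoid X2)) = Pr P (A j) * Pr P (avoid X2).
    apply: Pr_indep (dA j) (depends_on_avoid dA) _.
    apply: bigcup_disjoint => i; rewrite disjoint_sym.
    by rewrite !inE => /andP[+ iX]; rewrite iX /= negbK.
  have le1 : Pr P (predI (A j) (avoid X)) <= p j * Pr P (avoid X2).
    apply: (@le_trans _ _ (Pr P (predI (A j) (avoid X2)))).
      by apply: sub_Pr => om /= /andP[-> /sub2].
    by rewrite ind ler_wpM2r ?Pr_ge0.
  have le2 : Pr P (avoid X2) <= 2 * Pr P (avoid X).
    have : Pr P (avoid X2) <= Pr P (avoid X) +
        \sum_(i in X1) Pr P (predI (A i) (avoid X2)).
      rewrite -Ex_sum -ExD; apply: le_Ex => om.
      case: (boolP (avoid X2 om)) => [a2|_]; last first.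
        by rewrite addr_ge0 ?sumr_ge0.
      case: (boolP (avoid X om)) => [_|]; first by rewrite lerDl sumr_ge0.
      rewrite negb_forall_in => /exists_inP[i iX]; rewrite negbK => Ai.
      have iX1 : i \in X1.
        apply: contraLR a2 => iX1; rewrite negb_forall_in; apply/exists_inP.
        by exists i; rewrite ?negbK // inE iX1.
      by rewrite add0r (bigD1 i) //= Ai a2 lerDl sumr_ge0.
    have : \sum_(i in X1) Pr P (predI (A i) (avoid X2)) <=
        2^-1 * Pr P (avoid X2).
      apply: (@le_trans _ _ (\sum_(i in X1) 2 * p i * Pr P (avoid X2))).
        apply: ler_sum => i iX1; have c2 : (#|X2| < #|X|)%N.
          apply: proper_card; apply/properP; split; first exact: subsetDl.
          exists i; first by move: iX1; rewrite inE => /andP[].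
          by rewrite in_setD iX1.
        by have [_] := IH1 _ c2; apply.
      rewrite -mulr_suml ler_wpM2r ?Pr_ge0 // -mulr_sumr.
      have : \sum_(i in X1) p i <= 1 / 4.
        apply: le_trans (p4 j).
        rewrite big_mkcond [leRHS]big_mkcond; apply: ler_sum => i _.
        rewrite !inE; case: (i \in X); case: (i == j); case: [disjoint S i & S j] => //=.
      by lra.
    lra.
  have := p0 j; nra.
have [pos _] := claim _ _ (leqnn #|[set: J]|).
have [om [av wpos]] := Pr_gt0_witness pos.
by exists om; split=> // j; apply: (forall_inP av); rewrite inE.
Qed.

End LocalLemma.

Section Chernoff.
Variable R : realType.

(** From exp(-x) >= 1 - x one gets exp(x) (1 - x) <= 1, while (1 - x)(1 + x + 2x^2) = 1 + x^2 (1 -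
    2x) >= 1. *)
Lemma expR_le_quad (x : R) : x <= 1 / 2 -> expR x <= 1 + x + 2 * x ^+ 2.
Proof.
move=> x2; have h := expR_ge1Dx (- x).
have e1 : expR x * expR (- x) = 1 by rewrite expRxMexpNx_1.
have e0 := expR_gt0 x.
have : expR x * (1 - x) <= 1 by nra.
move=> h1; rewrite -(ler_pM2r (_ : 0 < 1 - x)); last by lra.
apply: (le_trans h1); nra.
Qed.

Variables (I T : finType) (P : product_law R I T).
Variables (J : finType) (Q : {set J}) (A : J -> pred {ffun I -> T}) (S : J -> {set I}).
Hypothesis dA : {in Q, forall j, depends_on (A j) (S j)}.
Hypothesis dis : {in Q &, forall j j', j != j' -> [disjoint S j & S j']}.

Let count om : R := #|[set j in Q | A j om]|%:R.

(** The exponential of x times an indicator is affine in the indicator, so independence leaves a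
    product of terms 1 + (exp x - 1) Pr(A j), each bounded by an exponential. *)
Lemma mgf_count (x : R) :
  Ex P (fun om => expR (x * count om)) <=
  expR ((expR x - 1) * \sum_(j in Q) Pr P (A j)).
Proof.
pose F j om := 1 + (expR x - 1) * (A j om)%:R.
have -> : Ex P (fun om => expR (x * count om)) = Ex P (fun om => \prod_(j in Q) F j om).
  apply: eq_Ex => om; rewrite /count -sum1_card natr_sum mulr_sumr expR_sum.
  rewrite (eq_bigl (fun j => (j \in Q) && A j om)); last by move=> j; rewrite !inE.
  rewrite big_mkcondr; apply: eq_bigr => j _; rewrite /F.
  by case: (A j om); rewrite ?mulr1 ?mulr0 ?addr0 // addrC subrK.
rewrite (Ex_prod _ (S := S)) //; last first.
  by move=> j jQ om om' e; rewrite /F (dA jQ e).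
rewrite mulr_sumr expR_sum; apply: ler_prod => j _.
have -> : Ex P (F j) = 1 + (expR x - 1) * Pr P (A j).
  by rewrite /F ExD ExZ Ex_cst.
rewrite expR_ge1Dx andbT.
have := Pr_ge0 P (A j); have := Pr_le1 P (A j); have := expR_gt0 x; nra.
Qed.

Lemma chernoff_upper (M x : R) : \sum_(j in Q) Pr P (A j) <= M -> 0 <= x <= 1 ->
  Pr P (fun om => (1 + x) * M <= count om) <= expR (- (x ^+ 2 * M / 8)).
Proof.
move=> sM /andP[x0 x1].
have M0 : 0 <= M by apply: le_trans sM; apply: sumr_ge0 => j _; exact: Pr_ge0.
(* The tilt x/4 gives x/4 + 2(x/4)^2 - (x/4)(1 + x) = - x^2/8. *)
apply: (le_trans (exp_markov (f := fun om => x / 4 * count om)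
  (d := x / 4 * ((1 + x) * M)) _ _)).
  by move=> om h; rewrite ler_wpM2l //; lra.
apply: (le_trans (ler_wpM2r (expR_ge0 _) (mgf_count _))).
rewrite -expRD ler_expR.
have q : expR (x / 4) - 1 <= x / 4 + 2 * (x / 4) ^+ 2.
  by have := @expR_le_quad (x / 4); lra.
have e1 : 0 <= expR (x / 4) - 1 by have := expR_ge1Dx (x / 4); lra.
have : (expR (x / 4) - 1) * \sum_(j in Q) Pr P (A j) <= (x / 4 + 2 * (x / 4) ^+ 2) * M.
  by apply: ler_pM => //; apply: sumr_ge0 => j _; exact: Pr_ge0.
by move=> h; apply: (le_trans (lerD h (lexx _))); rewrite le_eqVlt; apply/orP; left; apply/eqP; field.
Qed.

Lemma chernoff_lower (M x : R) : 0 <= M <= \sum_(j in Q) Pr P (A j) -> 0 <= x <= 1 ->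
  Pr P (fun om => count om <= (1 - x) * M) <= expR (- (x ^+ 2 * M / 8)).
Proof.
move=> /andP[M0 sM] /andP[x0 x1].
(* Symmetric tilt: - x/4 + 2(x/4)^2 + (x/4)(1 - x) = - x^2/8. *)
apply: (le_trans (exp_markov (f := fun om => (- (x / 4)) * count om)
  (d := - (x / 4) * ((1 - x) * M)) _ _)).
  by move=> om h; rewrite ler_wnM2l //; lra.
apply: (le_trans (ler_wpM2r (expR_ge0 _) (mgf_count _))).
rewrite -expRD ler_expR.
have q : expR (- (x / 4)) - 1 <= - (x / 4) + 2 * (x / 4) ^+ 2.
  by have := @expR_le_quad (- (x / 4)); rewrite sqrrN; lra.
have e1 : expR (- (x / 4)) - 1 <= 0 by rewrite subr_le0 expR_le1; lra.
have : (expR (- (x / 4)) - 1) * \sum_(j in Q) Pr P (A j) <= (- (x / 4) + 2 * (x / 4) ^+ 2) * M.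
  apply: (@le_trans _ _ ((expR (- (x / 4)) - 1) * M)); first by rewrite ler_wnM2l.
  by rewrite ler_wpM2r.
by move=> h; apply: (le_trans (lerD h (lexx _))); rewrite le_eqVlt; apply/orP; left; apply/eqP; field.
Qed.

End Chernoff.

(** * Geometry of uncrowded hypergraphs *)

Section Uncrowded.
Variables (V : finType) (H : hypergraph V).
Hypothesis uncH : uncrowded H.
Implicit Types (e f : {set V}) (u v w : V).

Lemma no_2cycle e f x y : e \in H -> f \in H -> e != f -> x != y ->
  x \in e -> x \in f -> y \in e -> y \in f -> False.
Proof.
move=> eH fH ef xy xe xf ye yf.
apply: (@uncH 2) => //; exists (tnth [tuple e; f]), (tnth [tuple x; y]); split.
- by apply/tuple_uniqP; rewrite /= inE ef.
- by apply/tuple_uniqP; rewrite /= inE xy.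
- by case=> [[|[|i]] li].
- by case=> [[|[|i]] li] //; rewrite in_setI ?(tnth_nth x) ?(tnth_nth e) /= ?xe ?xf ?ye ?yf.
Qed.

Lemma no_3cycle e1 e2 e3 x y z : e1 \in H -> e2 \in H -> e3 \in H ->
  uniq [:: e1; e2; e3] -> uniq [:: x; y; z] ->
  x \in e1 -> x \in e2 -> y \in e2 -> y \in e3 -> z \in e3 -> z \in e1 -> False.
Proof.
move=> h1 h2 h3 ue ux a1 a2 b2 b3 c3 c1.
apply: (@uncH 3) => //.
exists (tnth [tuple e1; e2; e3]), (tnth [tuple x; y; z]); split.
- exact/tuple_uniqP.
- exact/tuple_uniqP.
- by case=> [[|[|[|i]]] li].
- case=> [[|[|[|i]]] li] //; rewrite in_setI ?(tnth_nth x) ?(tnth_nth e1) /=;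
  by rewrite ?a1 ?a2 ?b2 ?b3 ?c3 ?c1.
Qed.

Lemma no_4cycle e1 e2 e3 e4 x y z t :
  e1 \in H -> e2 \in H -> e3 \in H -> e4 \in H ->
  uniq [:: e1; e2; e3; e4] -> uniq [:: x; y; z; t] ->
  x \in e1 -> x \in e2 -> y \in e2 -> y \in e3 -> z \in e3 -> z \in e4 ->
  t \in e4 -> t \in e1 -> False.
Proof.
move=> h1 h2 h3 h4 ue ux a1 a2 b2 b3 c3 c4 d4 d1.
apply: (@uncH 4) => //.
exists (tnth [tuple e1; e2; e3; e4]), (tnth [tuple x; y; z; t]); split.
- exact/tuple_uniqP.
- exact/tuple_uniqP.
- by case=> [[|[|[|[|i]]]] li].
- case=> [[|[|[|[|i]]]] li] //; rewrite in_setI ?(tnth_nth x) ?(tnth_nth e1) /=;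
  by rewrite ?a1 ?a2 ?b2 ?b3 ?c3 ?c4 ?d4 ?d1.
Qed.

(** The vertices whose trials decide what happens to u once the edges through v are ignored. *)
Definition reach v u : {set V} :=
  u |: \bigcup_(f in H | (u \in f) && (v \notin f)) f.

Lemma reachP v u w :
  reflect (w = u \/ exists f, [/\ f \in H, u \in f, v \notin f & w \in f])
          (w \in reach v u).
Proof.
rewrite in_setU1; apply: (iffP orP) => [[/eqP ->|/bigcupP[f]]|[->|[f [fH uf vf wf]]]].
- by left.
- by move=> /andP[fH /andP[uf vf]] wf; right; exists f.
- by rewrite eqxx; left.
- by right; apply/bigcupP; exists f; rewrite // fH uf.
Qed.

Lemma notin_reach v u : u != v -> v \notin reach v u.
Proof.
by move=> uv; apply/reachP => -[/eqP|[f [_ _ /negP vf /vf]]] //; rewrite eq_sym (negPf uv).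
Qed.

(** A common vertex w, reached through f from u and f' from u', closes the walk v, u, w, u' along e,
    f, f', e': a 4-cycle in general. When edges or vertices coincide it degenerates to a 3-cycle or
    a 2-cycle. *)
Lemma reach_disjoint v e e' u u' : e \in H -> e' \in H -> v \in e -> v \in e' ->
  u \in e -> u' \in e' -> u != v -> u' != v -> u != u' ->
  [disjoint reach v u & reach v u'].
Proof.
move=> eH e'H ve ve' ue u'e' uv u'v uu'.
(* A single edge avoiding v that joins u to u' gives a 2-cycle with e when e = e', and a triangle
   through v otherwise. *)
have common f : f \in H -> v \notin f -> u \in f -> u' \in f -> False.
  move=> fH vf uf u'f.
  have ef : e != f by apply: contraNneq vf => <-.
  have e'f : e' != f by apply: contraNneq vf => <-.
  have [ee'|ee'] := eqVneq e e'.
    by apply: (no_2cycle eH fH ef uu' ue uf _ u'f); rewrite ee'.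
  apply: (@no_3cycle e e' f v u' u) => //=.
    by rewrite !inE negb_or ee' ef e'f.
  by rewrite !inE negb_or eq_sym u'v eq_sym uv eq_sym uu'.
rewrite -setI_eq0; apply/eqP/setP => w; rewrite in_set0 in_setI; apply/negP => /andP[].
move=> /reachP[->|[f [fH uf vf wf]]] /reachP[eqw|[f' [f'H u'f' vf' wf']]].
- by rewrite eqw eqxx in uu'.
- exact: common wf' u'f'.
- by subst w; exact: common uf wf.
have [ff'|ff'] := eqVneq f f'; first by apply: (common f) => //; rewrite ff'.
have [wu|wu] := eqVneq w u; first by apply: (common f') => //; rewrite -wu.
have [wu'|wu'] := eqVneq w u'; first by apply: (common f) => //; rewrite -wu'.
have ef : e != f by apply: contraNneq vf => <-.
have e'f : e' != f by apply: contraNneq vf => <-.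
have ef' : e != f' by apply: contraNneq vf' => <-.
have e'f' : e' != f' by apply: contraNneq vf' => <-.
have [ee'|ee'] := eqVneq e e'.
  apply: (@no_3cycle e f f' u w u') => //=; last by rewrite ee'.
    by rewrite !inE negb_or ef ef' ff'.
  by rewrite !inE negb_or eq_sym wu uu' wu'.
apply: (@no_4cycle e f f' e' u w u' v) => //=.
  by rewrite !inE !negb_or ef ef' ee' ff' eq_sym e'f eq_sym e'f'.
have vw : w != v by apply: contraNneq vf => <-.
by rewrite !inE !negb_or eq_sym wu uu' uv wu' vw u'v.
Qed.

Lemma sub_edge_disjoint v e f : e \in H -> f \in H -> v \in e -> v \in f -> e != f ->
  [disjoint e :\ v & f :\ v].
Proof.
move=> eH fH ve vf ef; rewrite -setI_eq0; apply/eqP/setP => w.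
rewrite in_set0 !inE; apply/negP => /andP[/andP[wv we] /andP[_ wf]].
exact: (no_2cycle eH fH ef wv we wf ve vf).
Qed.

Definition nb v : {set V} := v |: \bigcup_(e in H | v \in e) e.
(** The outcome of a round at u is decided by trials on [nb u]; a bad event at v inspects the
    outcomes on [nb v], hence trials on this set. *)
Definition ball2 v : {set V} := \bigcup_(u in nb v) nb u.

Lemma nbP v w :
  reflect (w = v \/ exists e, [/\ e \in H, v \in e & w \in e]) (w \in nb v).
Proof.
rewrite in_setU1; apply: (iffP orP) => [[/eqP ->|/bigcupP[f]]|[->|[f [fH uf wf]]]].
- by left.
- by move=> /andP[fH uf] wf; right; exists f.
- by rewrite eqxx; left.
- by right; apply/bigcupP; exists f; rewrite // fH uf.
Qed.

Lemma nb_sym v w : (w \in nb v) = (v \in nb w).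
Proof.
by apply/nbP/nbP => -[->|[e [eH ve we]]]; [left|right; exists e|left|right; exists e].
Qed.

Lemma ball2_sym v w : (w \in ball2 v) = (v \in ball2 w).
Proof.
by apply/bigcupP/bigcupP => -[u uv uw]; exists u; rewrite // nb_sym.
Qed.

Lemma nb_self v : v \in nb v. Proof. by apply/nbP; left. Qed.

Lemma nb_sub_ball2 v u : u \in nb v -> nb u \subset ball2 v.
Proof. by move=> uv; apply/subsetP => w wu; apply/bigcupP; exists u. Qed.

Lemma leq_card_bigcup (X : {set V}) (F : V -> {set V}) n :
  (forall x, x \in X -> (#|F x| <= n)%N) -> (#|\bigcup_(x in X) F x| <= #|X| * n)%N.
Proof.
move=> Fn; have H1 : (#|\bigcup_(x in X) F x| <= \sum_(x in X) #|F x|)%N.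
  apply: (big_ind2 (fun (Y : {set V}) m => #|Y| <= m)%N) => //; first by rewrite cards0.
  move=> Y1 m1 Y2 m2 h1 h2; rewrite (leq_trans (leq_card_setU _ _)) ?leq_add //.
by apply: (leq_trans H1); rewrite -sum_nat_const leq_sum.
Qed.

Lemma card_nb k v : uniform k H -> (#|nb v| <= 1 + k * max_degree H)%N.
Proof.
move=> /forall_inP uniH; rewrite (leq_trans (leq_card_setU _ _)) // cards1 leq_add2l.
have H1 : (#|\bigcup_(e in H | v \in e) e| <= \sum_(e in H | v \in e) #|e|)%N.
  apply: (big_ind2 (fun (Y : {set V}) m => #|Y| <= m)%N) => //; first by rewrite cards0.
  move=> Y1 m1 Y2 m2 h1 h2; rewrite (leq_trans (leq_card_setU _ _)) ?leq_add //.
apply: (leq_trans H1).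
rewrite (eq_bigr (fun=> k)); last by move=> e /andP[/uniH /eqP].
rewrite sum_nat_const mulnC leq_mul2l.
have -> : #|[pred e in H | v \in e]| = degree H v.
  by apply: eq_card => e; rewrite !inE.
by rewrite /max_degree (leq_bigmax v) orbT.
Qed.

Lemma card_ball2 k v : uniform k H -> (#|ball2 v| <= (1 + k * max_degree H) ^ 2)%N.
Proof.
move=> uniH; rewrite (leq_trans (leq_card_bigcup (n := 1 + k * max_degree H) _)) //.
  by move=> x _; exact: card_nb.
by rewrite expnS expn1 leq_mul2r card_nb ?orbT.
Qed.

(** This is the dependency degree in the local lemma applied to a round. *)
Lemma card_ball2_meet k v : uniform k H ->
  (#|[set w | ~~ [disjoint ball2 w & ball2 v]]| <= (1 + k * max_degree H) ^ 4)%N.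
Proof.
move=> uniH; apply: (@leq_trans #|\bigcup_(x in ball2 v) ball2 x|).
  apply: subset_leq_card; apply/subsetP => w; rewrite inE -setI_eq0 => /set0Pn[x].
  by rewrite inE => /andP[xw xv]; apply/bigcupP; exists x; rewrite // ball2_sym.
rewrite (leq_trans (leq_card_bigcup (n := (1 + k * max_degree H) ^ 2) _)) //.
  by move=> x _; exact: card_ball2.
by rewrite (expnD _ 2 2) leq_mul2r card_ball2 ?orbT.
Qed.

End Uncrowded.

(** * Partial colorings and threatening edges *)

Section Bernoulli.
Variables (R : realType) (I : finType) (p : I -> R).
Hypothesis p01 : forall i, 0 <= p i <= 1.

Lemma bernoulli_ge0 i (b : bool) : 0 <= (if b then p i else 1 - p i).
Proof. by have /andP[p0 p1] := p01 i; case: b; rewrite ?subr_ge0. Qed.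

Lemma bernoulli_sum1 i : \sum_(b : bool) (if b then p i else 1 - p i) = 1.
Proof. by rewrite big_bool /= addrC subrK. Qed.

Definition bernoulli : product_law R I bool := ProductLaw bernoulli_ge0 bernoulli_sum1.

Lemma Pr_bernoulli i : Pr bernoulli (fun om => om i) = p i.
Proof. by rewrite (Pr_coord _ _ (fun b : bool => b)) (big_pred1 true) //; case. Qed.

End Bernoulli.

(** Weierstrass product inequality. The induction has to carry along that the product stays in
    [0, 1]. *)
Lemma prod_1B_ge (R : realDomainType) (J : finType) (Q : pred J) (x : J -> R) :
  (forall j, Q j -> 0 <= x j <= 1) ->
  1 - \sum_(j | Q j) x j <= \prod_(j | Q j) (1 - x j).
Proof.
move=> x01; suff : 1 - \sum_(j | Q j) x j <= \prod_(j | Q j) (1 - x j) /\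
    0 <= \prod_(j | Q j) (1 - x j) <= 1 by case.
apply: (big_rec2 (fun (s t : R) => 1 - s <= t /\ 0 <= t <= 1)).
  by rewrite subr0 lexx ler01.
move=> j s t /x01 /andP[x0 x1] [st /andP[t0 t1]]; split; nra.
Qed.

Section State.
Variables (R : realType) (V C : finType) (H : hypergraph V) (r : nat).
Implicit Types (phi : V -> option C) (A : V -> {set C}) (c : C) (u v w : V).

Definition colored phi u c := phi u == Some c.
Definition listed phi A u c := (phi u == None) && (c \in A u).
Definition alive phi A u c := colored phi u c || listed phi A u c.

(* The edges that may still become monochromatic in color c through v. *)
Definition threats phi A v c : {set {set V}} :=
  [set e in H | (v \in e) && [forall u in e :\ v, alive phi A u c]].

Definition colset phi c (X : {set V}) := [set u in X | colored phi u c].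
Definition lstset phi A c (X : {set V}) := [set u in X | listed phi A u c].

Definition class phi A v c j : {set {set V}} :=
  [set e in threats phi A v c | #|colset phi c (e :\ v)| == j].

(** [state_open] says that every listed color is still safe, so the classes j < r exhaust the
    threats. The window of [state_size] bounds lists on both sides: from below for the survival
    estimates, from above for the union bounds over the colors of a list. *)
Record state phi A (l : R) (D : nat -> R) : Prop := State {
  state_proper : forall e c, e \in H -> ~~ [forall u in e, colored phi u c];
  state_size : forall v, phi v = None -> l <= #|A v|%:R < l + 1;
  state_open : forall v c, listed phi A v c -> class phi A v c r = set0;
  state_class : forall v c j, listed phi A v c -> (j < r)%N ->
    #|class phi A v c j|%:R <= D j }.

Lemma in_class phi A v c j e : (e \in class phi A v c j) =
  [&& e \in H, v \in e, [forall u in e :\ v, alive phi A u c] &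
      #|colset phi c (e :\ v)| == j].
Proof. by rewrite !inE -!andbA. Qed.

Lemma colored_listedF phi A u c : colored phi u c -> listed phi A u c = false.
Proof. by rewrite /colored /listed => /eqP ->. Qed.

Hypothesis uniH : uniform r.+1 H.

Lemma card_edgeD1 e v : e \in H -> v \in e -> #|e :\ v| = r.
Proof.
move=> /(forall_inP uniH) /eqP ce ve.
by move: (cardsD1 v e); rewrite ve ce => -[].
Qed.

Lemma card_lstset phi A v c e : e \in threats phi A v c ->
  (#|lstset phi A c (e :\ v)| + #|colset phi c (e :\ v)|)%N = r.
Proof.
rewrite inE => /and3P[eH ve /forall_inP al].
rewrite -(card_edgeD1 eH ve) -(cardsID (colset phi c (e :\ v)) (e :\ v)) addnC.
congr (_ + _)%N; apply: eq_card => u; rewrite in_set ?in_setI ?in_setD ?[in RHS]in_set.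
  by rewrite andbA andbb.
have := al u; rewrite !(inE, in_set1) in al *; case: (u != v); case: (u \in e) => //=;
  rewrite ?andbF //= => /(_ isT).
by rewrite /alive; case: (boolP (colored _ _ _)) => //= /colored_listedF -> .
Qed.

Lemma sum_threats phi A l D v c (F : nat -> R) :
  state phi A l D -> listed phi A v c -> 
  \sum_(e in threats phi A v c) F #|colset phi c (e :\ v)| =
  \sum_(j < r) #|class phi A v c j|%:R * F j.
Proof.
move=> st lvc.
have lt e : e \in threats phi A v c -> (#|colset phi c (e :\ v)| < r)%N.
  move=> et; have := card_lstset et; rewrite ltn_neqAle => cc.
  rewrite -[X in (_ <= X)%N]cc leq_addl andbT; apply/eqP => er.
  have : e \in class phi A v c r by rewrite inE et er eqxx.
  by rewrite (state_open st lvc) inE.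
under [RHS]eq_bigr => j _.
  rewrite -sum1_card natr_sum mulr_suml.
  rewrite (eq_bigl (fun e => (e \in threats phi A v c) && (#|colset phi c (e :\ v)| == j))); last first.
    by move=> e; rewrite !inE.
  rewrite big_mkcondr /=.
  over.
rewrite exchange_big /=; apply: eq_bigr => e /lt ltr.
rewrite (bigD1 (Ordinal ltr)) //= eqxx mul1r big1 ?addr0 // => j /eqP ne.
by case: eqP => // ej; case: ne; apply: val_inj.
Qed.

Lemma sum_threats_le phi A l D v c (F : nat -> R) :
  state phi A l D -> listed phi A v c -> (forall j, (j < r)%N -> 0 <= F j) ->
  \sum_(e in threats phi A v c) F #|colset phi c (e :\ v)| <= \sum_(j < r) D j * F j.
Proof.
move=> st lvc F0; rewrite (sum_threats F st lvc); apply: ler_sum => j _.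
by rewrite ler_wpM2r ?F0 // (state_class st).
Qed.

End State.

(** * One random round *)

Section Round.
Variables (R : realType) (V C : finType) (H : hypergraph V) (r : nat).
Hypotheses (uniH : uniform r.+1 H) (uncH : uncrowded H).
Variables (phi : V -> option C) (A : V -> {set C}) (l : R) (D : nat -> R).
Hypothesis st : state H r phi A l D.
Variables (alpha kappa : R).
Hypotheses (alpha01 : 0 < alpha < 1) (kappa01 : 0 < kappa <= 1).
Hypothesis kappaD : \sum_(j < r) D j * alpha ^+ (r - j) <= 1 - kappa.

Implicit Types (c : C) (u v w : V) (e f : {set V}).

Notation col := (colored phi).
Notation lst := (listed phi A).
Notation alv := (alive phi A).
Notation lset := (lstset phi A).

(* A coordinate (u, c, true) decides whether c is activated at u; the coordinate
   (u, c, false) is the coin equalizing the survival probabilities. *)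
Definition trial := (V * C * bool)%type.

Definition full_prob v c f : R :=
  if [forall u in f :\ v, alv u c] then alpha ^+ #|lset c (f :\ v)| else 0.

(** The probability that no edge at v blocks c: edges through v share no other vertex, whence the
    product. *)
Definition nofull_prob v c : R := \prod_(f in H | v \in f) (1 - full_prob v c f).

Definition trial_prob (i : trial) : R :=
  if i.2 then alpha else if lst i.1.1 i.1.2 then kappa / nofull_prob i.1.1 i.1.2 else 0.

Lemma alpha_exp01 n : 0 <= alpha ^+ n <= 1.
Proof.
have /andP[a0 a1] := alpha01.
by rewrite exprn_ge0 ?(ltW a0) //= exprn_ile1 // ltW.
Qed.

Lemma full_prob01 v c f : 0 <= full_prob v c f <= 1.
Proof. by rewrite /full_prob; case: ifP => _; rewrite ?alpha_exp01 // lexx ler01. Qed.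

(** This makes kappa / [nofull_prob] a legitimate coin bias. Edges that are not threats contribute 0
    to the sum produced by the Weierstrass inequality, and the others are controlled by [kappaD]. *)
Lemma nofull_prob_ge v c : lst v c -> kappa <= nofull_prob v c.
Proof.
move=> lvc.
apply: le_trans (prod_1B_ge (fun f _ => full_prob01 v c f)).
rewrite lerBrDr addrC -lerBrDr; apply: le_trans kappaD.
apply: le_trans (sum_threats_le uniH (F := fun j => alpha ^+ (r - j)) st lvc _); last first.
  by move=> j _; case/andP: (alpha_exp01 (r - j)).
rewrite le_eqVlt; apply/orP; left; apply/eqP.
rewrite big_mkcondr [LHS]big_mkcond [RHS]big_mkcond; apply: eq_bigr => f _.
case: (boolP (f \in threats _ _ _ _ _)) => ft.
  have := card_lstset uniH ft; move: (ft); rewrite inE /full_prob => /and3P[-> -> ->].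
  by move=> <-; rewrite addnK.
move: ft; rewrite inE /full_prob.
by case: (f \in H); case: (v \in f) => //= /negPf ->.
Qed.

Lemma trial_prob01 i : 0 <= trial_prob i <= 1.
Proof.
rewrite /trial_prob; case: i.2; first by rewrite -[alpha]expr1 alpha_exp01.
case: ifP => [l1|_]; last by rewrite lexx ler01.
have /andP[k0 k1] := kappa01; have h := nofull_prob_ge l1.
have n0 : 0 < nofull_prob i.1.1 i.1.2 by apply: lt_le_trans h.
by rewrite divr_ge0 ?(ltW k0) ?(ltW n0) //= ler_pdivrMr // mul1r.
Qed.

Definition round_law : product_law R trial bool := bernoulli trial_prob01.
Local Notation P := round_law.
Local Notation Omega := {ffun trial -> bool}.
Implicit Types om : Omega.

Definition act om u c := om (u, c, true).
(** An activation at u counts whether or not c survives at u. This blocks a few more colors, but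
    keeps the event a function of the activations on one edge alone. *)
Definition full om v c f := [forall u in f :\ v, col u c || (lst u c && act om u c)].

(* Restricting to edges avoiding X: X = set0 gives actual survival; with X = [set v]
   survival no longer depends on the activations at v. *)
Definition kept (X : {set V}) om u c :=
  om (u, c, false) &&
  [forall f in H, (u \in f) && [disjoint f & X] ==> ~~ full om u c f].

Lemma Pr_act u c : Pr P (fun om => act om u c) = alpha.
Proof. exact: Pr_bernoulli. Qed.

Lemma depends_act u c (S : {set trial}) : (u, c, true) \in S ->
  depends_on (fun om => act om u c) S.
Proof. exact: depends_on_coord. Qed.

Lemma depends_full v c f (S : {set trial}) :
  (forall w, w \in f :\ v -> (w, c, true) \in S) ->
  depends_on (fun om => full om v c f) S.
Proof.
move=> fS om om' e; apply: eq_forallb => w.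
by case wf : (w \in f :\ v) => //=; rewrite /act (e _ (fS _ wf)).
Qed.

Lemma depends_kept (X : {set V}) u c (S : {set trial}) : (u, c, false) \in S ->
  (forall f w, f \in H -> u \in f -> [disjoint f & X] -> w \in f :\ u -> (w, c, true) \in S) ->
  depends_on (fun om => kept X om u c) S.
Proof.
move=> uS fS om om' e; rewrite /kept (e _ uS); congr (_ && _).
apply: eq_forallb => f; case fH : (f \in H) => //=.
case uf : (u \in f) => //=; case fX : [disjoint f & X] => //=.
by rewrite (depends_full (S := S) _ e) // => w wf; apply: fS wf.
Qed.

Lemma Pr_full v c f : Pr P (fun om => full om v c f) = full_prob v c f.
Proof.
rewrite /full_prob; case: forall_inP => [al|nal]; last first.
  rewrite /Pr -[RHS](Ex_cst P); apply: eq_Ex => om.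
  case: (boolP (full om v c f)) => // /forall_inP fu.
  case: nal => u /fu; rewrite /alive; case: (col u c) => //=.
  by case: (lst u c).
have -> : Pr P (fun om => full om v c f) =
    Pr P (fun om => [forall u in lset c (f :\ v), act om u c]).
  apply: eq_Pr => om; apply/forall_inP/forall_inP => fu u.
    rewrite inE => /andP[uf lu]; move: (fu u uf).
    rewrite lu orbC; case: (act _ _ _) => //= co.
    by rewrite (colored_listedF _ co) in lu.
  move=> uf; move: (al u uf); rewrite /alive; case: (boolP (col u c)) => //= _ lu.
  by rewrite lu fu // inE uf.
rewrite (Pr_forall _ (S := fun u => [set (u, c, true)])).
- rewrite (eq_bigr (fun=> alpha)) => [|u _]; last exact: Pr_act.
  by rewrite prodr_const.
- by move=> u _; apply: depends_act; rewrite inE.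
by move=> u u' _ _ uu'; rewrite disjoints1 inE xpair_eqE xpair_eqE !eqxx !andbT.
Qed.

(** Without 2-cycles the edges at v read disjoint sets of trials, so the probability of no blocking
    is exactly [nofull_prob], which the bias of the coin cancels. *)
Lemma Pr_kept v c : lst v c -> Pr P (fun om => kept set0 om v c) = kappa.
Proof.
move=> lvc.
pose S : {set trial} := [set i | (i.2 == true) ].
pose Hv : {set {set V}} := [set f in H | v \in f].
have -> : Pr P (fun om => kept set0 om v c) =
    Pr P (predI (fun om => om (v, c, false))
      (fun om => [forall f in Hv, ~~ full om v c f])).
  apply: eq_Pr => om /=; congr (_ && _); apply/forall_inP/forall_inP => h f.
    by rewrite inE => /andP[fH vf]; move: (h f fH); rewrite vf -setI_eq0 setI0 eqxx.
  by move=> fH; apply/implyP => /andP[vf _]; apply: h; rewrite inE fH.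
rewrite (Pr_indep _ (S1 := [set (v, c, false)]) (S2 := S)).
- rewrite Pr_bernoulli /trial_prob /= lvc.
  rewrite (Pr_forall _ (S := fun f => [set (u, c, true) | u in f :\ v])).
  + have -> : \prod_(f in Hv) Pr P (fun om => ~~ full om v c f) = nofull_prob v c.
      rewrite /nofull_prob; apply: eq_big => [f|f _]; first by rewrite inE.
      by rewrite -Pr_full -PrC.
    rewrite divfK //; apply: lt0r_neq0.
    by apply: lt_le_trans (nofull_prob_ge lvc); case/andP: kappa01.
  + move=> f _; apply: (depends_on_comp negb); apply: depends_full => w wf.
    exact: imset_f.
  move=> f f'; rewrite !inE => /andP[fH vf] /andP[f'H vf'] ff'.
  have dis := sub_edge_disjoint uncH fH f'H vf vf' ff'.
  rewrite -setI_eq0; apply/eqP/setP => i; rewrite in_set0 in_setI; apply/negP.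
  move=> /andP[/imsetP[w wf ->] /imsetP[w' wf' [ww']]].
  by move: (disjointFr dis wf); rewrite ww' wf'.
- by apply: depends_on_coord; rewrite inE.
- move=> om om' e; apply: eq_forallb => f; congr (_ ==> ~~ _).
  by apply: (depends_full (S := S) _ e) => w _; rewrite inE.
by rewrite disjoints1 inE.
Qed.

(* An edge through both u and v can block c at u only if c is activated at v. *)
Lemma Pr_kept_avoid v u c : phi v = None -> u != v -> lst u c ->
  kappa <= Pr P (fun om => kept [set v] om u c) <= kappa / (1 - alpha).
Proof.
move=> phiv uv luc; have /andP[a0 a1] := alpha01; apply/andP; split.
  rewrite -(Pr_kept luc); apply: sub_Pr => om /andP[coin /forall_inP h]; rewrite /kept coin /=.
  apply/forall_inP => f /h /implyP k; apply/implyP => /andP[uf _]; apply: k.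
  by rewrite uf -setI_eq0 setI0 eqxx.
rewrite ler_pdivlMr ?subr_gt0 // -(Pr_kept luc).
have -> : 1 - alpha = Pr P (predC (fun om => act om v c)) by rewrite PrC Pr_act.
rewrite -(Pr_indep _ (S1 := ~: [set (v, c, true)]) (S2 := [set (v, c, true)])).
- apply: sub_Pr => om /= /andP[/andP[coin /forall_inP h] nact].
  rewrite /kept coin /=; apply/forall_inP => f fH; apply/implyP => /andP[uf _].
  have := h f fH; rewrite uf /=; case: (boolP (v \in f)) => [vf _|vf].
    apply/negP => /forall_inP /(_ v); rewrite !inE vf eq_sym uv => /(_ isT).
    by rewrite (negPf nact) andbF orbF /colored phiv.
  by rewrite disjoint_sym disjoints1 vf.
- apply: depends_kept; first by rewrite !inE xpair_eqE andbF.
  move=> f w fH uf dfv wf; rewrite !inE; apply: contraTN wf => /eqP[->].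
  by rewrite !inE; move: dfv; rewrite disjoint_sym disjoints1 => /negPf ->; rewrite andbF.
- by apply: (depends_on_comp negb); apply: depends_act; rewrite inE.
by rewrite disjoint_sym disjoints1 !inE negbK.
Qed.

End Round.

(** * Concentration of the class sizes *)

(** The strict bound on the size of S leaves room for removing c as well. *)
Lemma card_setD_setD1 (T : finType) (A S : {set T}) (c : T) s :
  (#|S| < s)%N -> (#|A| - s <= #|(A :\: S) :\ c|)%N.
Proof.
move=> cS; have := cardsID S A; have := subset_leq_card (subsetIr A S).
by have := cardsD1 c (A :\: S); case: (c \in _) => /=; lia.
Qed.

(** * The partial coloring and the lists produced by a round *)

Section Outcome.
Variables (V C : finType) (H : hypergraph V).
Variables (phi : V -> option C) (A : V -> {set C}).
Implicit Types om : {ffun trial V C -> bool}.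

Definition new_coloring om u : option C :=
  if phi u is Some c then Some c
  else [pick c in A u | act om u c && kept H phi A set0 om u c].

Definition new_lists om u : {set C} := [set c in A u | kept H phi A set0 om u c].

Definition activated om v : {set C} := [set c in A v | act om v c].

Lemma new_coloring_old om u c : phi u = Some c -> new_coloring om u = Some c.
Proof. by rewrite /new_coloring => ->. Qed.

Lemma new_coloring_Some om u c : phi u = None -> new_coloring om u = Some c ->
  [/\ c \in A u, act om u c & kept H phi A set0 om u c].
Proof.
rewrite /new_coloring => ->; case: pickP => // c' /andP[cA /andP[a k]] [<-].
by rewrite cA.
Qed.

Lemma new_coloring_None om u : new_coloring om u = None ->
  phi u = None /\ forall c, c \in A u -> ~~ (act om u c && kept H phi A set0 om u c).
Proof.
rewrite /new_coloring; case: (phi u) => // ; case: pickP => // no _; split=> // c cA.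
by have := no c; rewrite cA => /negbT.
Qed.

Lemma kept_set0W (X : {set V}) om u c :
  kept H phi A set0 om u c -> kept H phi A X om u c.
Proof.
move=> /andP[coin /forall_inP h]; rewrite /kept coin /=.
apply/forall_inP => f /h /implyP k; apply/implyP => /andP[uf _]; apply: k.
by rewrite uf -setI_eq0 setI0 eqxx.
Qed.

(** An edge through u and v blocks c at u only if v is colored or activated with c. So, outside the
    colors activated at v, ignoring the edges through v does not change survival. *)
Lemma kept_avoidK om v u c : phi v = None -> u != v -> c \notin activated om v ->
  kept H phi A [set v] om u c -> kept H phi A set0 om u c.
Proof.
move=> phiv uv cS /andP[coin /forall_inP h]; rewrite /kept coin /=.
apply/forall_inP => f fH; apply/implyP => /andP[uf _].
case: (boolP (v \in f)) => vf; last first.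
  by have := h f fH; rewrite uf disjoint_sym disjoints1 vf.
apply/negP => /forall_inP /(_ v); rewrite !inE vf eq_sym uv => /(_ isT).
rewrite /colored /listed phiv /= => /andP[cA a].
by rewrite inE cA a in cS.
Qed.

Lemma new_alive om u c : alive (new_coloring om) (new_lists om) u c -> alive phi A u c.
Proof.
rewrite /alive /colored /listed => /orP[/eqP|/andP[/eqP/new_coloring_None[-> _]]].
  case E : (phi u) => [c'|]; first by rewrite (new_coloring_old _ E) => ->; rewrite eqxx.
  by move=> /(new_coloring_Some E)[-> _ _]; rewrite orbT.
by rewrite inE => /andP[-> _].
Qed.

End Outcome.

Section Degrees.
Variables (R : realType) (V C : finType) (H : hypergraph V) (r : nat).
Hypotheses (uniH : uniform r.+1 H) (uncH : uncrowded H).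
Variables (phi : V -> option C) (A : V -> {set C}) (l : R) (D : nat -> R).
Hypothesis st : state H r phi A l D.
Variables (alpha kappa : R).
Hypotheses (alpha01 : 0 < alpha < 1) (kappa01 : 0 < kappa <= 1).
Hypothesis kappaD : \sum_(j < r) D j * alpha ^+ (r - j) <= 1 - kappa.

Implicit Types (u w : V) (e f : {set V}).
Local Notation P := (round_law uniH st alpha01 kappa01 kappaD).
Local Notation Omega := {ffun trial V C -> bool}.
Implicit Types om : Omega.

Notation lst := (listed phi A).
Notation lset := (lstset phi A).
Notation cset := (colset phi).
Notation kept := (kept H phi A).

Variables (v : V) (c : C).
Hypothesis lvc : lst v c.

Variables (s : nat) (g : R).
Hypothesis gP : forall m : nat, l <= m%:R ->
  kappa / (1 - alpha) * (1 - alpha * kappa) ^+ (m - s) <= g.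

Let phiv : phi v = None. Proof. by case/andP: lvc => /eqP. Qed.

(* [S0] stands for the colors activated at v. Once it is fixed, the events below
   ignore all the edges through v, hence are independent for distinct u. *)
Definition wins om u := act om u c && kept [set v] om u c.

(** Colors of S0 are dropped because for them [kept [set v]] need not imply actual survival. The
    color c is dropped so that the two conjuncts read trials of different colors. *)
Definition stays (S0 : {set C}) om u :=
  kept [set v] om u c &&
  [forall c' in (A u :\: S0) :\ c, ~~ (act om u c' && kept [set v] om u c')].

(** B stands for the vertices of e that receive color c in this round. The event is only a necessary
    condition for e to land in class j, but its probability factors over the vertices. *)
Definition moves (S0 : {set C}) (j : nat) e om :=
  [exists B : {set V}, [&& B \subset lset c (e :\ v),
    (#|B| + #|cset c (e :\ v)|)%N == j &
    [forall u in lset c (e :\ v), if u \in B then wins om u else stays S0 om u]]].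

Lemma depends_kept_color X u c' (S : {set trial V C}) :
  (forall w b, (w, c', b) \in S) -> depends_on (fun om => kept X om u c') S.
Proof. by move=> h; apply: depends_kept => *; exact: h. Qed.

Lemma depends_kept_reach u c' (S : {set trial V C}) :
  (forall w b, w \in reach H v u -> (w, c', b) \in S) ->
  depends_on (fun om => kept [set v] om u c') S.
Proof.
move=> h; apply: depends_kept => [|f w fH uf dfv wf]; apply: h.
  by rewrite in_setU1 eqxx.
apply/reachP; right; exists f; split=> //.
  by rewrite disjoint_sym disjoints1 in dfv.
by move: wf; rewrite inE => /andP[].
Qed.

Lemma depends_wins u (S : {set trial V C}) :
  (forall w b, w \in reach H v u -> (w, c, b) \in S) ->
  depends_on (fun om => wins om u) S.
Proof.
move=> h; apply: (depends_on2 andb); last exact: depends_kept_reach.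
by apply: depends_act; apply: h; rewrite in_setU1 eqxx.
Qed.

Lemma depends_stays S0 u (S : {set trial V C}) :
  (forall w c' b, w \in reach H v u -> (w, c', b) \in S) ->
  depends_on (fun om => stays S0 om u) S.
Proof.
move=> h; apply: (depends_on2 andb); first by apply: depends_kept_reach => *; exact: h.
apply: depends_on_forall => c'; apply: (depends_on_comp (implb _)).
apply: (depends_on_comp negb); apply: (depends_on2 andb).
  by apply: depends_act; apply: h; rewrite in_setU1 eqxx.
by apply: depends_kept_reach => *; exact: h.
Qed.

Lemma Pr_wins u : Pr P (fun om => wins om u) <= alpha.
Proof.
rewrite -[leRHS](Pr_act uniH st alpha01 kappa01 kappaD u c).
by apply: sub_Pr => om /andP[].
Qed.

(** Survival at u never reads the activations at u, so the two events are independent. *)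
Lemma Pr_act_kept u c' : u != v -> lst u c' ->
  alpha * kappa <= Pr P (fun om => act om u c' && kept [set v] om u c').
Proof.
move=> uv luc; have /andP[a0 _] := alpha01.
have -> : Pr P (fun om => act om u c' && kept [set v] om u c') =
   Pr P (fun om => act om u c') * Pr P (fun om => kept [set v] om u c').
  apply: (Pr_indep _ (S1 := [set (u, c', true)]) (S2 := ~: [set (u, c', true)])).
  - by apply: depends_act; rewrite inE.
  - apply: depends_kept => [|f w fH uf _ wf]; first by rewrite !inE xpair_eqE andbF.
    by rewrite !inE; apply: contraTN wf => /eqP[->]; rewrite !inE eqxx.
  by rewrite disjoints1 !inE negbK.
rewrite Pr_act ler_wpM2l ?(ltW a0) //.
by case/andP: (Pr_kept_avoid uniH uncH st alpha01 kappa01 kappaD phiv uv luc).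
Qed.

Lemma ak01 : 0 <= 1 - alpha * kappa <= 1.
Proof. by have /andP[a0 a1] := alpha01; have /andP[k0 k1] := kappa01; nra. Qed.

(** Trials of distinct colors are independent. Survival of c gives kappa / (1 - alpha), and each
    remaining color of the list, at least m - s of them for a list of size m, gives a factor 1 -
    alpha kappa. *)
Lemma Pr_stays (S0 : {set C}) u : (#|S0| < s)%N -> u != v -> lst u c ->
  Pr P (fun om => stays S0 om u) <= g.
Proof.
move=> cS uv luc; have /andP[/eqP phiu cAu] := luc.
have /andP[lm _] := state_size st phiu; apply: le_trans (gP lm).
pose Q := (A u :\: S0) :\ c.
have -> : Pr P (fun om => stays S0 om u) = Pr P (fun om => kept [set v] om u c) *
    Pr P (fun om => [forall c' in Q, ~~ (act om u c' && kept [set v] om u c')]).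
  apply: (Pr_indep _ (S1 := [set i | i.1.2 == c]) (S2 := ~: [set i | i.1.2 == c])).
  - by apply: depends_kept_color => w b; rewrite inE.
  - move=> om om' e; apply: eq_forallb => c'.
    case cQ : (c' \in Q) => //=; congr (~~ _).
    have c'c : c' != c by move: cQ; rewrite !inE => /andP[].
    rewrite /act e ?inE //; congr (_ && _).
    have h w b : (w, c', b) \in ~: [set i : trial V C | i.1.2 == c] by rewrite !inE.
    exact: (depends_kept_color _ _ h e).
  by rewrite -setI_eq0 setICr.
have /andP[k1 k2] := Pr_kept_avoid uniH uncH st alpha01 kappa01 kappaD phiv uv luc.
have /andP[q0 q1] := ak01.
apply: ler_pM => //; try exact: Pr_ge0.
rewrite (Pr_forall _ (S := fun c' => [set i | i.1.2 == c'])).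
- apply: (@le_trans _ _ (\prod_(c' in Q) (1 - alpha * kappa))).
    apply: ler_prod => c' c'Q; rewrite Pr_ge0 /=.
    rewrite [X in X <= _](_ : _ = 1 - Pr P (fun om => act om u c' && kept [set v] om u c')).
      rewrite lerD2l lerN2 Pr_act_kept // /listed phiu /=.
      by move: c'Q; rewrite !inE => /and3P[].
    by rewrite -PrC.
  rewrite prodr_const; apply: ler_wiXn2l => //.
  exact: card_setD_setD1.
- move=> c' _; apply: (depends_on_comp negb); apply: (depends_on2 andb).
    by apply: depends_act; rewrite inE.
  by apply: depends_kept_color => w b; rewrite inE.
move=> c1 c2 _ _ c12; rewrite -setI_eq0; apply/eqP/setP => i; rewrite !inE.
by apply/negP => /andP[/eqP -> /eqP e]; rewrite e eqxx in c12.
Qed.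

(** From i to j vertices colored c: choose which j - i of the r - i listed vertices win, each with
    probability at most alpha; the other r - j stay, each with probability at most g. *)
Definition move_bound j i : R :=
  (i <= j)%:R * ('C(r - i, j - i)%:R * alpha ^+ (j - i) * g ^+ (r - j)).

Lemma g_ge0 : 0 <= g.
Proof.
have /andP[a0 a1] := alpha01; have /andP[k0 k1] := kappa01; have /andP[q0 q1] := ak01.
have /andP[lm _] := state_size st phiv; apply: le_trans (gP lm).
by rewrite mulr_ge0 ?exprn_ge0 // divr_ge0 ?subr_ge0 ?ltW.
Qed.

Lemma move_bound_ge0 j i : 0 <= move_bound j i.
Proof.
have /andP[a0 a1] := alpha01.
by rewrite !mulr_ge0 // exprn_ge0 // ?g_ge0 ?ltW.
Qed.

(** Union bound over B. For a fixed B the fates of the vertices of e are independent, because their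
    reaches are disjoint. *)
Lemma Pr_moves (S0 : {set C}) j e : (#|S0| < s)%N -> e \in threats H phi A v c ->
  Pr P (fun om => moves S0 j e om) <= move_bound j #|cset c (e :\ v)|.
Proof.
move=> cS et; set i := #|_|; have := et; rewrite inE => /and3P[eH ve _].
have /andP[a0 a1] := alpha01.
pose QB (B : {set V}) := (B \subset lset c (e :\ v)) && ((#|B| + i)%N == j).
apply: (@le_trans _ _ (\sum_(B | QB B) alpha ^+ (j - i) * g ^+ (r - j))).
  apply: (@le_trans _ _ (\sum_(B | QB B) Pr P (fun om =>
    [forall u in lset c (e :\ v), if u \in B then wins om u else stays S0 om u]))).
    by apply: Pr_le_sum => om /existsP[B /and3P[sB cB h]]; exists B; rewrite // /QB sB.
  apply: ler_sum => B /andP[sB /eqP cB].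
  rewrite (Pr_forall _ (S := fun u => [set x : trial V C | x.1.1 \in reach H v u])).
  - apply: (@le_trans _ _ (\prod_(u in lset c (e :\ v)) (if u \in B then alpha else g))).
      apply: ler_prod => u; rewrite !inE => /andP[/andP[uv ue] luc]; rewrite Pr_ge0 /=.
      by case: (u \in B); [exact: Pr_wins | exact: Pr_stays].
    rewrite (bigID (fun u => u \in B)) /=.
    rewrite (eq_bigr (fun=> alpha)); last by move=> u /andP[_ ->].
    rewrite [X in _ * X](eq_bigr (fun=> g)); last by move=> u /andP[_ /negPf ->].
    rewrite !prodr_const le_eqVlt; apply/orP; left; apply/eqP; congr (_ ^+ _ * _ ^+ _).
      rewrite (_ : #|_| = #|B|); first by rewrite -cB addnK.
      apply: eq_card => u; rewrite [LHS]inE andbC.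
      by case: (boolP (u \in B)) => //= /(subsetP sB).
    rewrite (_ : #|_| = #|lset c (e :\ v) :\: B|).
      by rewrite cardsD (setIidPr sB) -(card_lstset uniH et) -/i -cB subnDr.
    by apply: eq_card => u; rewrite [LHS]inE in_setD andbC.
  - move=> u; rewrite !inE => /andP[/andP[uv ue] luc] om om' eq_om.
    case: ifP => _; first by apply: (depends_wins _ eq_om) => w b wu; rewrite inE.
    by apply: (depends_stays _ _ eq_om) => w b c' wu; rewrite inE.
  move=> u u'; rewrite !inE => /andP[/andP[uv ue] _] /andP[/andP[u'v u'e] _] uu'.
  have := reach_disjoint uncH eH eH ve ve ue u'e uv u'v uu'.
  rewrite -!setI_eq0 => /eqP dis; apply/eqP/setP => x.
  by move/setP: dis => /(_ x.1.1); rewrite !in_setI !in_set0 !in_set.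
rewrite sumr_const -[_ *+ _]mulr_natl /move_bound mulrA.
case: (leqP i j) => ij; last first.
  rewrite (eq_card0 (A := QB)) ?mul0r // => B; rewrite unfold_in /QB.
  by apply/negP => /andP[_ /eqP e']; move: ij; rewrite -e' ltnNge leq_addl.
rewrite mul1r ler_wpM2r ?exprn_ge0 ?g_ge0 // ler_wpM2r ?exprn_ge0 ?(ltW a0) //.
rewrite ler_nat -(card_lstset uniH et) -/i addnK -cards_draws leq_eqVlt.
apply/orP; left; apply/eqP; rewrite cardsE; apply: eq_card => B; rewrite !unfold_in /QB.
by congr (_ && _); rewrite -[RHS](eqn_add2r i) subnK.
Qed.

Lemma depends_moves S0 j e (S : {set trial V C}) :
  (forall u w c' b, u \in e :\ v -> w \in reach H v u -> (w, c', b) \in S) ->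
  depends_on (fun om => moves S0 j e om) S.
Proof.
move=> h om om' eq_om; apply: eq_existsb => B; congr [&& _, _ & _].
apply: eq_forallb => u; case ul : (u \in lset c (e :\ v)) => //=.
have ue : u \in e :\ v by move: ul; rewrite inE => /andP[].
case: ifP => _; first by apply: (depends_wins _ eq_om) => *; exact: h ue _.
by apply: (depends_stays _ _ eq_om) => *; exact: h ue _.
Qed.

(** Take for B the newly colored vertices. A vertex that stays uncolored has no color both activated
    and surviving, and [kept_avoidK] transfers this to [kept [set v]] for colors not activated at
    v. *)
Lemma new_class_moves om j e :
  e \in class H (new_coloring H phi A om) (new_lists H phi A om) v c j ->
  e \in threats H phi A v c /\ moves (activated A om v) j e om.
Proof.
rewrite in_class => /and4P[eH ve /forall_inP al /eqP cj].
have et : e \in threats H phi A v c.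
  by rewrite inE eH ve /=; apply/forall_inP => u /al; exact: new_alive.
split=> //; apply/existsP.
pose B := [set u in lset c (e :\ v) | colored (new_coloring H phi A om) u c].
exists B; apply/and3P; split.
- by apply/subsetP => u; rewrite inE => /andP[].
- rewrite -cj -(cardsID (lset c (e :\ v)) (colset (new_coloring H phi A om) c (e :\ v))); apply/eqP.
  congr (_ + _)%N; apply: eq_card => u; rewrite !inE.
    by case: (u == v); case: (u \in e); case: (listed _ _ _ _); case: (colored _ _ _).
  case: (boolP (u == v)) => //= uv; case: (boolP (u \in e)) => //= ue.
  have := al u; rewrite !inE uv ue => /(_ isT) /new_alive; rewrite /alive.
  rewrite andbC; case: (boolP (colored phi u c)) => [co _|nco] /=.
    by rewrite (colored_listedF _ co) andbT /colored (new_coloring_old _ _ _ (eqP co)) eqxx.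
  by move=> ->; rewrite andbF.
apply/forall_inP => u uls; have := uls; rewrite 3!inE => /andP[/andP[uv ue] luc].
have /andP[/eqP phiu cAu] := luc.
have := al u; rewrite !inE uv ue => /(_ isT) alu.
rewrite luc /=; case: ifP => [/eqP|nco].
  by move=> /(new_coloring_Some phiu)[_ a k]; rewrite /wins a kept_set0W.
move: alu; rewrite /alive nco /= /listed => /andP[/eqP/new_coloring_None[_ no]].
rewrite inE => /andP[_ k]; rewrite /stays kept_set0W //=.
apply/forall_inP => c'; rewrite !inE => /and3P[_ c'S c'A].
apply: contra (no c' c'A) => /andP[a k']; rewrite a /=.
by apply: kept_avoidK k' => //; rewrite inE.
Qed.

(** Condition on the value S0 of the set of colors activated at v. The events [moves S0 j e] read no
    trial at v, so they are independent of the conditioning, and of each other for distinct e.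
    Chernoff therefore applies for each S0 with fewer than s colors, and the probabilities of the
    values S0 sum to at most 1. *)
Lemma degree_tail j (x M D' : R) : 0 <= x <= 1 ->
  \sum_(i < r) D i * move_bound j i <= M -> (1 + x) * M <= D' ->
  Pr P (fun om => (#|activated A om v| < s)%N &&
    (D' < #|class H (new_coloring H phi A om) (new_lists H phi A om) v c j|%:R)) <=
  expR (- (x ^+ 2 * M / 8)).
Proof.
move=> x01 sM MD'; pose E0 := threats H phi A v c.
pose big (S0 : {set C}) om := (1 + x) * M <= #|[set e in E0 | moves S0 j e om]|%:R :> R.
have bigP (S0 : {set C}) : (#|S0| < s)%N -> Pr P (big S0) <= expR (- (x ^+ 2 * M / 8)).
  move=> cS.
  apply: (chernoff_upper (S := fun e => [set y : trial V C |
      y.1.1 \in \bigcup_(u in e :\ v) reach H v u])) => //.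
  - move=> e _; apply: depends_moves => u w c' b ue wu.
    by rewrite inE; apply/bigcupP; exists u.
  - move=> e e'; rewrite !inE => /and3P[eH ve _] /and3P[e'H ve' _] ee'.
    rewrite -setI_eq0; apply/eqP/setP => y; rewrite in_set0 !inE; apply/negP => /andP[].
    move=> /bigcupP[u ue yu] /bigcupP[u' u'e yu'].
    have uu' : u != u'.
      have := disjointFr (sub_edge_disjoint uncH eH e'H ve ve' ee') ue.
      by apply: contraFneq => ->.
    move: ue u'e; rewrite !inE => /andP[uv ue] /andP[u'v u'e].
    have := disjointFr (reach_disjoint uncH eH e'H ve ve' ue u'e uv u'v uu') yu.
    by rewrite yu'.
  apply: le_trans sM; apply: le_trans
    (sum_threats_le uniH (F := move_bound j) st lvc (fun i _ => move_bound_ge0 j i)).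
  by apply: ler_sum => e et; exact: Pr_moves.
apply: (@le_trans _ _ (\sum_(S0 : {set C} | (#|S0| < s)%N)
   Pr P (predI (fun om => activated A om v == S0) (big S0)))).
  apply: Pr_le_sum => om /andP[cS lt]; exists (activated A om v) => //=.
  rewrite eqxx /= /big; apply: (le_trans MD'); apply: (le_trans (ltW lt)).
  rewrite ler_nat; apply: subset_leq_card; apply/subsetP => e /new_class_moves[et mo].
  by rewrite inE et mo.
apply: (@le_trans _ _ (\sum_(S0 : {set C} | (#|S0| < s)%N)
   Pr P (fun om => activated A om v == S0) * expR (- (x ^+ 2 * M / 8)))).
  apply: ler_sum => S0 cS.
  rewrite (Pr_indep _ (S1 := [set y | y.1.1 == v]) (S2 := ~: [set y | y.1.1 == v])).
  - by rewrite ler_wpM2l ?Pr_ge0 ?bigP.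
  - move=> om om' eq_om; congr (_ == _); apply/setP => c'; rewrite !inE; congr (_ && _).
    by apply: eq_om; rewrite inE.
  - move=> om om' eq_om; congr (_ <= _%:R); apply: eq_card => e; rewrite !inE.
    case: and3P => //= -[eH ve _]; apply: (depends_moves _ _ _ eq_om) => u w c' b.
    rewrite in_setD1 in_setC in_set /= => /andP[uv _]; apply: contraTN => /eqP ->.
    exact: notin_reach.
  by rewrite -setI_eq0 setICr.
rewrite -mulr_suml -[leRHS]mul1r ler_wpM2r ?expR_ge0 // -Ex_sum.
rewrite -[leRHS](Ex_cst P); apply: le_Ex => om.
rewrite big_mkcond (bigD1 (activated A om v)) //= big1 => [|S0 ne].
  by case: ifP; rewrite ?eqxx addr0 // ler01.
by case: ifP; rewrite // eq_sym (negPf ne).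
Qed.

End Degrees.

(** * One round of the nibble *)

(** Survivor counts fluctuate; cutting the lists to a common size restores a single parameter l for
    the next round. Removing colors only removes threats, so degree bounds persist. *)
Definition trunc_set (T : finType) (n : nat) (B : {set T}) : {set T} :=
  [set x in take n (enum B)].

Lemma trunc_set_sub (T : finType) n (B : {set T}) : trunc_set n B \subset B.
Proof. by apply/subsetP => x; rewrite inE => /mem_take; rewrite mem_enum. Qed.

Lemma card_trunc_set (T : finType) n (B : {set T}) : (n <= #|B|)%N -> #|trunc_set n B| = n.
Proof.
move=> nB; rewrite cardsE (card_uniqP _) ?take_uniq ?enum_uniq //.
by rewrite size_take -cardE; case: ltnP => // /(conj nB)/andP; rewrite -eqn_leq => /eqP.
Qed.

Lemma nat_ceil_exists (R : realType) (x : R) : 0 <= x -> exists n : nat, x <= n%:R < x + 1.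
Proof.
move=> /truncn_itv /andP[]; set m := Num.truncn x => h1 h2.
have [e|ne] := eqVneq x m%:R; first by exists m; rewrite e lexx ltrDl ltr01.
exists m.+1; rewrite ltW //= -addn1 natrD ltrD2r.
by rewrite lt_neqAle eq_sym ne.
Qed.

(** * A round preserves properness and the safety of listed colors *)

Section NewState.
Variables (V C : finType) (H : hypergraph V) (r : nat).
Hypothesis uniH : uniform r.+1 H.
Variables (phi : V -> option C) (A : V -> {set C}) (om : {ffun trial V C -> bool}).
Implicit Types (u v : V) (c : C) (e : {set V}).

Notation phi' := (new_coloring H phi A om).

(** A vertex newly colored c has c activated, and one colored earlier also counts in [full]; an edge
    colored c outside v would thus have blocked c at v. *)
Lemma kept_blocks v c e : phi v = None -> kept H phi A set0 om v c ->
  e \in H -> v \in e -> ~~ [forall u in e :\ v, colored phi' u c].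
Proof.
move=> phiv /andP[_ /forall_inP k] eH ve.
have := k e eH; rewrite ve -setI_eq0 setI0 eqxx /=; apply: contra => /forall_inP h.
apply/forall_inP => u /h /eqP; rewrite /colored /listed.
case E : (phi u) => [c'|]; first by rewrite (new_coloring_old _ _ _ E) => ->; rewrite eqxx.
by move=> /(new_coloring_Some E)[-> -> _]; rewrite orbT.
Qed.

Lemma new_proper e c : (forall e c, e \in H -> ~~ [forall u in e, colored phi u c]) ->
  e \in H -> ~~ [forall u in e, colored phi' u c].
Proof.
move=> old eH; apply/negP => /forall_inP h; have := old e c eH.
rewrite negb_forall_in => /exists_inP[v ve nco].
have := h v ve; rewrite /colored => /eqP; case E : (phi v) => [c'|].
  by rewrite (new_coloring_old _ _ _ E) => -[cc]; rewrite /colored E cc eqxx in nco.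
move=> /(new_coloring_Some E)[_ _ k].
have := kept_blocks E k eH ve; rewrite negb_forall_in => /exists_inP[u].
by rewrite inE => /andP[_ /h ->].
Qed.

Lemma new_open v c : listed phi' (new_lists H phi A om) v c ->
  class H phi' (new_lists H phi A om) v c r = set0.
Proof.
move=> /andP[/eqP/new_coloring_None[phiv _]]; rewrite inE => /andP[cA k].
apply/setP => e; rewrite in_set0 in_class; apply/negP => /and4P[eH ve _ /eqP cr].
have /negP := kept_blocks phiv k eH ve; apply; apply/forall_inP => u ue.
have /eqP ce : colset phi' c (e :\ v) == e :\ v.
  rewrite eqEcard cr (card_edgeD1 uniH eH ve) leqnn andbT.
  by apply/subsetP => w; rewrite inE => /andP[].
by move: ue; rewrite -{1}ce inE => /andP[].
Qed.

End NewState.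

Lemma class_subset (V C : finType) (H : hypergraph V) (phi : V -> option C)
  (A A' : V -> {set C}) v c j :
  (forall u, A' u \subset A u) -> class H phi A' v c j \subset class H phi A v c j.
Proof.
move=> sA; apply/subsetP => e; rewrite !in_class => /and4P[-> -> /forall_inP al ->].
rewrite /= andbT; apply/forall_inP => u /al; rewrite /alive /listed.
by case: (colored _ _ _) => //= /andP[-> /(subsetP (sA u)) ->].
Qed.

Section Step.
Variables (R : realType) (V C : finType) (H : hypergraph V) (r : nat).
Hypotheses (uniH : uniform r.+1 H) (uncH : uncrowded H).
Variables (phi : V -> option C) (A : V -> {set C}) (l : R) (D : nat -> R).
Hypothesis st : state H r phi A l D.
Variables (alpha kappa : R).
Hypotheses (alpha01 : 0 < alpha < 1) (kappa01 : 0 < kappa <= 1).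
Hypothesis kappaD : \sum_(j < r) D j * alpha ^+ (r - j) <= 1 - kappa.
Variables (s : nat) (g x l' b p : R) (M D' : nat -> R).
Hypothesis gP : forall m : nat, l <= m%:R ->
  kappa / (1 - alpha) * (1 - alpha * kappa) ^+ (m - s) <= g.
Hypotheses (x01 : 0 <= x <= 1) (l0 : 0 <= l) (l'0 : 0 <= l').
Hypothesis MP : forall j, (j < r)%N -> \sum_(i < r) D i * move_bound r alpha g j i <= M j.
Hypothesis D'P : forall j, (j < r)%N -> (1 + x) * M j <= D' j.
Hypothesis l'P : l' <= (1 - x) * (kappa * l).
Hypothesis sP : alpha * (l + 1) <= s%:R / 2.
Hypothesis bP : forall j, (j < r)%N -> expR (- (x ^+ 2 * M j / 8)) <= b.
Hypothesis pP : expR (- (s%:R / 16)) + expR (- (x ^+ 2 * (kappa * l) / 8)) +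
  (l + 1) * (r%:R * b) <= p.
Hypothesis pD : p * (1 + r.+1 * max_degree H)%:R ^+ 4 <= 1 / 4.

Local Notation P := (round_law uniH st alpha01 kappa01 kappaD).
Implicit Types (u v w : V) (om : {ffun trial V C -> bool}).

Notation newc om := (new_coloring H phi A om).
Notation newA om := (new_lists H phi A om).

Definition degree_bad v om := (#|activated A om v| < s)%N &&
  [exists c in A v, exists j : 'I_r, D' j < #|class H (newc om) (newA om) v c j|%:R].

Definition bad v om := (phi v == None) &&
  [|| #|newA om v|%:R < l', (s <= #|activated A om v|)%N | degree_bad v om].

Lemma Pr_short_list v : phi v = None ->
  Pr P (fun om => #|newA om v|%:R < l') <= expR (- (x ^+ 2 * (kappa * l) / 8)).
Proof.
move=> phiv; have /andP[k0 k1] := kappa01.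
apply: (@le_trans _ _ (Pr P (fun om => #|newA om v|%:R <= (1 - x) * (kappa * l)))).
  by apply: sub_Pr => om /ltW h; apply: le_trans h l'P.
apply: (chernoff_lower (S := fun c => [set y | y.1.2 == c])) => //.
- by move=> c _; apply: depends_kept_color => w b'; rewrite inE.
- move=> c1 c2 _ _ c12; rewrite -setI_eq0; apply/eqP/setP => i; rewrite !inE.
  by apply/negP => /andP[/eqP -> /eqP e]; rewrite e eqxx in c12.
rewrite mulr_ge0 ?(ltW k0) //= (eq_bigr (fun=> kappa)).
  rewrite sumr_const -[_ *+ _]mulr_natr ler_wpM2l ?(ltW k0) //.
  by case/andP: (state_size st phiv).
by move=> c cA; apply: Pr_kept => //; rewrite /listed phiv.
Qed.

Lemma Pr_many_activated v : phi v = None ->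
  Pr P (fun om => (s <= #|activated A om v|)%N) <= expR (- (s%:R / 16)).
Proof.
move=> phiv; have /andP[a0 a1] := alpha01.
(* Chernoff with x = 1 and M = s/2: the expected number of activations is at most s/2, and reaching
   s doubles it. *)
have -> : - (s%:R / 16) = - (1 ^+ 2 * (s%:R / 2) / 8) :> R by field.
apply: (@le_trans _ _ (Pr P (fun om => (1 + 1) * (s%:R / 2) <= #|activated A om v|%:R))).
  apply: sub_Pr => om h; rewrite (_ : (1 + 1) * (s%:R / 2) = s%:R) ?ler_nat //.
  by field.
apply: (chernoff_upper (S := fun c => [set (v, c, true)])).
- by move=> c _; apply: depends_act; rewrite inE.
- by move=> c1 c2 _ _ c12; rewrite disjoints1 inE xpair_eqE xpair_eqE !eqxx andbT.
- rewrite (eq_bigr (fun=> alpha)) => [|c _]; last exact: Pr_act.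
  rewrite sumr_const -[_ *+ _]mulr_natr; apply: le_trans sP.
  by rewrite ler_wpM2l ?(ltW a0) // ltW //; case/andP: (state_size st phiv).
by rewrite ler01 lexx.
Qed.

Lemma b_ge0 : (0 < r)%N -> 0 <= b.
Proof. by move=> /bP; apply: le_trans; exact: expR_ge0. Qed.

Lemma Pr_degree_bad v : phi v = None ->
  Pr P (degree_bad v) <= (l + 1) * (r%:R * b).
Proof.
move=> phiv.
apply: (@le_trans _ _ (\sum_(c in A v) \sum_(j < r) b)).
  apply: (@le_trans _ _ (\sum_(c in A v) Pr P (fun om => (#|activated A om v| < s)%N &&
     [exists j : 'I_r, D' j < #|class H (newc om) (newA om) v c j|%:R]))).
    by apply: Pr_le_sum => om /andP[h /exists_inP[c cA hc]]; exists c; rewrite ?h.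
  apply: ler_sum => c cA.
  apply: (@le_trans _ _ (\sum_(j < r) Pr P (fun om => (#|activated A om v| < s)%N &&
     (D' j < #|class H (newc om) (newA om) v c j|%:R)))).
    by apply: Pr_le_sum => om /andP[h /existsP[j hj]]; exists j; rewrite ?h.
  apply: ler_sum => j _; have lvc : listed phi A v c by rewrite /listed phiv.
  apply: le_trans (bP (ltn_ord j)).
  have := degree_tail uniH uncH st alpha01 kappa01 kappaD lvc gP x01 (MP (ltn_ord j)) (D'P (ltn_ord j)). exact.
rewrite !sumr_const card_ord -[_ *+ #|_|]mulr_natl -[b *+ r]mulr_natl.
apply: ler_wpM2r; last by rewrite ltW //; case/andP: (state_size st phiv).
by case: (r) b_ge0 => [_|n]; [rewrite mul0r|move=> /(_ isT); exact: mulr_ge0].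
Qed.

Lemma Pr_bad v : Pr P (bad v) <= p.
Proof.
have [phiv|nphi] := eqVneq (phi v) None; last first.
  have -> : Pr P (bad v) = 0.
    by rewrite -(Ex_cst P 0); apply: eq_Ex => om; rewrite /bad (negPf nphi).
  apply: le_trans pP; rewrite !addr_ge0 ?expR_ge0 // mulr_ge0 ?addr_ge0 //.
  by case: (r) b_ge0 => [_|n]; [rewrite mul0r|move=> /(_ isT); exact: mulr_ge0].
apply: le_trans pP.
apply: (@le_trans _ _ (Pr P (predU (fun om => #|newA om v|%:R < l')
   (predU (fun om => (s <= #|activated A om v|)%N) (degree_bad v))))).
  by apply: sub_Pr => om /andP[_].
have h1 := Pr_short_list phiv; have h2 := Pr_many_activated phiv.
have h3 := Pr_degree_bad phiv.
have h4 := Pr_or P (fun om => (s <= #|activated A om v|)%N) (degree_bad v).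
apply: (le_trans (Pr_or _ _ _)); apply: (le_trans (lerD h1 h4)).
lra.
Qed.

Let scope v : {set trial V C} := [set y | y.1.1 \in ball2 H v].

Lemma depends_kept_scope v u c : u \in nb H v ->
  depends_on (fun om => kept H phi A set0 om u c) (scope v).
Proof.
move=> uv; apply: depends_kept => [|f w fH uf _ wf]; rewrite in_set /=.
  by apply: (subsetP (nb_sub_ball2 uv)); exact: nb_self.
apply: (subsetP (nb_sub_ball2 uv)); apply/nbP; right; exists f; split=> //.
by move: wf; rewrite inE => /andP[].
Qed.

Lemma depends_act_scope v u c : u \in nb H v ->
  depends_on (fun om => act om u c) (scope v).
Proof.
move=> uv; apply: depends_act; rewrite in_set /=.
by apply: (subsetP (nb_sub_ball2 uv)); exact: nb_self.
Qed.

Lemma depends_new_lists v u : u \in nb H v -> depends_on (fun om => newA om u) (scope v).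
Proof.
move=> uv om om' e; apply/setP => c; rewrite !inE.
by rewrite (depends_kept_scope c uv e).
Qed.

Lemma depends_new_coloring v u : u \in nb H v ->
  depends_on (fun om => newc om u) (scope v).
Proof.
move=> uv om om' e; rewrite /new_coloring; case: (phi u) => //.
apply: eq_pick => c.
by rewrite (depends_kept_scope c uv e) (depends_act_scope c uv e).
Qed.

Lemma depends_class v c j :
  depends_on (fun om => class H (newc om) (newA om) v c j) (scope v).
Proof.
move=> om om' eq_om; apply/setP => e; rewrite !in_class.
case eH : (e \in H) => //=; case ve : (v \in e) => //=.
have ue u : u \in e :\ v -> u \in nb H v.
  by rewrite inE => /andP[_ ue]; apply/nbP; right; exists e.
congr (_ && _).
  apply: eq_forallb => u; case h : (u \in e :\ v) => //=.
  rewrite /alive /colored /listed (depends_new_coloring (ue u h) eq_om).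
  by rewrite (depends_new_lists (ue u h) eq_om).
congr (_ == _); apply: eq_card => u; rewrite [LHS]in_set [RHS]in_set.
case h : (u \in e :\ v) => //=.
by rewrite /colored (depends_new_coloring (ue u h) eq_om).
Qed.

Lemma depends_activated v : depends_on (fun om => activated A om v) (scope v).
Proof.
move=> om om' eq_om; apply/setP => c; rewrite !inE.
by rewrite (depends_act_scope c (nb_self H v) eq_om).
Qed.

Lemma depends_bad v : depends_on (bad v) (scope v).
Proof.
move=> om om' e; rewrite /bad /degree_bad.
rewrite (depends_new_lists (nb_self H v) e) (depends_activated e).
congr (_ && [|| _, _ | _ && _]); apply: eq_existsb => c; congr (_ && _).
by apply: eq_existsb => j; rewrite (depends_class c j e).
Qed.

Lemma nibble_step : exists phi' A', [/\ state H r phi' A' l' D',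
  forall u c, phi u = Some c -> phi' u = Some c,
  forall u c, phi' u = Some c -> phi u = Some c \/ c \in A u &
  forall u, A' u \subset A u].
Proof.
have p0 : V -> 0 <= p by move=> v; apply: le_trans (Pr_bad v); exact: Pr_ge0.
have [|om [good _]] := @local_lemma _ _ _ P _ bad scope (fun=> p) depends_bad Pr_bad.
  (* All events share the bound p, so the condition of the local lemma is p times the dependency
     degree. *)
  move=> v; apply: le_trans pD; rewrite sumr_const -[_ *+ _]mulr_natr.
  rewrite ler_wpM2l ?p0 // -natrX ler_nat.
  apply: leq_trans (card_ball2_meet v uniH); apply: subset_leq_card.
  apply/subsetP => w; rewrite unfold_in inE => /orP[/eqP ->|].
    rewrite -setI_eq0 setIid; apply/set0Pn; exists v.
    by apply: (subsetP (nb_sub_ball2 (nb_self H v))); exact: nb_self.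
  rewrite -!setI_eq0 => /set0Pn[y]; rewrite in_setI !in_set => /andP[y1 y2].
  by apply/set0Pn; exists y.1.1; rewrite in_setI y1.
have [n /andP[n1 n2]] := nat_ceil_exists l'0.
have goodP v : phi v = None -> [/\ l' <= #|newA om v|%:R &
    forall c j, c \in A v -> (j < r)%N ->
    #|class H (newc om) (newA om) v c j|%:R <= D' j].
  move=> phiv; have := good v; rewrite /bad phiv eqxx /= !negb_or -leNgt -ltnNge.
  move=> /and3P[h1 h2 h3]; split=> // c j cA jr.
  move: h3; rewrite /degree_bad h2 /= negb_exists_in => /forall_inP /(_ c cA).
  by rewrite negb_exists => /forallP /(_ (Ordinal jr)) /=; rewrite -leNgt.
pose A' u := trunc_set n (newA om u).
have sA' u : A' u \subset newA om u by exact: trunc_set_sub.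
have lA' u c : listed (newc om) A' u c -> listed (newc om) (newA om) u c.
  by rewrite /listed => /andP[-> /(subsetP (sA' u)) ->].
exists (newc om), A'; split; last 3 first.
- by move=> u c; exact: new_coloring_old.
- move=> u c; case E : (phi u) => [c'|]; first by rewrite (new_coloring_old _ _ _ E); left.
  by move=> /(new_coloring_Some E)[]; right.
- by move=> u; apply: (subset_trans (sA' u)); apply/subsetP => c; rewrite inE => /andP[].
split.
- by move=> e c; apply: new_proper; exact: (state_proper st).
- move=> v /new_coloring_None[phiv _]; have [h _] := goodP v phiv.
  rewrite card_trunc_set ?n1 //.
  have : n%:R < (#|newA om v|.+1)%:R :> R.
    by rewrite -[X in _ < X%:R]addn1 natrD; apply: (lt_le_trans n2); rewrite lerD2r.
  by rewrite ltr_nat ltnS.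
- move=> v c /lA' lvc; apply/eqP; rewrite -subset0 -(new_open uniH lvc).
  exact: class_subset.
move=> v c j /lA' /andP[/eqP/new_coloring_None[phiv _]]; rewrite inE => /andP[cA _] jr.
have [_ h] := goodP v phiv; apply: le_trans (h c j cA jr).
by rewrite ler_nat subset_leq_card // class_subset.
Qed.

End Step.

(** * Completing a sparse partial coloring *)

Section Completion.
Variables (R : realType) (V C : finType) (H : hypergraph V) (r : nat).
Hypothesis uniH : uniform r.+1 H.
Variables (phi : V -> option C) (A : V -> {set C}) (l : R) (D : nat -> R).
Hypothesis st : state H r phi A l D.
Hypothesis l1 : 1 <= l.
Hypothesis lD : r.+1%:R * (2 * \sum_(j < r) D j * l^-1 ^+ (r - j)) <= 1 / 4.
Implicit Types (u v : V) (c : C) (e : {set V}).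

Definition completion_mass v c : R :=
  if phi v is Some c' then (c == c')%:R
  else if c \in A v then (#|A v|%:R)^-1 else 0.

Lemma completion_mass_ge0 v c : 0 <= completion_mass v c.
Proof.
by rewrite /completion_mass; case: (phi v) => [c'|]; rewrite ?ler0n //; case: ifP;
  rewrite ?invr_ge0 ?ler0n.
Qed.

Lemma card_list_gt0 v : phi v = None -> (0 < #|A v|)%N.
Proof.
move=> /(state_size st)/andP[h _]; rewrite -(ltr_nat R).
by apply: lt_le_trans h; apply: lt_le_trans l1.
Qed.

Lemma completion_mass_sum1 v : \sum_c completion_mass v c = 1.
Proof.
rewrite /completion_mass; case E : (phi v) => [c'|].
  by rewrite (bigD1 c') //= eqxx big1 ?addr0 // => c /negPf ->.
rewrite -big_mkcond sumr_const -[_ *+ _]mulr_natr mulVf //.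
by rewrite pnatr_eq0 -lt0n card_list_gt0.
Qed.

Definition completion_law : product_law R V C :=
  ProductLaw completion_mass_ge0 completion_mass_sum1.
Local Notation P := completion_law.

Definition unc e := [set u in e | phi u == None].

Definition risky (i : {set V} * C) :=
  [&& i.1 \in H, [forall u in i.1, alive phi A u i.2] & unc i.1 != set0].

Definition mono_event (i : {set V} * C) (om : {ffun V -> C}) :=
  risky i && [forall u in unc i.1, om u == i.2].

(** Pairs that are not risky get an empty scope and bound 0, so they enter no sum of the local
    lemma. *)
Definition mono_scope i : {set V} := if risky i then unc i.1 else set0.
Definition mono_prob i : R := if risky i then l^-1 ^+ #|unc i.1| else 0.

Lemma l_gt0 : 0 < l. Proof. exact: lt_le_trans l1. Qed.

Lemma mono_prob_ge0 i : 0 <= mono_prob i.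
Proof. by rewrite /mono_prob; case: ifP => // _; rewrite exprn_ge0 // invr_ge0 ltW ?l_gt0. Qed.

Lemma depends_mono_event i : depends_on (mono_event i) (mono_scope i).
Proof.
move=> om om' eq_om; rewrite /mono_event; rewrite /mono_scope in eq_om.
case: (risky i) eq_om => //= eq_om; apply: eq_forallb => u.
by case h : (u \in unc i.1) => //=; rewrite eq_om.
Qed.

Lemma Pr_mono_event i : Pr P (mono_event i) <= mono_prob i.
Proof.
rewrite /mono_prob /mono_event; case: (boolP (risky i)) => [ri|_]; last first.
  by rewrite -[leRHS](Ex_cst P); apply: le_Ex.
rewrite [leLHS](_ : _ = Pr P (fun om => [forall u in unc i.1, om u == i.2])); last exact: eq_Pr.
rewrite (Pr_forall _ (S := fun u => [set u])).
- rewrite -prodr_const; apply: ler_prod => u; rewrite inE => /andP[ui /eqP phiu].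
  rewrite Pr_ge0 /= (Pr_coord _ _ (fun c => c == i.2)) big_pred1_eq.
  rewrite /= /completion_mass phiu; case: ifP => _; last by rewrite invr_ge0 ltW ?l_gt0.
  rewrite lef_pV2 ?posrE ?l_gt0 ?ltr0n ?card_list_gt0 //.
  by case/andP: (state_size st phiu).
- by move=> u _ om om' eq_om; rewrite eq_om // inE.
by move=> u u' _ _ uu'; rewrite disjoints1 inE.
Qed.

(** There are at most l + 1 <= 2 l colors c in the list of v. A threat with j other vertices colored
    c has r - j + 1 uncolored ones, v included, hence contributes l^-1 times l^-(r - j); the first
    factor pays for the number of colors. *)
Lemma sum_mono_prob v : phi v = None ->
  \sum_(i | risky i && (v \in unc i.1)) mono_prob i <=
  2 * \sum_(j < r) D j * l^-1 ^+ (r - j).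
Proof.
move=> phiv; set S := \sum_(j < r) _.
have l0 := l_gt0; have lV0 : 0 <= l^-1 by rewrite invr_ge0 ltW.
have S0 : 0 <= S.
  have /card_gt0P[c cA] := card_list_gt0 phiv.
  apply: sumr_ge0 => j _; rewrite mulr_ge0 ?exprn_ge0 //.
  have lvc : listed phi A v c by rewrite /listed phiv.
  by apply: le_trans (state_class st lvc (ltn_ord j)); rewrite ler0n.
apply: (@le_trans _ _ (\sum_(c in A v) \sum_(e in threats H phi A v c)
    l^-1 * l^-1 ^+ (r - #|colset phi c (e :\ v)|))).
  rewrite (exchange_big_dep predT) //= pair_big_dep /=.
  rewrite big_mkcond [leRHS]big_mkcond; apply: ler_sum => -[e c] _ /=.
  rewrite /mono_prob /=; case: (boolP (risky _)) => [|_] /=; last first.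
    by case: ifP => // _; rewrite mulr_ge0 ?exprn_ge0.
  case/and3P => /= eH /forall_inP al _.
  case: (boolP (v \in unc e)) => [vu|_]; last first.
    by case: ifP => // _; rewrite mulr_ge0 ?exprn_ge0.
  have ve : v \in e by move: vu; rewrite inE => /andP[].
  have cA : c \in A v.
    by have := al v ve; rewrite /alive /colored /listed phiv.
  have et : e \in threats H phi A v c.
    by rewrite inE eH ve /=; apply/forall_inP => u; rewrite inE => /andP[_ /al].
  rewrite cA et -exprS; have := card_lstset uniH et.
  set nl := #|lstset _ _ _ _|; set nc := #|colset _ _ _| => cc.
  rewrite (_ : #|unc e| = (r - nc).+1) //.
  rewrite (cardsD1 v) vu add1n -cc addnK; congr _.+1; apply: eq_card => u.
  rewrite !inE; case: (boolP (u == v)) => //= uv; case: (boolP (u \in e)) => //= ue.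
  have := al u ue; rewrite /alive /colored /listed.
  by case: (phi u) => [c'|] /=; rewrite ?orbF.
have bd c : c \in A v -> \sum_(e in threats H phi A v c)
    l^-1 * l^-1 ^+ (r - #|colset phi c (e :\ v)|) <= l^-1 * S.
  move=> cA; rewrite -mulr_sumr ler_wpM2l //.
  apply: (sum_threats_le uniH (F := fun j => l^-1 ^+ (r - j)) st); rewrite /listed ?phiv //.
  by move=> j _; rewrite exprn_ge0.
apply: (le_trans (ler_sum _ bd)); rewrite sumr_const -[_ *+ _]mulr_natl mulrA.
apply: ler_wpM2r => //; rewrite ler_pdivrMr //.
have /andP[_ h] := state_size st phiv; apply: (le_trans (ltW h)).
by have := l1; lra.
Qed.

Lemma complete_coloring : exists Phi : {ffun V -> C},
  (forall v, phi v = Some (Phi v) \/ Phi v \in A v) /\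
  forall e c, e \in H -> ~~ [forall u in e, Phi u == c].
Proof.
have [|om [good pos]] := local_lemma (P := P) depends_mono_event Pr_mono_event.
  move=> j; case: (boolP (risky j)) => rj; last first.
    rewrite big1 ?divr_ge0 // => i.
    rewrite {2}/mono_scope (negPf rj) -setI_eq0 setI0 eqxx orbF.
    by move=> /eqP ->; rewrite /mono_prob (negPf rj).
  apply: le_trans lD; case/and3P: (rj) => jH _ /set0Pn[v0].
  rewrite inE => /andP[_ /eqP phiv0].
  (* Dependent events share an uncolored vertex of the edge of j, which has at most r + 1 of
     them. *)
  apply: (@le_trans _ _ (\sum_(v in unc j.1)
      \sum_(i | risky i && (v \in unc i.1)) mono_prob i)).
    rewrite (exchange_big_dep predT) //= big_mkcond; apply: ler_sum => i _.
    case: ifP => [h|_]; last by rewrite sumr_ge0 // => v _; exact: mono_prob_ge0.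
    have [ri|nri] := boolP (risky i); last first.
      by rewrite {1}/mono_prob (negPf nri) sumr_ge0 // => v _; exact: mono_prob_ge0.
    have [v vi vj] : exists2 v, v \in unc i.1 & v \in unc j.1.
      case/orP: h => [/eqP ->|].
        by case/and3P: rj => _ _ /set0Pn[v vj]; exists v.
      rewrite -setI_eq0 /mono_scope ri rj => /set0Pn[v]; rewrite in_setI => /andP[vi vj].
      by exists v.
    rewrite (bigD1 v) /=; last by rewrite vj vi.
    by rewrite lerDl sumr_ge0 // => w _; exact: mono_prob_ge0.
  apply: (@le_trans _ _ (\sum_(v in unc j.1) (2 * \sum_(j < r) D j * l^-1 ^+ (r - j)))).
    by apply: ler_sum => v; rewrite inE => /andP[_ /eqP]; exact: sum_mono_prob.
  rewrite sumr_const -[_ *+ _]mulr_natl; apply: ler_wpM2r.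
    apply: le_trans (sum_mono_prob phiv0).
    by apply: sumr_ge0 => i _; exact: mono_prob_ge0.
  rewrite ler_nat -(eqP (forall_inP uniH _ jH)).
  by apply: subset_leq_card; apply/subsetP => u; rewrite inE => /andP[].
exists om; split=> [v|e c eH].
  have := pos v; rewrite /= /completion_mass; case: (phi v) => [c'|].
    by case: eqP => [->|]; [left|rewrite ltxx].
  by case: ifP => [|_]; [right|rewrite ltxx].
apply/negP => /forall_inP mono.
have /negP := good (e, c); apply; rewrite /mono_event /risky /= eH /=.
(* Each sampled color has positive mass, so a monochromatic edge is alive in its color at every
   vertex. *)
have al : [forall u in e, alive phi A u c].
  apply/forall_inP => u ue; have := pos u; rewrite /= /completion_mass (eqP (mono u ue)).
  rewrite /alive /colored /listed; case: (phi u) => [c'|].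
    by case: eqP => [->|]; rewrite ?eqxx // ltxx.
  by case: ifP => // _; rewrite ltxx.
rewrite al /=; apply/andP; split; last first.
  by apply/forall_inP => u; rewrite inE => /andP[ue _]; exact: mono.
(* Without uncolored vertices the edge would already be monochromatic in phi. *)
apply: contraT; rewrite negbK => /eqP un0.
have /negP := state_proper st c eH; case; apply/forall_inP => u ue.
have := forall_inP al u ue; rewrite /alive; case: (colored _ _ _) => //= /andP[phiu _].
have : u \in unc e by rewrite inE ue.
by rewrite un0 inE.
Qed.

End Completion.

(** * Numerical form of a round *)

(** Trinomial revision: both sides count pairs of nested sets of sizes i and j. *)
Lemma bin_mulC r i j : (i <= j <= r)%N ->
  ('C(r, i) * 'C(r - i, j - i) = 'C(r, j) * 'C(j, i))%N.
Proof.
move=> /andP[ij jr].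
have h1 := bin_fact (leq_trans ij jr); have h2 := bin_fact ij; have h3 := bin_fact jr.
have h4 : (j - i <= r - i)%N by lia.
have := bin_fact h4; rewrite (_ : r - i - (j - i) = r - j)%N; last by lia.
move=> h5; have f1 := fact_gt0 i; have f2 := fact_gt0 (j - i); have f3 := fact_gt0 (r - j).
have f0 : (0 < i`! * ((j - i)`! * (r - j)`!))%N by rewrite !muln_gt0 f1 f2 f3.
apply/eqP; rewrite -(eqn_pmul2r f0).
apply/eqP; transitivity r`!.
  by rewrite -h1 -h5; ring.
by rewrite -h3 -h2; ring.
Qed.

(** The left side bounds the probability that a vertex with n usable colors receives none; ideally
    this is 1 - theta. With z = theta y + alpha S the exponent is at least theta - z, and the total
    error theta^2 + z + alpha is at most 3 theta^2 + theta y <= xi/2, absorbed by 1 + xi. The factor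
    1 - alpha compensates the loss in [Pr_kept_avoid]. *)
Lemma survival_bound (R : realType) (theta xi y alpha l S n : R) :
  0 <= theta <= 1 / 2 -> 0 <= xi <= 1 / 2 -> 0 <= y <= 1 / 2 -> 0 <= alpha ->
  8 * alpha <= theta ^+ 2 -> alpha * l = theta -> 0 <= S <= theta * l ->
  3 * theta ^+ 2 + theta * y <= xi / 2 -> l - S <= n ->
  expR (- (alpha * (1 - y) * n)) <= (1 - theta) * (1 + xi) * (1 - alpha).
Proof.
move=> /andP[th0 th1] /andP[xi0 xi1] /andP[y0 y1] al0 al8 alth /andP[S0 S1] small ln.
have sth : alpha * S <= theta ^+ 2.
  by apply: (le_trans (ler_wpM2l al0 S1)); rewrite mulrCA alth.
have aS0 : 0 <= alpha * S by exact: mulr_ge0.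
have thy0 : 0 <= theta * y by exact: mulr_ge0.
set z := theta * y + alpha * S.
have z0 : 0 <= z by exact: addr_ge0.
have h1 : theta - z <= alpha * (1 - y) * n.
  have a1y : 0 <= alpha * (1 - y) by apply: mulr_ge0 => //; lra.
  apply: le_trans (ler_wpM2l a1y ln).
  have -> : alpha * (1 - y) * (l - S) = theta - z + y * (alpha * S).
    by rewrite /z -alth; ring.
  by rewrite lerDl mulr_ge0.
have wb : theta ^+ 2 + z + alpha <= xi / 2.
  have : 0 <= theta ^+ 2 by exact: sqr_ge0.
  by rewrite /z; lra.
clearbody z; move: wb; set w := theta ^+ 2; have w0 : 0 <= w by exact: sqr_ge0.
move=> wb; have p1 : 0 < 1 + theta - z by lra.
apply: (@le_trans _ _ (expR (- (theta - z)))); first by rewrite ler_expR lerN2.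
rewrite expRN -(ler_pM2l p1); have e1 := expR_ge1Dx (theta - z).
apply: (@le_trans _ _ 1); first by rewrite ler_pdivrMr ?expR_gt0 // mul1r addrA in e1 *.
have q1 : 1 - w - z <= (1 + theta - z) * (1 - theta).
  have -> : (1 + theta - z) * (1 - theta) = 1 - w - z + z * theta by rewrite /w; ring.
  by rewrite lerDl mulr_ge0.
have q2 : 1 - w - z - alpha <= (1 - w - z) * (1 - alpha).
  have -> : (1 - w - z) * (1 - alpha) = 1 - w - z - alpha + (w + z) * alpha by ring.
  by rewrite lerDl mulr_ge0 // addr_ge0.
have q3 : 1 <= (1 - w - z - alpha) * (1 + xi).
  apply: (@le_trans _ _ ((1 - xi / 2) * (1 + xi))); first by nra.
  by apply: ler_wpM2r; lra.
apply: (le_trans q3).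
rewrite (_ : (1 + theta - z) * ((1 - theta) * (1 + xi) * (1 - alpha)) =
 ((1 + theta - z) * (1 - theta) * (1 - alpha)) * (1 + xi)); last by ring.
apply: ler_wpM2r; first by lra.
by apply: (le_trans q2); apply: ler_wpM2r q1; lra.
Qed.

(** With q = r - j: one factor 1 + xi comes from the Chernoff deviation and q from the error in g,
    while the new list size brings q factors 1 - xi. Since (1 + xi) <= (1 + 4 xi)(1 - xi), raising
    lam by (1 + 4 xi)^(r+1) covers every class at once. *)
Lemma slack_absorb (R : realType) (xi B : R) q n : 0 <= xi <= 1 / 2 -> 0 <= B ->
  (q <= n)%N ->
  (1 + xi) * (B * (1 + xi)) ^+ q <= (1 + 4 * xi) ^+ n.+1 * (B * (1 - xi)) ^+ q.
Proof.
move=> /andP[xi0 xi1] B0 qn.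
have xx : 1 + xi <= (1 + 4 * xi) * (1 - xi) by nra.
have -> : (1 + xi) * (B * (1 + xi)) ^+ q = B ^+ q * ((1 + xi) * (1 + xi) ^+ q).
  by rewrite exprMn; ring.
have -> : (1 + 4 * xi) ^+ n.+1 * (B * (1 - xi)) ^+ q =
    B ^+ q * ((1 + 4 * xi) ^+ n.+1 * (1 - xi) ^+ q).
  by rewrite [(B * _) ^+ _]exprMn; ring.
rewrite ler_wpM2l ?exprn_ge0 //.
apply: (@le_trans _ _ ((1 + 4 * xi) * ((1 + 4 * xi) * (1 - xi)) ^+ q)).
  apply: ler_pM => //; rewrite ?exprn_ge0 //; try lra.
  by apply: lerXn2r; rewrite ?nnegrE //; lra.
rewrite exprMn mulrA -exprS ler_wpM2r ?exprn_ge0 //; first by lra.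
by apply: ler_weXn2l; [lra | rewrite ltnS].
Qed.

(** A lower bound uniform in j on the mean used in Chernoff. Since t >= theta, t^j >= theta^r; since
    j < r, at least one factor X remains. *)
Lemma class_mean_ge (R : realType) (lam theta t X0 X : R) r j : (j < r)%N ->
  1 <= lam -> 0 <= theta <= t -> t <= 1 -> 1 <= X0 <= X ->
  theta ^+ r * X0 <= lam * 'C(r, j)%:R * t ^+ j * X ^+ (r - j).
Proof.
move=> jr lam1 /andP[th0 tht] t1 /andP[X01 X0X].
apply: ler_pM; [exact: exprn_ge0|lra| |].
  apply: (@le_trans _ _ (theta ^+ j)).
    by apply: ler_wiXn2l; [lra|lra|exact: ltnW].
  apply: (@le_trans _ _ (t ^+ j)); first by apply: lerXn2r; rewrite ?nnegrE //; lra.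
  have C1 : 1 <= 'C(r, j)%:R :> R by rewrite ler1n bin_gt0 ltnW.
  rewrite -[leLHS]mul1r ler_wpM2r ?exprn_ge0 //; first by lra.
  by apply: (le_trans C1); rewrite -[leLHS]mul1r ler_wpM2r.
apply: (le_trans X0X); rewrite -[leLHS]expr1; apply: ler_weXn2l; first by lra.
by rewrite subn_gt0.
Qed.

(** The degree events have the weakest exponent, because theta^r a <= theta; the two list events are
    then also bounded by b. *)
Lemma failure_prob_le (R : realType) (theta xi a l kappa s b : R) r : (0 < r)%N ->
  0 < theta <= 1 / 2 -> 0 <= xi <= 1 / 2 -> 0 < a <= 1 -> 0 < l -> 1 / 2 <= kappa ->
  theta * l / 2 <= s ->
  b = expR (- (xi ^+ 2 * theta ^+ r * a * l / 16)) ->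
  expR (- (s / 16)) + expR (- (xi ^+ 2 * (kappa * l) / 8)) + (l + 1) * (r%:R * b) <=
  b * (2 + (l + 1) * r%:R).
Proof.
move=> r0 /andP[th0 th1] /andP[xi0 xi1] /andP[a0 a1] l0 kap2 ths bE.
have q0 : 0 <= theta ^+ r by rewrite exprn_ge0 // ltW.
have q1 : theta ^+ r <= theta.
  by rewrite -[leRHS]expr1; apply: ler_wiXn2l => //; lra.
have x0 : 0 <= xi ^+ 2 by exact: sqr_ge0.
have x1 : xi ^+ 2 <= 1 / 4 by nra.
have qa : theta ^+ r * a <= theta.
  by apply: le_trans q1; rewrite -[leRHS]mulr1 ler_wpM2l.
have qa0 : 0 <= theta ^+ r * a by rewrite mulr_ge0 // ltW.
have qal : theta ^+ r * a * l <= theta * l by rewrite ler_wpM2r // ltW.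
have qal0 : 0 <= theta ^+ r * a * l by rewrite mulr_ge0 // ltW.
have e1 : expR (- (s / 16)) <= b.
  rewrite bE ler_expR lerN2.
  have : xi ^+ 2 * (theta ^+ r * a * l) <= 1 / 4 * (theta * l) by apply: ler_pM.
  by lra.
have e2 : expR (- (xi ^+ 2 * (kappa * l) / 8)) <= b.
  rewrite bE ler_expR lerN2.
  have h : theta ^+ r * a * l <= 2 * (kappa * l).
    have := ler_wpM2r (ltW l0) kap2; have : theta * l <= 1 * l.
      by rewrite ler_wpM2r //; lra.
    by lra.
  have := ler_wpM2l x0 h; lra.
by lra.
Qed.

Section Rounds.
Variables (R : realType) (r : nat).

(* [t] is the fraction of colored vertices and [lam] the weighted color degree,
   where a colored vertex has weight 1 and an uncolored one 1/l: the number of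
   colored vertices of an edge is distributed as a binomial of parameters r, t. *)
Definition class_bound (lam t l : R) (j : nat) : R :=
  lam * 'C(r, j)%:R * t ^+ j * ((1 - t) * l) ^+ (r - j).

(** Binomial theorem without its top term j = r. At x = theta it gives the fraction of colors lost
    in a round; at x = 1 it gives the sum that the completion needs. *)
Lemma sum_class_bound lam t l (x : R) : l != 0 ->
  \sum_(j < r) class_bound lam t l j * (x / l) ^+ (r - j) =
  lam * ((t + (1 - t) * x) ^+ r - t ^+ r).
Proof.
move=> l0; rewrite [t + _]addrC exprDn big_ord_recr /= subnn expr0 mul1r binn mulr1n.
rewrite addrK mulr_sumr; apply: eq_bigr => j _.
rewrite /class_bound -mulrA -exprMn (_ : (1 - t) * l * (x / l) = (1 - t) * x); last by field.
by rewrite -[_ *+ _]mulr_natr; ring.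
Qed.

(** Coloring each uncolored vertex with probability x turns a binomial law of parameter t into one
    of parameter t + (1 - t) x; this is why the shape of [class_bound] is preserved. *)
Lemma sum_move_bound lam t l (x g : R) j : l != 0 -> (j < r)%N ->
  \sum_(i < r) class_bound lam t l i * move_bound r (x / l) g j i =
  lam * 'C(r, j)%:R * (t + (1 - t) * x) ^+ j * ((1 - t) * l * g) ^+ (r - j).
Proof.
move=> l0 jr; rewrite [t + _]addrC exprDn mulr_sumr mulr_suml.
rewrite [RHS](big_ord_widen r (fun i => lam * 'C(r, j)%:R *
  (((1 - t) * x) ^+ (j - i) * t ^+ i *+ 'C(j, i)) * ((1 - t) * l * g) ^+ (r - j))) //.
rewrite [RHS]big_mkcond /=; apply: eq_bigr => i _; rewrite /move_bound.
case: (ltnP i j.+1) => [|ij]; last by rewrite leqNgt ij /= mul0r mulr0.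
rewrite ltnS => ij; rewrite ij mul1r /class_bound.
have -> : ((1 - t) * l) ^+ (r - i) = ((1 - t) * l) ^+ (j - i) * ((1 - t) * l) ^+ (r - j).
  by rewrite -exprD; congr (_ ^+ _); lia.
have -> : ((1 - t) * x) ^+ (j - i) = ((1 - t) * l) ^+ (j - i) * (x / l) ^+ (j - i).
  by rewrite -exprMn; congr (_ ^+ _); field.
rewrite [((1 - t) * l * g) ^+ _]exprMn -(mulr_natr (_ * t ^+ i)).
have -> : lam * 'C(r, i)%:R * t ^+ i * (((1 - t) * l) ^+ (j - i) * ((1 - t) * l) ^+ (r - j)) *
  ('C(r - i, j - i)%:R * (x / l) ^+ (j - i) * g ^+ (r - j)) =
  ('C(r, i) * 'C(r - i, j - i))%:R * (lam * t ^+ i * (((1 - t) * l) ^+ (j - i) * ((1 - t) * l) ^+ (r - j)) *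
  ((x / l) ^+ (j - i) * g ^+ (r - j))) by rewrite natrM; ring.
by rewrite bin_mulC ?ij ?(ltnW jr) // natrM; ring.
Qed.

Variables (V C : finType) (H : hypergraph V).
Hypotheses (r0 : (0 < r)%N) (uniH : uniform r.+1 H) (uncH : uncrowded H).

Lemma pow_1B_le (x : R) n : 0 <= x <= 1 -> (1 - x) ^+ n <= expR (- (x * n%:R)).
Proof.
move=> /andP[x0 x1]; rewrite -mulNr expRM_natr; apply: lerXn2r; rewrite ?nnegrE ?subr_ge0 ?expR_ge0 //.
exact: expR_ge1Dx.
Qed.

Lemma nibble_round (phi : V -> option C) A (lam t l theta xi a : R) :
  let t' := t + (1 - t) * theta in
  let y := lam * (t' ^+ r - t ^+ r) in
  state H r phi A l (class_bound lam t l) ->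
  0 < theta <= 1 / 2 -> 0 <= xi <= 1 / 2 -> 1 <= lam -> 0 <= t <= 1 ->
  0 < a <= 1 - t' -> y <= 1 / 2 ->
  3 * theta ^+ 2 + theta * y <= xi / 2 -> 8 <= theta * l -> 2 <= a * l ->
  expR (- (xi ^+ 2 * theta ^+ r * a * l / 16)) * (2 + (l + 1) * r%:R) *
    (1 + r.+1 * max_degree H)%:R ^+ 4 <= 1 / 4 ->
  let l' := (1 - xi) * ((1 - y) * l) in
  exists phi' A', [/\ state H r phi' A' l' (class_bound (lam * (1 + 4 * xi) ^+ r.+1) t' l'),
  forall u c, phi u = Some c -> phi' u = Some c,
  forall u c, phi' u = Some c -> phi u = Some c \/ c \in A u &
  forall u, A' u \subset A u].
Proof.
move=> t' y st /andP[th0 th1] /andP[xi0 xi1] lam1 /andP[t0 t1] /andP[a0 a1] y1 small thl al fail l'.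
have l16 : 16 <= l by nra.
have lneq0 : l != 0 by apply: lt0r_neq0; lra.
have lgt0 : 0 < l by lra.
set kappa := 1 - y; pose alpha := theta / l.
have tt' : t <= t' by rewrite /t'; nra.
have tht' : theta <= t' by rewrite /t'; nra.
have t'1 : t' <= 1 by lra.
have y0 : 0 <= y by rewrite mulr_ge0 ?subr_ge0 ?lerXn2r ?nnegrE //; lra.
have al0 : 0 < alpha by rewrite divr_gt0.
have alth : alpha * l = theta by rewrite /alpha divfK.
have al8 : 8 * alpha <= theta ^+ 2 by nra.
have alpha01 : 0 < alpha < 1 by rewrite al0; nra.
have kappa01 : 0 < kappa <= 1 by rewrite /kappa; apply/andP; split; lra.
have kappaD : \sum_(j < r) class_bound lam t l j * alpha ^+ (r - j) <= 1 - kappa.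
  by rewrite sum_class_bound // /kappa opprB addrCA subrr addr0.
(* Only about theta colors are activated on average. This generous threshold makes its failure
   exponentially small in theta l, while leaving out s <= theta l colors costs only alpha s <=
   theta^2 in the survival estimate. *)
have [s /andP[s1 s2]] : exists n : nat, theta * l / 2 <= n%:R < theta * l / 2 + 1.
  by apply: nat_ceil_exists; nra.
(* Keeping c has probability about kappa and receiving no color about 1 - theta; 1 + xi absorbs the
   errors. *)
pose g := (1 - theta) * kappa * (1 + xi).
pose b := expR (- (xi ^+ 2 * theta ^+ r * a * l / 16)).
pose M j := lam * 'C(r, j)%:R * t' ^+ j * ((1 - t) * l * g) ^+ (r - j).
have th1r n : 0 <= theta ^+ n <= 1.
  by rewrite exprn_ge0 ?(ltW th0) //= exprn_ile1 ?(ltW th0) //; lra.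
have kap2 : 1 / 2 <= kappa by rewrite /kappa; lra.
have t'E : (1 - t) * (1 - theta) = 1 - t' by rewrite /t'; ring.
have gE : (1 - t) * l * g = (1 - t') * l * kappa * (1 + xi) by rewrite /g -t'E; ring.
have kl1 : a * l / 2 <= (1 - t) * l * g.
  rewrite gE.
  have h1 : a * l <= (1 - t') * l by rewrite ler_pM2r.
  have h2 : 1 / 2 <= kappa * (1 + xi) by nra.
  have -> : a * l / 2 = (a * l) * (1 / 2) by field.
  have -> : (1 - t') * l * kappa * (1 + xi) = ((1 - t') * l) * (kappa * (1 + xi)) by ring.
  by apply: ler_pM => //; nra.
apply: (@nibble_step R V C H r uniH uncH phi A l _ st alpha kappa alpha01 kappa01 kappaD
  s g xi l' b (b * (2 + (l + 1) * r%:R)) M).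
- move=> m lm.
  have al1 : 0 < 1 - alpha by lra.
  rewrite mulrAC ler_pdivrMr // /g.
  rewrite (_ : (1 - theta) * kappa * (1 + xi) * (1 - alpha) =
    kappa * ((1 - theta) * (1 + xi) * (1 - alpha))); last by ring.
  rewrite ler_wpM2l //; first by lra.
  have ak01 : 0 <= alpha * kappa <= 1 by case/andP: kappa01 => k0 k1; nra.
  apply: (le_trans (pow_1B_le _ ak01)).
  have ms : l - s%:R <= (m - s)%:R.
    have [sm|sm] := leqP s m; first by rewrite natrB // lerD2r.
    have -> : (m - s)%N = 0%N by apply/eqP; rewrite subn_eq0 ltnW.
    rewrite subr_le0; apply: (le_trans lm); rewrite ler_nat; exact: ltnW.
  have sth : 0 <= (s%:R : R) <= theta * l by apply/andP; split; [exact: ler0n|lra].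
  have th01 : 0 <= theta <= 1 / 2 by rewrite th1 ltW.
  have y01 : 0 <= y <= 1 / 2 by rewrite y0.
  have xi01 : 0 <= xi <= 1 / 2 by rewrite xi0.
  exact: (survival_bound th01 xi01 y01 (ltW al0) al8 alth sth small ms).
- by apply/andP; split; lra.
- lra.
- by rewrite /l' !mulr_ge0 //; lra.
- by move=> j jr; rewrite sum_move_bound.
- move=> j jr; rewrite /M gE /class_bound; set K := lam * 'C(r, j)%:R * t' ^+ j.
  pose B := (1 - t') * l * kappa.
  have K0 : 0 <= K.
    by apply: mulr_ge0; [apply: mulr_ge0 => //; exact: le_trans lam1|exact: exprn_ge0 (le_trans t0 tt')].
  have B0 : 0 <= B.
    apply: mulr_ge0; last by case/andP: kappa01 => /ltW.
    by apply: mulr_ge0; [rewrite subr_ge0|exact: ltW].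
  have -> : (1 + xi) * (K * ((1 - t') * l * kappa * (1 + xi)) ^+ (r - j)) =
      K * ((1 + xi) * (B * (1 + xi)) ^+ (r - j)) by rewrite mulrCA.
  have -> : lam * (1 + 4 * xi) ^+ r.+1 * 'C(r, j)%:R * t' ^+ j * ((1 - t') * l') ^+ (r - j) =
      K * ((1 + 4 * xi) ^+ r.+1 * (B * (1 - xi)) ^+ (r - j)).
    rewrite (_ : (1 - t') * l' = B * (1 - xi)); last by rewrite /B /l' /kappa; ring.
    by rewrite /K; ring.
  by rewrite ler_wpM2l // slack_absorb ?xi0 ?leq_subr.
- by [].
- rewrite (_ : alpha * (l + 1) = theta + alpha); last by rewrite -alth; ring.
  by nra.
- move=> j jr; rewrite /b ler_expR lerN2.
  have h : theta ^+ r * (a * l / 2) <= M j.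
    apply: class_mean_ge => //; first by rewrite tht' ltW.
    by rewrite kl1 andbT ler_pdivlMr // mul1r.
  have : xi ^+ 2 * (theta ^+ r * (a * l / 2)) <= xi ^+ 2 * M j.
    by rewrite ler_wpM2l // exprn_ge0.
  by move: (M j) => m {h}; lra.
- have th01 : 0 < theta <= 1 / 2 by rewrite th0.
  have xi01 : 0 <= xi <= 1 / 2 by rewrite xi0.
  have a01 : 0 < a <= 1 by rewrite a0 (le_trans a1) // lerBlDr lerDl (le_trans t0).
  exact: (failure_prob_le r0 th01 xi01 a01 lgt0 kap2 s1 (erefl b)).
exact: fail.
Qed.

End Rounds.

(** * Iterating the rounds *)

(** It turns the product of the losses of the rounds into a sum in the exponent. The inequality
    reduces to (1 - x)(1 + x + 2x^2) >= 1. *)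
Lemma expRN_le_1B (R : realType) (x : R) : 0 <= x <= 1 / 2 ->
  expR (- (x * (1 + 2 * x))) <= 1 - x.
Proof.
move=> /andP[x0 x1]; have h := expR_ge1Dx (x * (1 + 2 * x)).
rewrite expRN -[leLHS]mul1r ler_pdivrMr ?expR_gt0 //.
apply: (@le_trans _ _ ((1 - x) * (1 + x * (1 + 2 * x)))); first by nra.
by rewrite ler_wpM2l //; lra.
Qed.

Lemma subrX_le (R : realType) (t t' : R) n : 0 <= t -> t <= t' <= 1 ->
  t' ^+ n - t ^+ n <= n%:R * (t' - t).
Proof.
move=> t0 /andP[tt' t1]; elim: n => [|n IH]; first by rewrite !expr0 subrr mul0r.
have h1 : 0 <= t' ^+ n <= 1 by rewrite exprn_ge0 ?exprn_ile1 //; lra.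
have h2 : t ^+ n <= t' ^+ n by apply: lerXn2r; rewrite ?nnegrE //; lra.
rewrite !exprS -natr1 mulrDl mul1r; case/andP: h1 => h1 h3; nra.
Qed.

Section NibbleColoring.
Variables (R : realType) (V C : finType) (H : hypergraph V) (r : nat).
Hypotheses (r0 : (0 < r)%N) (uniH : uniform r.+1 H) (uncH : uncrowded H).
Variables (L : V -> {set C}) (l0 lam0 : R).
Hypothesis sizeL : forall v, l0 <= #|L v|%:R.
Hypothesis degL : forall v c, c \in L v ->
  #|[set e in H | (v \in e) && [forall u in e :\ v, c \in L u]]|%:R <= lam0 * l0 ^+ r.
Variables (theta xi delta a lmin lam1 : R) (N : nat).
Hypotheses (theta01 : 0 < theta <= 1 / 2) (xi01 : 0 <= xi <= 1 / 2).
Hypothesis lamP : 1 <= lam0.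
Hypothesis lam1P : lam0 * (1 + 4 * xi) ^+ (r.+1 * N) <= lam1.
Hypothesis deltaP : lam1 * (r%:R * theta) <= delta.
Hypothesis delta12 : delta <= 1 / 2.
Hypothesis small : 3 * theta ^+ 2 + theta * delta <= xi / 2.
Hypotheses (a0 : 0 < a) (aP : a <= (1 - theta) ^+ N).
Hypothesis lminP : lmin <= l0 * expR (- (2 * xi * N%:R + (1 + 2 * delta) * lam1)).
Hypotheses (thl : 8 <= theta * lmin) (al : 2 <= a * lmin).
Hypothesis fail : expR (- (xi ^+ 2 * theta ^+ r * a * lmin / 16)) *
  (2 + (l0 + 1) * r%:R) * (1 + r.+1 * max_degree H)%:R ^+ 4 <= 1 / 4.
Hypothesis finish : 8 * (r%:R * r.+1%:R) * lam1 * (1 - theta) ^+ N <= 1.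

Let lmin_gt0 : 0 < lmin.
Proof. by have /andP[t0 _] := theta01; rewrite -(pmulr_rgt0 _ t0); apply: lt_le_trans thl. Qed.

Let l0_gt0 : 0 < l0.
Proof.
rewrite -(pmulr_lgt0 _ (expR_gt0 (- (2 * xi * N%:R + (1 + 2 * delta) * lam1)))).
exact: lt_le_trans lminP.
Qed.

Let tm i : R := 1 - (1 - theta) ^+ i.

Let tm01 i : 0 <= tm i <= 1.
Proof.
have /andP[t0 t1] := theta01; have : 0 <= (1 - theta) ^+ i <= 1.
  by rewrite exprn_ge0 ?exprn_ile1 //; lra.
by rewrite /tm; lra.
Qed.

Let tmS i : tm i + (1 - tm i) * theta = tm i.+1.
Proof. by rewrite /tm exprS; ring. Qed.

Let lam i := lam0 * (1 + 4 * xi) ^+ (r.+1 * i).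

Let lam_bounds i : (i <= N)%N -> 1 <= lam i <= lam1.
Proof.
have /andP[x0 x1] := xi01; have lamP' := lamP; move=> iN; apply/andP; split.
  apply: (le_trans lamP); rewrite -[leLHS]mulr1 ler_wpM2l //; first by lra.
  by apply: exprn_ege1; lra.
apply: le_trans lam1P; rewrite ler_wpM2l //; first by lra.
by apply: ler_weXn2l; [lra|rewrite leq_mul2l iN orbT].
Qed.

Lemma initial_state : exists A : V -> {set C}, (forall v, A v \subset L v) /\
  state H r (fun=> None) A l0 (class_bound r lam0 0 l0).
Proof.
have [n /andP[n1 n2]] := nat_ceil_exists (ltW l0_gt0).
have nL v : (n <= #|L v|)%N.
  rewrite -ltnS -(ltr_nat R); apply: (lt_le_trans n2).
  by rewrite -[X in _ <= X%:R]addn1 natrD lerD2r sizeL.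
pose A v := trunc_set n (L v).
have sA v : A v \subset L v by exact: trunc_set_sub.
have col0 c (X : {set V}) : colset (fun=> None) c X = set0.
  by apply/setP => u; rewrite !inE andbF.
exists A; split=> //; split.
- move=> e c eH; rewrite negb_forall_in; apply/exists_inP.
  have : (0 < #|e|)%N by rewrite (eqP (forall_inP uniH _ eH)).
  by case/card_gt0P => u ue; exists u.
- by move=> v _; rewrite card_trunc_set // n1 n2.
- move=> v c _; apply/setP => e; rewrite in_set0 in_class col0 cards0.
  by move: r0; case: (r) => //= m _; rewrite !andbF.
(* Nothing is colored, so only class 0 can be nonempty; at t = 0 the bounds for j > 0 vanish
   accordingly. *)
move=> v c j /andP[_ cA] jr; case: j jr => [|j] jr; last first.
  rewrite (_ : class _ _ _ _ _ _ = set0) ?cards0.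
    by rewrite /class_bound expr0n /= mulr0 mul0r.
  by apply/setP => e; rewrite in_set0 in_class col0 cards0 /= !andbF.
rewrite /class_bound bin0 expr0 !mulr1 subn0 subr0 mul1r.
apply: le_trans (degL (subsetP (sA v) _ cA)).
rewrite ler_nat; apply: subset_leq_card; apply/subsetP => e.
rewrite in_class => /and4P[eH ve /forall_inP h _]; rewrite inE eH ve /=.
by apply/forall_inP => u /h /(subsetP (sA u)).
Qed.

(** Round i loses a fraction y of each list, and y is at most lam1 times the increment of
    [tm i ^+ r]. These losses telescope to lam1 at most, whatever the number of rounds; only the
    fluctuation term 2 xi grows with i. *)
Lemma nibble_iter i : (i <= N)%N -> exists phi A l, [/\
  state H r phi A l (class_bound r (lam i) (tm i) l),
  l <= l0,
  l0 * expR (- (2 * xi * i%:R + (1 + 2 * delta) * (lam1 * tm i ^+ r))) <= l,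
  forall u c, phi u = Some c -> c \in L u &
  forall u, A u \subset L u].
Proof.
have /andP[x0 x1] := xi01; have /andP[th0 th1] := theta01.
have del12 := delta12.
elim: i => [_|i IH iN].
  have [A [sA st]] := initial_state; exists (fun=> None), A, l0; split=> //.
    by rewrite /lam muln0 expr0 mulr1 /tm expr0 subrr.
  rewrite /tm expr0 subrr expr0n gtn_eqF //= !mulr0 addr0 oppr0 expR0 mulr1 //.
have [phi [A [l [st ll0 lge phiL sA]]]] := IH (ltnW iN).
have /andP[la0 la1] := lam_bounds (ltnW iN).
have /andP[t0 t1] := tm01 i; have /andP[t'0 t'1] := tm01 i.+1.
have tt' : tm i <= tm i.+1 by rewrite -tmS; nra.
pose y := lam i * (tm i.+1 ^+ r - tm i ^+ r).
have powle : tm i ^+ r <= tm i.+1 ^+ r by apply: lerXn2r; rewrite ?nnegrE.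
have y0 : 0 <= y by rewrite mulr_ge0 //; lra.
have yle : y <= lam1 * (tm i.+1 ^+ r - tm i ^+ r).
  by rewrite ler_wpM2r //; lra.
have ydelta : y <= delta.
  apply: le_trans deltaP; apply: (le_trans yle); rewrite ler_wpM2l //; first by lra.
  apply: le_trans (subrX_le _ t0 _) _; first by rewrite tt'.
  rewrite ler_wpM2l // -tmS; nra.
have tN n : (n <= N)%N -> a <= 1 - tm n.
  move=> nN; rewrite /tm opprB addrCA subrr addr0; apply: (le_trans aP).
  by apply: ler_wiXn2l; [lra|lra|].
have pow1 n : tm n ^+ r <= 1 by have /andP[? ?] := tm01 n; apply: exprn_ile1.
have lam1_ge0 : 0 <= lam1 by lra.
have lminl : lmin <= l.
  apply: (le_trans lminP); apply: le_trans lge.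
  rewrite ler_wpM2l ?(ltW l0_gt0) // ler_expR lerN2; apply: lerD.
    by rewrite ler_wpM2l ?ler_nat ?(ltnW (ltnW iN)) ?(ltnW iN) //; lra.
  rewrite ler_wpM2l //; first by lra.
  by rewrite -[leRHS]mulr1 ler_wpM2l.
have l_gt0 : 0 < l by exact: lt_le_trans lminl.
have rnd := @nibble_round R r V C H r0 uniH uncH phi A (lam i) (tm i) l theta xi a.
rewrite /= tmS -/y in rnd.
have [||||||||||phi' [A' [st' ext new sA']]] := rnd st.
- exact: theta01.
- exact: xi01.
- exact: la0.
- by rewrite t0.
- by rewrite a0 tN.
- lra.
- apply: le_trans small; rewrite lerD2l ler_wpM2l //; exact: ltW.
- by apply: (le_trans thl); rewrite ler_wpM2l // ltW.
- by apply: (le_trans al); rewrite ler_wpM2l // ltW.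
- apply: le_trans fail; rewrite ler_wpM2r ?exprn_ge0 ?ler0n //.
  have q0 : 0 <= xi ^+ 2 * theta ^+ r * a by rewrite !mulr_ge0 ?exprn_ge0 // ltW.
  apply: ler_pM; rewrite ?expR_ge0 //.
  + by rewrite addr_ge0 ?mulr_ge0 //; lra.
  + by rewrite ler_expR lerN2; have := ler_wpM2l q0 lminl; lra.
  by rewrite lerD2l ler_wpM2r //; lra.
exists phi', A', ((1 - xi) * ((1 - y) * l)); split.
- have -> : lam i.+1 = lam i * (1 + 4 * xi) ^+ r.+1; last exact: st'.
  by rewrite /lam mulnS exprD; ring.
- have h1 : 0 <= (1 - xi) * (1 - y) <= 1.
    have xi1 : xi <= 1 by lra.
    have y1 : y <= 1 by lra.
    by rewrite mulr_ge0 ?mulr_ile1 ?subr_ge0 // lerBlDr lerDl.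
  by apply: le_trans ll0; rewrite mulrA; case/andP: h1 => h1 h2; nra.
- have e1 : expR (- (2 * xi)) <= 1 - xi.
    apply: le_trans (expRN_le_1B (x := xi) _); last by rewrite x0.
    by rewrite ler_expR lerN2; nra.
  have e2 : expR (- ((1 + 2 * delta) * (lam1 * (tm i.+1 ^+ r - tm i ^+ r)))) <= 1 - y.
    apply: le_trans (expRN_le_1B (x := y) _); last by rewrite y0; lra.
    rewrite ler_expR lerN2 mulrC; apply: ler_pM; [lra|exact: y0|lra|exact: yle].
  have -> : 2 * xi * i.+1%:R + (1 + 2 * delta) * (lam1 * tm i.+1 ^+ r) =
     2 * xi + ((1 + 2 * delta) * (lam1 * (tm i.+1 ^+ r - tm i ^+ r)) +
     (2 * xi * i%:R + (1 + 2 * delta) * (lam1 * tm i ^+ r))).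
    by rewrite -natr1; ring.
  rewrite opprD expRD [- (_ + (_ + _))]opprD expRD.
  rewrite mulrCA; apply: ler_pM; rewrite ?expR_ge0 //.
    by rewrite mulr_ge0 ?mulr_ge0 ?expR_ge0 // ltW.
  rewrite mulrCA; apply: ler_pM; rewrite ?expR_ge0 //.
  by rewrite mulr_ge0 ?expR_ge0 // ltW.
- move=> u c /new[|]; [exact: phiL|exact: (subsetP (sA u))].
- by move=> u; apply: subset_trans (sA u).
Qed.

Lemma nibble_coloring : exists Phi : {ffun V -> C},
  (forall v, Phi v \in L v) /\
  forall e c, e \in H -> ~~ [forall u in e, Phi u == c].
Proof.
have /andP[x0 x1] := xi01; have /andP[th0 th1] := theta01.
have del12 := delta12.
have [phi [A [l [st ll0 lge phiL sA]]]] := nibble_iter (leqnn N).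
have /andP[la0 la1] := lam_bounds (leqnn N).
have /andP[t0 t1] := tm01 N.
have lminl : lmin <= l.
  apply: (le_trans lminP); apply: le_trans lge.
  rewrite ler_wpM2l ?(ltW l0_gt0) // ler_expR lerN2 lerD2l.
  rewrite ler_wpM2l //.
    have : 0 <= lam1 * (r%:R * theta) by rewrite !mulr_ge0 //; lra.
    by have := deltaP; lra.
  by rewrite -[leRHS]mulr1 ler_wpM2l ?exprn_ile1 //; lra.
have l1 : 1 <= l.
  apply: le_trans lminl; have := thl; have := lmin_gt0; nra.
have [|Phi [PhiA mono]] := complete_coloring uniH st l1.
  (* The sum is lam (1 - t^r) <= lam1 r (1 - theta)^N, which [finish] makes small enough for the
     completion. *)
  have -> : \sum_(j < r) class_bound r (lam N) (tm N) l j * l^-1 ^+ (r - j) =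
      lam N * (1 - tm N ^+ r).
    rewrite (eq_bigr (fun j : 'I_r => class_bound r (lam N) (tm N) l j * (1 / l) ^+ (r - j))).
      rewrite sum_class_bound; last by apply: lt0r_neq0; lra.
      by rewrite mulr1 addrCA subrr addr0 expr1n.
    by move=> j _; rewrite div1r.
  have h : 1 - tm N ^+ r <= r%:R * (1 - theta) ^+ N.
    rewrite -[X in X - _](expr1n _ r); apply: le_trans (subrX_le _ t0 _) _.
      by rewrite t1 lexx.
    by rewrite /tm opprB addrCA subrr addr0.
  have h2 : lam N * (1 - tm N ^+ r) <= lam1 * (r%:R * (1 - theta) ^+ N).
    apply: ler_pM => //; first by lra.
    by rewrite subr_ge0 exprn_ile1.
  have h3 : r.+1%:R * (2 * (lam N * (1 - tm N ^+ r))) <=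
      r.+1%:R * (2 * (lam1 * (r%:R * (1 - theta) ^+ N))) by rewrite !ler_wpM2l.
  by apply: (le_trans h3); have := finish; lra.
exists Phi; split=> // v; case: (PhiA v) => [/phiL //|]; exact: (subsetP (sA v)).
Qed.

End NibbleColoring.

(** * Choice of the parameters *)

Lemma expR_ge_sqr (R : realType) (x : R) : 0 <= x -> x ^+ 2 / 2 <= expR x.
Proof.
move=> x0; apply: le_trans (expR_ge1Dxn 1 x0).
by rewrite (_ : 2`!%:R = 2 :> R) // lerDr.
Qed.

Lemma expR_le_inv (R : realType) (x : R) : 0 < x -> x * expR (- x) <= 2 / x.
Proof.
move=> x0; rewrite expRN ler_pdivrMr ?expR_gt0 //.
apply: (@le_trans _ _ (2 / x * (x ^+ 2 / 2))); last first.
  by rewrite ler_wpM2l ?expR_ge_sqr ?divr_ge0 // ltW.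
by rewrite le_eqVlt; apply/orP; left; apply/eqP; field; rewrite gt_eqF.
Qed.

(** Take the least N with (1 - theta)^N <= A. Minimality bounds the power below, as 1 - theta >=
    1/2, and bounds N through exp(theta (N - 1)) < 1/A. The linear bound 1 + 1/A instead of a
    logarithm is enough, because 1/A will be of order Lam. *)
Lemma exists_rounds (R : realType) (theta A : R) : 0 < theta <= 1 / 2 -> 0 < A < 1 ->
  exists N : nat, [/\ A / 2 <= (1 - theta) ^+ N, (1 - theta) ^+ N <= A &
    theta * N%:R <= 1 + A^-1].
Proof.
move=> /andP[th0 th1] /andP[A0 A1].
have q01 : 0 <= 1 - theta by lra.
have expb n : (1 - theta) ^+ n <= expR (- (theta * n%:R)).
  by apply: pow_1B_le; apply/andP; split; lra.
have ex : exists n, (1 - theta) ^+ n <= A.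
  pose n := (Num.truncn (A^-1 / theta)).+1; exists n.
  apply: (le_trans (expb n)); rewrite expRN -[leRHS]invrK lef_pV2 ?posrE ?expR_gt0 ?invr_gt0 //.
  apply: le_trans (expR_ge1Dx _).
  have : A^-1 / theta < n%:R.
    by have /truncn_itv/andP[] : 0 <= A^-1 / theta by rewrite divr_ge0 ?invr_ge0 ?(ltW A0) ?(ltW th0).
  by rewrite ltr_pdivrMr // mulrC => /ltW h; apply: (le_trans h); rewrite lerDr.
exists (ex_minn ex); case: ex_minnP => n nA nmin.
case: n nA nmin => [|n] nA nmin; first by rewrite expr0 leNgt A1 in nA.
have nA' : A < (1 - theta) ^+ n by rewrite ltNge; apply/negP => /nmin; rewrite ltnn.
split=> //.
  rewrite exprS; apply: (@le_trans _ _ (1 / 2 * A)); first by rewrite mulrC div1r.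
  by apply: ler_pM; lra.
have := lt_le_trans nA' (expb n); rewrite expRN => h.
have h2 : expR (theta * n%:R) < A^-1 by rewrite -[ltLHS]invrK ltf_pV2 ?posrE ?invr_gt0 ?expR_gt0.
have := expR_ge1Dx (theta * n%:R); rewrite -natr1 mulrDr mulr1 => h3.
by lra.
Qed.

Lemma nibble_threshold (R : realType) (r : nat) (eps K : R) :
  (0 < r)%N -> 0 < eps < 1 -> 0 <= K ->
  exists Lam0 : R, forall Lam : R, Lam0 <= Lam ->
  forall (V C : finType) (H : hypergraph V) (L : V -> {set C}),
  uniform r.+1 H -> uncrowded H -> (max_degree H)%:R <= expR (K * Lam) ->
  (forall v, expR Lam <= #|L v|%:R) ->
  (forall v c, c \in L v ->
    #|[set e in H | (v \in e) && [forall u in e :\ v, c \in L u]]|%:R <=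
    (1 - eps) * Lam * expR Lam ^+ r) ->
  exists Phi : {ffun V -> C}, (forall v, Phi v \in L v) /\
    forall e c, e \in H -> ~~ [forall u in e, Phi u == c].
Proof.
move=> r0 /andP[ep0 ep1] K0.
pose rr : R := r%:R * r.+1%:R.
(* The failure exponent contains xi^2 theta^r (A/2) >= eta^(6 + 2r + 1). This beta makes eta^(2r +
   7) = exp(- eps Lam / 8), against a final list size of exp(eps Lam / 4 - 1). *)
pose beta : R := eps / (8 * (2 * r + 7)%:R).
pose e1 : R := expR (- 1).
pose c'' : R := 4 * ((2 * r + 2)%:R * (r + 2)%:R ^+ 4).
pose c : R := 8 * rr + 2.
pose c1 : R := 16 * r.+1%:R * c / eps.
pose kap : R := e1 / 16 * (eps / 8) ^+ 2 / 2.
have r1 : 1 <= r%:R :> R by rewrite ler1n.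
have rr2 : 2 <= rr by rewrite /rr -natr1; nra.
have b0 : 0 < beta by rewrite /beta divr_gt0 // mulr_gt0 // ltr0n addn_gt0 orbT.
have c2 : 2 <= c by rewrite /c; lra.
have c1_gt0 : 0 < c1.
  by rewrite /c1 divr_gt0 //; do !apply: mulr_gt0 => //; exact: lt_le_trans c2.
have kap0 : 0 < kap.
  rewrite /kap divr_gt0 // mulr_gt0 ?exprn_gt0 ?divr_gt0 //; exact: expR_gt0.
have c''0 : 0 <= c'' by rewrite /c'' mulr_ge0 // mulr_ge0 ?exprn_ge0.
(* The summands ensure in turn Lam >= 1, initial weight (1 - eps) Lam >= 1 ([C3]), Lam eta small
   ([C1]), and the failure estimate ([C2]). *)
exists (1 + (1 - eps)^-1 + c1 * (2 / beta ^+ 2) + (1 + 4 * K + c'') / kap) => Lam LamP.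
move=> V C H L uniH uncH degH sizeL degL.
have t1 : 0 < (1 - eps)^-1 by rewrite invr_gt0; lra.
have t2 : 0 < c1 * (2 / beta ^+ 2) by rewrite mulr_gt0 // divr_gt0 // exprn_gt0.
have t3 : 0 <= (1 + 4 * K + c'') / kap by rewrite divr_ge0 ?(ltW kap0) //; lra.
have Lam1 : 1 <= Lam by lra.
have Lam_gt0 : 0 < Lam by lra.
pose eta := expR (- (beta * Lam)).
have eta0 : 0 < eta by exact: expR_gt0.
have C1 : c1 * (Lam * eta) <= 1.
  have bL : 0 < beta * Lam by exact: mulr_gt0.
  have h1 := expR_le_inv bL; rewrite -/eta in h1.
  have h2 : Lam * eta <= 2 / beta ^+ 2 / Lam.
    rewrite -(ler_pM2l b0) mulrA; apply: (le_trans h1).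
    by rewrite le_eqVlt; apply/orP; left; apply/eqP; field; rewrite !gt_eqF.
  apply: (le_trans (ler_wpM2l (ltW c1_gt0) h2)).
  by rewrite mulrA ler_pdivrMr // mul1r; lra.
have C3 : 1 <= (1 - eps) * Lam.
  have h : 0 < 1 - eps by lra.
  by rewrite mulrC -ler_pdivrMr // div1r; lra.
pose E := e1 / 16 * expR (eps * Lam / 8).
(* E bounds the failure exponent from below; it must beat the factor exp((1 + 4 K) Lam) from lists
   and degrees and the constant c''. The quadratic lower bound on the exponential outgrows this
   linear term. *)
have C2 : (1 + 4 * K) * Lam + c'' <= E.
  apply: (@le_trans _ _ (kap * Lam ^+ 2)).
    apply: (@le_trans _ _ ((1 + 4 * K + c'') * Lam)).
      by rewrite [leRHS]mulrDl lerD2l -[leLHS]mulr1 ler_wpM2l.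
    rewrite expr2 mulrA ler_wpM2r ?(ltW Lam_gt0) //.
    by rewrite [leRHS]mulrC -ler_pdivrMr //; lra.
  have -> : kap * Lam ^+ 2 = e1 / 16 * ((eps * Lam / 8) ^+ 2 / 2) by rewrite /kap; field.
  rewrite /E ler_wpM2l ?divr_ge0 ?expR_ge0 // expR_ge_sqr //.
  by rewrite divr_ge0 // mulr_ge0 // ltW.
clear LamP t1 t2 t3 c1_gt0 kap0.
pose u := Lam * eta; have u0 : 0 < u by exact: mulr_gt0.
have F1 : 16 * (r.+1%:R * c * u) <= eps.
  move: C1; rewrite /c1 -/u (_ : 16 * r.+1%:R * c / eps * u = (16 * (r.+1%:R * c * u)) / eps).
    by rewrite ler_pdivrMr // mul1r.
  by field; rewrite gt_eqF.
have rc : r%:R + 1 <= r.+1%:R * c / 2.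
  have e : r.+1%:R = r%:R + 1 :> R by rewrite natr1.
  have := ler_wpM2l (ler0n R r.+1) c2; rewrite e; lra.
have ru : 32 * ((r%:R + 1) * u) <= eps.
  apply: le_trans F1; have := ler_wpM2r (ltW u0) rc; lra.
have cu : 32 * (c * u) <= eps.
  apply: le_trans F1; have : 2 * (c * u) <= r.+1%:R * (c * u).
    have r2 : 2 <= r.+1%:R :> R by rewrite ler_nat ltnS.
    by apply: ler_wpM2r => //; rewrite mulr_ge0 ?(ltW u0) //; lra.
  by lra.
have etau : eta <= u by rewrite -[leLHS]mul1r ler_wpM2r // ltW.
have u64 : u <= 1 / 64.
  have : 2 * u <= (r%:R + 1) * u by rewrite ler_wpM2r ?(ltW u0) //; lra.
  by lra.
have eta64 : eta <= 1 / 64 by exact: le_trans u64.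
clear C1 rc.
have etaX n : 0 <= eta ^+ n <= 1 by rewrite exprn_ge0 ?exprn_ile1 ?(ltW eta0) //; lra.
(* xi must dominate theta^2 and theta delta, the errors of one round, yet xi N must vanish while
   theta N is of order Lam; theta^(3/2) lies between. *)
pose theta := eta ^+ 2; pose xi := eta ^+ 3.
have th_eta : theta <= eta by rewrite /theta expr2; nra.
have th0 : 0 < theta by exact: exprn_gt0.
have theta01 : 0 < theta <= 1 / 2 by rewrite th0; lra.
have xi_eta : xi <= eta by rewrite /xi exprS -[leRHS]mulr1 ler_wpM2l ?(ltW eta0) //; case/andP: (etaX 2).
have xi0 : 0 <= xi by case/andP: (etaX 3).
have xi01 : 0 <= xi <= 1 / 2 by rewrite xi0; lra.
(* Half of the slack eps is left for the growth of lam over the rounds, the other half keeps the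
   final lists a power of l. *)
pose lam1 := (1 - eps / 2) * Lam.
have lam1_le : lam1 <= Lam by rewrite /lam1 -[leRHS]mul1r ler_wpM2r ?(ltW Lam_gt0) //; lra.
have lam1_ge : 1 / 2 <= lam1.
  have h : 1 / 2 <= 1 - eps / 2 by lra.
  have := ler_wpM2r (ltW Lam_gt0) h; rewrite -/lam1; lra.
have lam1_gt0 : 0 < lam1 by lra.
(* The uncolored fraction at which the completion applies. *)
pose A := (8 * rr * lam1)^-1.
have rl : 1 <= rr * lam1 by have := ler_wpM2r (ltW lam1_gt0) rr2; lra.
have P8 : 1 < 8 * rr * lam1 by lra.
have A01 : 0 < A < 1.
  by rewrite /A invr_gt0 invf_lt1 ?(lt_trans ltr01 P8).
have [N [N1 N2 N3]] := exists_rounds theta01 A01.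
rewrite /A invrK in N3.
have thN : theta * N%:R <= c * Lam.
  apply: (le_trans N3); rewrite /c mulrDl.
  have : rr * lam1 <= rr * Lam by rewrite ler_wpM2l //; lra.
  by lra.
have xiN : xi * N%:R <= c * u.
  have -> : xi * N%:R = eta * (theta * N%:R) by rewrite /xi /theta; ring.
  have -> : c * u = eta * (c * Lam) by rewrite /u; ring.
  by rewrite ler_wpM2l // ltW.
pose delta := lam1 * (r%:R * theta).
have lr_eta : lam1 * (r%:R * eta) <= eps / 32.
  have h : lam1 * (r%:R * eta) <= Lam * (r%:R * eta) by rewrite ler_wpM2r ?mulr_ge0 // ltW.
  have : Lam * (r%:R * eta) <= (r%:R + 1) * u by rewrite /u; nra.
  by lra.
have del0 : 0 <= delta by rewrite /delta (mulr_ge0 (ltW lam1_gt0)) // mulr_ge0 // ltW.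
have delE : delta <= eps / 32.
  apply: le_trans lr_eta; rewrite /delta ler_wpM2l ?(ltW lam1_gt0) // ler_wpM2l //.
pose lmin := expR (eps * Lam / 4 - 1).
have lmin0 : 0 < lmin by exact: expR_gt0.
have ZE : eta ^+ (2 * r + 7) * lmin = 16 * E.
  have -> : eta ^+ (2 * r + 7) = expR (- (eps * Lam / 8)).
    rewrite /eta -expRM_natr; congr expR; rewrite /beta.
    have : (2 * r + 7)%:R != 0 :> R by rewrite pnatr_eq0 addn_eq0 andbF.
    by move: (2 * r + 7)%:R => k7 k70; field.
  rewrite /E /lmin expRD [16 * _]mulrA (_ : 16 * (e1 / 16) = e1); last by field.
  rewrite mulrA -expRD mulrC; congr (_ * expR _); by field.
have E1 : 1 <= E.
  apply: le_trans C2; have : 0 <= K * Lam by rewrite mulr_ge0 // ltW.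
  by lra.
have Z16 n : (n <= 2 * r + 7)%N -> 16 * E <= eta ^+ n * lmin.
  move=> nr; rewrite -ZE ler_wpM2r ?(ltW lmin0) //.
  by apply: ler_wiXn2l => //; [exact: ltW|lra].
have Aeta : eta <= A / 2.
  rewrite /A -(ler_pM2r (_ : 0 < 16 * (rr * lam1))); last by lra.
  rewrite (_ : (8 * rr * lam1)^-1 / 2 * (16 * (rr * lam1)) = 1); last first.
    have rl0 : 0 < rr * lam1 by exact: lt_le_trans rl.
    have rr0 : 0 < rr by exact: lt_le_trans rr2.
    by clear -lam1_gt0 rr0; field; rewrite !gt_eqF.
  have h : eta * (16 * (rr * lam1)) <= 16 * (rr * u).
    have := ler_wpM2l (ltW eta0) lam1_le; rewrite [eta * Lam]mulrC -/u => h.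
    have rr0 : 0 <= rr by exact: le_trans rr2.
    have := ler_wpM2l rr0 h; clear; lra.
  have : 8 * rr * u <= c * u by rewrite ler_wpM2r ?(ltW u0) // /c lerDl.
  by move: h cu ep1; clear; lra.
apply: (@nibble_coloring R V C H r r0 uniH uncH L (expR Lam) ((1 - eps) * Lam) sizeL degL
  theta xi delta (A / 2) lmin lam1 N theta01 xi01 C3).
- have h : (1 + 4 * xi) ^+ (r.+1 * N) <= 1 + eps / 2.
    apply: (@le_trans _ _ (expR (4 * xi * (r.+1 * N)%:R))).
      rewrite expRM_natr; apply: lerXn2r; rewrite ?nnegrE ?expR_ge0 ?expR_ge1Dx //.
      by clear -xi0; lra.
    apply: (@le_trans _ _ (expR (eps / 4))).
      rewrite ler_expR natrM.
      have := ler_wpM2l (ler0n R r.+1) xiN; move: F1; clear; lra.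
    clear -ep0 ep1; apply: (le_trans (expR_le_quad _)); first by lra.
    have : eps ^+ 2 <= eps by rewrite expr2; nra.
    by lra.
  rewrite /lam1 -mulrA [Lam * _]mulrC mulrA ler_wpM2r ?(ltW Lam_gt0) //.
  apply: (@le_trans _ _ ((1 - eps) * (1 + eps / 2))); first by clear -h ep1; rewrite ler_wpM2l //; lra.
  have -> : (1 - eps) * (1 + eps / 2) = 1 - eps / 2 - eps ^+ 2 / 2 by field.
  by rewrite lerBlDr lerDl divr_ge0 // sqr_ge0.
- by [].
- by clear -delE ep1; lra.
- have -> : 3 * theta ^+ 2 + theta * delta = xi * (3 * eta + lam1 * (r%:R * eta)).
    by rewrite /delta /theta /xi; ring.
  by clear -xi0 eta64 lr_eta ep1; rewrite ler_wpM2l //; lra.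
- by case/andP: A01 => A0 _; exact: divr_gt0.
- exact: N1.
- rewrite /lmin -expRD ler_expR.
  have h : (1 + 2 * delta) * lam1 <= (1 - eps / 4) * Lam.
    rewrite /lam1 mulrA ler_wpM2r ?(ltW Lam_gt0) //.
    apply: (@le_trans _ _ ((1 + eps / 16) * (1 - eps / 2))).
      by clear -delE ep0 ep1; rewrite ler_wpM2r //; lra.
    have : 0 <= eps ^+ 2 by exact: sqr_ge0.
    have -> : (1 + eps / 16) * (1 - eps / 2) = 1 - 7 / 16 * eps - eps ^+ 2 / 32 by field.
    by clear -ep0; lra.
  by clear -h xiN cu ep1; lra.
- have h : 16 * E <= theta * lmin by apply: (Z16 2%N); exact: leq_trans (leq_addl _ _).
  by clear -h E1; lra.
- have h : 16 * E <= eta * lmin by apply: (Z16 1%N); exact: leq_trans (leq_addl _ _).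
  have := ler_wpM2r (ltW lmin0) Aeta; clear -h E1; lra.
- have hE : E <= xi ^+ 2 * theta ^+ r * (A / 2) * lmin / 16.
    rewrite ler_pdivlMr // mulrC -ZE ler_wpM2r ?(ltW lmin0) //.
    have -> : eta ^+ (2 * r + 7) = xi ^+ 2 * theta ^+ r * eta.
      by rewrite /xi /theta -!exprM -exprD -exprSr; congr (_ ^+ _); rewrite addnC.
    by rewrite ler_wpM2l // mulr_ge0 ?exprn_ge0 // ltW.
  have q1 : 2 + (expR Lam + 1) * r%:R <= (2 * r + 2)%:R * expR Lam.
    have eL : 1 <= expR Lam by rewrite -expR0 ler_expR ltW.
    rewrite natrD natrM; have := ler_wpM2r (ler0n R r) eL; move: eL; clear; lra.
  have q2 : (1 + r.+1 * max_degree H)%:R ^+ 4 <= (r + 2)%:R ^+ 4 * expR (4 * K * Lam).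
    have -> : expR (4 * K * Lam) = expR (K * Lam) ^+ 4.
      by rewrite -expRM_natr; congr expR; ring.
    rewrite -exprMn; apply: lerXn2r; rewrite ?nnegrE ?mulr_ge0 ?expR_ge0 //.
    have eK : 1 <= expR (K * Lam) by rewrite -expR0 ler_expR mulr_ge0 // ltW.
    have := ler_wpM2l (ler0n R r.+1) degH.
    rewrite natrD natrM (_ : (r + 2)%:R = 1 + r.+1%:R :> R); first by move: eK; clear; lra.
    by rewrite nat1r addn2.
  apply: (@le_trans _ _ (expR (- E) * ((2 * r + 2)%:R * expR Lam) *
      ((r + 2)%:R ^+ 4 * expR (4 * K * Lam)))).
    have p0 : 0 <= 2 + (expR Lam + 1) * r%:R.
      by rewrite addr_ge0 // mulr_ge0 // addr_ge0 // expR_ge0.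
    apply: ler_pM q2; [exact: mulr_ge0 (expR_ge0 _) p0|exact: exprn_ge0|].
    by apply: ler_pM q1; rewrite ?expR_ge0 ?ler_expR ?lerN2.
  have -> : expR (- E) * ((2 * r + 2)%:R * expR Lam) * ((r + 2)%:R ^+ 4 * expR (4 * K * Lam)) =
      c'' / 4 * (expR (- E) * expR Lam * expR (4 * K * Lam)).
    by rewrite /c''; field.
  rewrite -!expRD; set X := _ + _ + _.
  have h1 : c'' <= expR c'' by have := expR_ge1Dx c''; clear; lra.
  have h2 : c'' * expR X <= 1.
    apply: (@le_trans _ _ (expR c'' * expR X)); first by rewrite ler_wpM2r ?expR_ge0.
    by rewrite -expRD expR_le1 /X; move: C2; clear; lra.
  by move: h2; clear; lra.
have -> : 8 * (r%:R * r.+1%:R) * lam1 * (1 - theta) ^+ N = (1 - theta) ^+ N / A.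
  by rewrite /A invrK /rr; ring.
by rewrite ler_pdivrMr ?mul1r //; case/andP: A01.
Qed.

(** * Random lists *)

Lemma sum_subsets_expr (R : realType) (T : finType) (X : {set T}) (y : R) :
  \sum_(B : {set T} | B \subset X) y ^+ #|B| = (1 + y) ^+ #|X|.
Proof.
rewrite exprDn.
rewrite (partition_big (fun B : {set T} => inord #|B| : 'I_(#|X|.+1)) predT) //=.
apply: eq_bigr => j _; rewrite expr1n mul1r.
rewrite (eq_bigl (fun B : {set T} => (B \subset X) && (#|B| == j))); last first.
  move=> B; case sB : (B \subset X) => //=.
  by rewrite -val_eqE /= inordK // ltnS subset_leq_card.
rewrite (eq_bigr (fun=> y ^+ j)) => [|B /andP[_ /eqP ->] //].
rewrite sumr_const; congr (_ *+ _); rewrite -cards_draws.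
by apply: eq_card => B; rewrite inE.
Qed.

(** One factor at a time, this is (l - i)/(q - i) <= l/q, cleared of denominators. *)
Lemma bin_shift_le q l t : (t <= l)%N -> (l <= q)%N ->
  ('C(q - t, l - t) * q ^ t <= l ^ t * 'C(q, l))%N.
Proof.
move=> + lq; elim: t => [|t IH] tl; first by rewrite !subn0 expn0 muln1 mul1n.
have {}IH := IH (ltnW tl).
have qt : (0 < q - t)%N by rewrite subn_gt0 (leq_trans tl).
have e := mul_bin_diag (q - t) (l - t).-1; rewrite prednK ?subn_gt0 // in e.
rewrite !subnS.
have step : ('C((q - t).-1, (l - t).-1) * q <= l * 'C(q - t, l - t))%N.
  rewrite -(leq_pmul2l qt) mulnA e mulnAC [leqRHS]mulnA leq_mul2r.
  by apply/orP; right; rewrite !mulnBl [(q * l)%N]mulnC leq_sub2l // leq_mul2l lq orbT.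
rewrite expnS mulnA (leq_trans (leq_mul step (leqnn _))) //.
by rewrite -mulnA (leq_trans (leq_mul (leqnn l) IH)) // mulnA -expnS.
Qed.

Lemma card_supersets q l (T : {set 'I_q}) :
  (#|[set S : {set 'I_q} | (T \subset S) && (#|S| == l)]| <= 'C(q - #|T|, l - #|T|))%N.
Proof.
have cT : #|~: T| = (q - #|T|)%N by have := cardsC T; rewrite card_ord; lia.
rewrite -cT -cards_draws -(card_in_imset (f := fun S => S :\: T)).
  apply: subset_leq_card; apply/subsetP => B /imsetP[S]; rewrite !inE => /andP[TS /eqP cS] ->.
  by rewrite setDE subsetIr /= -setDE cardsD (setIidPr TS) cS.
move=> S1 S2; rewrite !inE => /andP[T1 _] /andP[T2 _] e.
by rewrite -(setID S1 T) -(setID S2 T) e (setIidPr T1) (setIidPr T2).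
Qed.

Section RandomListLaw.
Variables (R : realType) (V : finType) (q l : nat).
Hypothesis lq : (l <= q)%N.

Lemma unif_subset_ge0 S : 0 <= unif_subset R (q := q) l S.
Proof. by rewrite /unif_subset; case: ifP => // _; rewrite invr_ge0 ler0n. Qed.

Definition list_law : product_law R V {set 'I_q} :=
  ProductLaw (fun _ : V => unif_subset_ge0) (fun _ : V => @unif_subset_sum1 R q l lq).
Local Notation P := list_law.
Local Notation Omega := {ffun V -> {set 'I_q}}.
Implicit Types L : Omega.

Lemma Pr_listsE (A : pred Omega) : Pr_lists R l A = Pr P A.
Proof.
rewrite /Pr_lists /Pr /Ex big_mkcond; apply: eq_bigr => L _ /=.
by case: (A L); rewrite ?mulr1 ?mulr0.
Qed.

Lemma Pr_size u : Pr P (fun L => #|L u| != l) = 0.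
Proof.
rewrite (Pr_coord _ _ (fun S : {set 'I_q} => #|S| != l)) big1 // => S /negPf h.
by rewrite /= /unif_subset h.
Qed.

(** The colors of one list are not independent, but sampling without replacement makes joint
    inclusion at most as likely as for independent colors of density l/q. *)
Lemma Pr_superset u (T : {set 'I_q}) :
  Pr P (fun L => T \subset L u) <= (l%:R / q%:R) ^+ #|T|.
Proof.
rewrite (Pr_coord _ _ (fun S : {set 'I_q} => T \subset S)) /= /unif_subset.
rewrite -big_mkcondr sumr_const.
set N := #|_|; have NE : N = #|[set S : {set 'I_q} | (T \subset S) && (#|S| == l)]|.
  by apply: eq_card => S; rewrite inE.
have [tl|lt] := leqP #|T| l; last first.
  have -> : N = 0%N.
    rewrite NE; apply/eqP; rewrite cards_eq0; apply/eqP/setP => S; rewrite !inE.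
    apply/negP => /andP[/subset_leq_card h /eqP cS].
    by rewrite cS leqNgt lt in h.
  by rewrite mulr0n exprn_ge0 // divr_ge0 ?ler0n.
have q0 : (0 < 'C(q, l))%N by rewrite bin_gt0.
(* The empty T is treated apart since it is the only case in which q can be 0. *)
have [T0|Tn] := eqVneq #|T| 0%N.
  rewrite T0 expr0 -[_ *+ _]mulr_natl ler_pdivrMr ?ltr0n // mul1r ler_nat NE.
  by have := card_supersets l T; rewrite T0 !subn0.
have qpos : (0 < q)%N by rewrite (leq_trans _ lq) // (leq_trans _ tl) // lt0n.
rewrite -[_ *+ _]mulr_natl ler_pdivrMr ?ltr0n // expr_div_n mulrAC.
rewrite ler_pdivlMr ?exprn_gt0 ?ltr0n // -!natrX -!natrM ler_nat.
apply: leq_trans (bin_shift_le tl lq); rewrite leq_mul2r NE card_supersets orbT //.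
Qed.

(** * Color degrees at a vertex under random lists *)

Variables (H : hypergraph V) (r : nat).
Hypotheses (uniH : uniform r.+1 H) (uncH : uncrowded H).
Variable v : V.

Definition color_degree L c : nat :=
  #|[set e in H | (v \in e) && [forall u in e :\ v, c \in L u]]|.

Let Hv : {set {set V}} := [set e in H | v \in e].

Definition common (S : {set 'I_q}) e L : {set 'I_q} :=
  [set c in S | [forall u in e :\ v, c \in L u]].

Lemma sum_color_degree (S : {set 'I_q}) L :
  (\sum_(c in S) color_degree L c = \sum_(e in Hv) #|common S e L|)%N.
Proof.
transitivity (\sum_(c in S) \sum_(e in Hv) [forall u in e :\ v, c \in L u] : nat)%N.
  apply: eq_bigr => c _; rewrite /color_degree -sum1_card big_mkcond [RHS]big_mkcond.
  apply: eq_bigr => e _; rewrite !inE; case: (e \in H) => //=; case: (v \in e) => //=.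
rewrite exchange_big; apply: eq_bigr => e _.
rewrite /common -sum1_card big_mkcond [RHS]big_mkcond; apply: eq_bigr => c _.
by rewrite inE; case: (c \in S) => //=; case: ifP => ->.
Qed.

Lemma depends_common S e : depends_on (common S e) (e :\ v).
Proof.
move=> L L' eqL; apply/setP => c; rewrite !inE; congr (_ && _); apply: eq_forallb => u.
by case h : (u \in e :\ v) => //=; rewrite eqL.
Qed.

(** With y = exp x - 1, expand (1 + y)^|common| over the subsets T of the common colors. T is common
    when it lies in S and in all r lists of the other vertices, of probability at most (l/q)^(r |T|)
    by [Pr_superset]. Resummation gives (1 + y (l/q)^r)^|S|, as for independent colors. *)
Lemma mgf_common (S : {set 'I_q}) e (x : R) : e \in Hv -> 0 <= x ->
  Ex P (fun L => expR (x * #|common S e L|%:R)) <=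
  expR (#|S|%:R * ((expR x - 1) * (l%:R / q%:R) ^+ r)).
Proof.
rewrite inE => /andP[eH ve] x0; set y := expR x - 1.
have y0 : 0 <= y by rewrite /y subr_ge0 -expR0 ler_expR.
have ce : #|e :\ v| = r.
  by have := forall_inP uniH e eH; rewrite (cardsD1 v e) ve => /eqP[].
have -> : Ex P (fun L => expR (x * #|common S e L|%:R)) =
    Ex P (fun L => \sum_(T : {set 'I_q} | T \subset S)
      y ^+ #|T| * (\prod_(u in e :\ v) (T \subset L u)%:R)).
  apply: eq_Ex => L; rewrite expRM_natr.
  have -> : expR x = 1 + y by rewrite /y addrC subrK.
  rewrite -sum_subsets_expr big_mkcond [RHS]big_mkcond; apply: eq_bigr => T _.
  case: (boolP (T \subset common S e L)) => [sT|nsT].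
    rewrite (subset_trans sT); last by apply/subsetP => c; rewrite inE => /andP[].
    rewrite big1 ?mulr1 // => u ue; rewrite (_ : T \subset L u) //.
    by apply/subsetP => c /(subsetP sT); rewrite inE => /andP[_ /forall_inP]; apply.
  case: ifP => // sTS; have : ~~ [forall u in e :\ v, T \subset L u].
    apply: contra nsT => /forall_inP h; apply/subsetP => c cT; rewrite inE (subsetP sTS) //=.
    by apply/forall_inP => u /h /subsetP; apply.
  rewrite negb_forall_in => /exists_inP[u ue /negPf nu].
  by rewrite (bigD1 u) //= nu mul0r mulr0.
rewrite Ex_sum.
apply: (@le_trans _ _ (\sum_(T : {set 'I_q} | T \subset S) (y * (l%:R / q%:R) ^+ r) ^+ #|T|)).
  apply: ler_sum => T _; rewrite ExZ exprMn ler_wpM2l ?exprn_ge0 //.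
  rewrite (Ex_prod _ (S := fun u => [set u])).
  - apply: (@le_trans _ _ (\prod_(u in e :\ v) (l%:R / q%:R) ^+ #|T|)).
      by apply: ler_prod => u _; rewrite Pr_ge0 /= Pr_superset.
    by rewrite prodr_const ce -!exprM mulnC.
  - by move=> u _ L L' eqL; rewrite eqL // inE.
  by move=> u u' _ _ uu'; rewrite disjoints1 inE.
rewrite sum_subsets_expr [#|S|%:R * _]mulrC expRM_natr.
apply: lerXn2r; rewrite ?nnegrE ?expR_ge0 ?expR_ge1Dx // addr_ge0 // mulr_ge0 //.
by rewrite exprn_ge0 // divr_ge0 ?ler0n.
Qed.

(** Counting by edges rather than by colors makes the sum one of independent terms, since edges at v
    share only v. The tilt is x/4, as in [chernoff_upper], for the mean |S| mu. *)
Lemma color_degree_tail (S : {set 'I_q}) (mu x : R) :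
  (max_degree H)%:R * (l%:R / q%:R) ^+ r <= mu -> 0 <= x <= 1 ->
  Pr P (fun L => (1 + x) * mu * #|S|%:R <= (\sum_(c in S) color_degree L c)%:R) <=
  expR (- (x ^+ 2 * mu / 8 * #|S|%:R)).
Proof.
move=> muP /andP[x0 x1]; set p := l%:R / q%:R in muP.
have p0 : 0 <= p by rewrite divr_ge0 ?ler0n.
have mu0 : 0 <= mu by apply: le_trans muP; rewrite mulr_ge0 ?exprn_ge0.
apply: (le_trans (exp_markov (f := fun L => x / 4 * (\sum_(c in S) color_degree L c)%:R)
  (d := x / 4 * ((1 + x) * mu * #|S|%:R)) _ _)).
  by move=> L h; rewrite ler_wpM2l //; lra.
have y0 : 0 <= expR (x / 4) - 1 by have := expR_ge1Dx (x / 4); lra.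
have mgf : Ex P (fun L => expR (x / 4 * (\sum_(c in S) color_degree L c)%:R)) <=
    expR (#|S|%:R * ((expR (x / 4) - 1) * mu)).
  rewrite (eq_Ex _ (g := fun L => \prod_(e in Hv) expR (x / 4 * #|common S e L|%:R))); last first.
    by move=> L; rewrite sum_color_degree natr_sum mulr_sumr expR_sum.
  rewrite (Ex_prod _ (S := fun e => e :\ v)).
  - apply: (@le_trans _ _ (\prod_(e in Hv) expR (#|S|%:R * ((expR (x / 4) - 1) * p ^+ r)))).
      apply: ler_prod => e eHv; apply/andP; split; last by apply: mgf_common => //; lra.
      by apply: Ex_ge0 => L; exact: expR_ge0.
    rewrite prodr_const -expRM_natr ler_expR.
    rewrite (_ : #|S|%:R * ((expR (x / 4) - 1) * p ^+ r) * #|Hv|%:R =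
      #|S|%:R * ((expR (x / 4) - 1) * (#|Hv|%:R * p ^+ r))); last by ring.
    rewrite ler_wpM2l // ler_wpM2l //; apply: le_trans muP.
    rewrite ler_wpM2r ?exprn_ge0 // ler_nat.
    by rewrite (_ : #|Hv| = degree H v) // /max_degree (leq_bigmax v).
  - by move=> e _ L L' eqL; rewrite (depends_common _ eqL).
  move=> e e'; rewrite !inE => /andP[eH ve] /andP[e'H ve'] ee'.
  exact: (sub_edge_disjoint uncH).
apply: (le_trans (ler_wpM2r (expR_ge0 _) mgf)); rewrite -expRD ler_expR.
have quad : expR (x / 4) - 1 <= x / 4 + 2 * (x / 4) ^+ 2.
  by have := @expR_le_quad _ (x / 4); lra.
have h : #|S|%:R * ((expR (x / 4) - 1) * mu) <= #|S|%:R * ((x / 4 + 2 * (x / 4) ^+ 2) * mu).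
  by rewrite ler_wpM2l // ler_wpM2r.
apply: (le_trans (lerD h (lexx _))); rewrite le_eqVlt; apply/orP; left; apply/eqP.
by field.
Qed.

Definition good_colors (d : R) L : {set 'I_q} := [set c in L v | (color_degree L c)%:R <= d].

(** If few colors are good, the bad ones form a set S in L v of size at least z l with total degree
    above (1 + x) mu |S|. The degrees do not read L v, so a union bound over S costs the expected
    number of subsets of L v, that is 2^l. The exponent carries both mu and l. *)
Lemma Pr_few_good_colors (mu x z : R) :
  (max_degree H)%:R * (l%:R / q%:R) ^+ r <= mu -> 0 <= x <= 1 -> 0 <= mu -> 0 <= z ->
  Pr P (fun L => #|good_colors ((1 + x) * mu) L|%:R < (1 - z) * l%:R) <=
  2 ^+ l * expR (- (x ^+ 2 * mu / 8 * (z * l%:R))).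
Proof.
move=> muP x01 mu0 z0; set d := (1 + x) * mu; set a := x ^+ 2 * mu / 8.
have a0 : 0 <= a by rewrite divr_ge0 // mulr_ge0 // sqr_ge0.
pose bigS (S : {set 'I_q}) L := d * #|S|%:R <= (\sum_(c in S) color_degree L c)%:R.
apply: (@le_trans _ _ (Pr P (fun L => #|L v| != l) +
   \sum_(S : {set 'I_q} | z * l%:R <= #|S|%:R) Pr P (predI (fun L => S \subset L v) (bigS S)))).
  apply: (@le_trans _ _ (Pr P (predU (fun L => #|L v| != l) (fun L => (#|L v| == l) &&
     (#|good_colors d L|%:R < (1 - z) * l%:R))))).
    by apply: sub_Pr => L h /=; rewrite h andbT orNb.
  apply: (le_trans (Pr_or _ _ _)); rewrite lerD2l.
  apply: Pr_le_sum => L /andP[/eqP sL few].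
  exists (L v :\: good_colors d L).
    have sub : good_colors d L \subset L v by apply/subsetP => c; rewrite inE => /andP[].
    rewrite cardsD (setIidPr sub) natrB ?subset_leq_card // sL.
    by move: few; move: (#|good_colors d L|%:R : R) (l%:R : R) => gg ll few; lra.
  rewrite /= subsetDl /= /bigS mulrC mulr_natl -sumr_const natr_sum.
  apply: ler_sum => c; rewrite !inE => /andP[+ cL]; rewrite cL /= -ltNge; exact: ltW.
rewrite Pr_size add0r.
apply: (@le_trans _ _ (\sum_(S : {set 'I_q} | z * l%:R <= #|S|%:R)
   Pr P (fun L => S \subset L v) * expR (- (a * (z * l%:R))))).
  apply: ler_sum => S zS.
  rewrite (Pr_indep _ (S1 := [set v]) (S2 := ~: [set v])).
  - rewrite ler_wpM2l ?Pr_ge0 //; apply: (le_trans (color_degree_tail S muP x01)).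
    by rewrite ler_expR lerN2 ler_wpM2l.
  - by move=> L L' eqL; rewrite eqL // inE.
  - move=> L L' eqL; rewrite /bigS; congr (_ <= _%:R); apply: eq_bigr => c _.
    apply: eq_card => e; rewrite !inE; congr [&& _, _ & _]; apply: eq_forallb => u.
    case uv : (u \in e :\ v) => //=; rewrite eqL //.
    by move: uv; rewrite !inE => /andP[].
  by rewrite -setI_eq0 setICr.
rewrite -mulr_suml ler_wpM2r ?expR_ge0 //.
apply: (@le_trans _ _ (\sum_(S : {set 'I_q}) Pr P (fun L => S \subset L v))).
  by rewrite [leRHS](bigID (fun S : {set 'I_q} => z * l%:R <= #|S|%:R)) /= lerDl sumr_ge0 // => S _; exact: Pr_ge0.
rewrite -Ex_sum (eq_Ex _ (g := fun L => 2 ^+ #|L v|)); last first.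
  move=> L; rewrite (_ : 2 = 1 + 1) // -sum_subsets_expr [RHS]big_mkcond.
  by apply: eq_bigr => S _; rewrite expr1n; case: ifP.
rewrite (Ex_coord _ _ (fun S : {set 'I_q} => 2 ^+ #|S|)) /=.
rewrite (eq_bigr (fun S => unif_subset R l S * 2 ^+ l)).
  by rewrite -mulr_suml unif_subset_sum1 // mul1r.
by move=> S _; rewrite /unif_subset; case: eqP => [->|]; rewrite ?mul0r.
Qed.

End RandomListLaw.

(** * Conclusion *)

Lemma powR_invK (R : realType) (x : R) n : (0 < n)%N -> 0 <= x -> (x `^ (1 / n%:R)) ^+ n = x.
Proof.
move=> n0 x0; rewrite -powR_mulrn ?powR_ge0 // -powRrM div1r mulVf ?powRr1 //.
by rewrite pnatr_eq0 -lt0n.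
Qed.

Lemma two_le_expR1 (R : realType) : 2 <= expR 1 :> R.
Proof. by have := @expR_ge1Dx R 1; lra. Qed.

Lemma list_colorable_of_coloring (V : finType) (q k : nat) (H : hypergraph V)
  (L : {ffun V -> {set 'I_q}}) (Phi : {ffun V -> 'I_q}) : uniform k.+1 H ->
  (forall v, Phi v \in L v) ->
  (forall e c, e \in H -> ~~ [forall u in e, Phi u == c]) -> list_colorable H L.
Proof.
move=> uniH PhiL mono; apply/existsP; exists Phi; apply/andP; split; first exact/forallP.
apply/forall_inP => e eH.
have /card_gt0P[u ue] : (0 < #|e|)%N by rewrite (eqP (forall_inP uniH _ eH)).
apply: contra (mono e (Phi u) eH) => /forall_inP h; apply/forall_inP => w we.
by have /forall_inP := h w we; apply.
Qed.

(** Raise the hypothesis on q to the power r, keep a single factor 1 + eps, and multiply by the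
    lower bound on lnl, which cancels r / gamma and the logarithm of Delta. *)
Lemma color_count_bound (R : realType) (r Delta q : nat) (eps gamma lnl : R) :
  (0 < r)%N -> 0 < eps -> 0 < gamma -> (1 < Delta)%N ->
  (1 + eps) * (r%:R / gamma * (Delta%:R / ln Delta%:R)) `^ (1 / r%:R) <= q%:R ->
  gamma / r%:R * ln Delta%:R <= lnl ->
  (1 + eps) * Delta%:R <= q%:R ^+ r * lnl.
Proof.
move=> r0 e0 g0 D1 hq hl; set D : R := Delta%:R in hq hl *.
have D0 : 1 < D by rewrite ltr1n.
have lD : 0 < ln D by apply: ln_gt0.
have rR : 0 < r%:R :> R by rewrite ltr0n.
set B := r%:R / gamma * (D / ln D) in hq.
have B0 : 0 <= B by rewrite mulr_ge0 // divr_ge0 // ltW // (lt_trans ltr01).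
have h1 : (1 + eps) ^+ r * B <= q%:R ^+ r.
  rewrite -[X in _ * X](powR_invK r0 B0) -exprMn; apply: lerXn2r => //.
    by rewrite nnegrE mulr_ge0 ?powR_ge0 //; lra.
  by rewrite nnegrE.
have h2 : (1 + eps) * B <= q%:R ^+ r.
  apply: le_trans h1; rewrite ler_wpM2r // -[leLHS]expr1; apply: ler_weXn2l => //; lra.
have -> : (1 + eps) * D = (1 + eps) * B * (gamma / r%:R * ln D).
  by rewrite /B; field; rewrite !gt_eqF.
have g1 : 0 <= gamma / r%:R * ln D by rewrite mulr_ge0 ?divr_ge0 // ltW.
apply: ler_pM => //; rewrite mulr_ge0 //; lra.
Qed.

Section Main.
Variables (R : realType) (r : nat) (e0 : R).
Hypotheses (r0 : (0 < r)%N) (e001 : 0 < e0 <= 1).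

Let x : R := e0 / 8.
Let z : R := e0 / (16 * r%:R).

Let r1 : 1 <= r%:R :> R. Proof. by rewrite ler1n. Qed.

Let z01 : 0 < z <= 1 / 16.
Proof.
have /andP[h0 h1] := e001; have h := r1; apply/andP; split.
  by rewrite /z divr_gt0 // mulr_gt0 //; lra.
by rewrite /z ler_pdivrMr; lra.
Qed.

(** The gain (1 + x)/(1 + e0) is at most (1 - e0/16)^3. One factor is the slack demanded by the
    nibble, one pays for Lam in place of lnl, and one for (1 - z)^r, the effect of shortening the
    lists. *)
Lemma degree_slack (lnl Lam lr : R) : 0 <= lr -> 0 < lnl -> (1 - e0 / 16) * lnl <= Lam ->
  (1 + x) * (lr * lnl / (1 + e0)) <= (1 - e0 / 16) * Lam * ((1 - z) ^+ r * lr).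
Proof.
move=> lr0 lnl0 hL; have /andP[h0 h1] := e001; have /andP[z0 z1] := z01.
have rz : r%:R * z = e0 / 16.
  by rewrite /z; field; rewrite pnatr_eq0 -lt0n.
have pz : 1 - e0 / 16 <= (1 - z) ^+ r.
  have := @subrX_le R (1 - z) 1 r; rewrite expr1n => /(_ _ _) h.
  have : 1 - (1 - z) ^+ r <= r%:R * (1 - (1 - z)) by apply: h; [lra|apply/andP; split; lra].
  by rewrite opprB addrCA subrr addr0 rz; lra.
have -> : (1 + x) * (lr * lnl / (1 + e0)) = ((1 + x) / (1 + e0)) * lnl * lr by field; lra.
rewrite mulrA ler_wpM2r //.
have y3 : (1 + x) / (1 + e0) <= (1 - e0 / 16) * (1 - e0 / 16) * (1 - e0 / 16).
  by rewrite ler_pdivrMr /x; nra.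
have y0 : 0 <= 1 - e0 / 16 by lra.
apply: (@le_trans _ _ ((1 - e0 / 16) * ((1 - e0 / 16) * lnl) * (1 - e0 / 16))).
  have := ler_wpM2r (ltW lnl0) y3; lra.
apply: ler_pM => //; first by rewrite !mulr_ge0 // ltW.
by rewrite ler_wpM2l.
Qed.

(** Shortening the list costs at most 1 in the logarithm, which e0/16 of a large logarithm
    covers. *)
Lemma ln_shrink (l : R) : 0 < l -> 16 / e0 <= ln l -> (1 - e0 / 16) * ln l <= ln ((1 - z) * l).
Proof.
move=> l0 hl; have /andP[h0 h1] := e001; have /andP[z0 z1] := z01.
rewrite lnM ?posrE //; last by lra.
have : -1 <= ln (1 - z).
  rewrite -ler_expR lnK ?posrE; last by lra.
  apply: (@le_trans _ _ (2^-1)); last by lra.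
  by rewrite expRN lef_pV2 ?posrE ?expR_gt0 // two_le_expR1.
have : 1 <= e0 / 16 * ln l.
  by rewrite -(ler_pM2l (_ : 0 < 16 / e0)) ?divr_gt0 // mulr1 mulrA
    (_ : 16 / e0 * (e0 / 16) = 1) ?mul1r //; field; rewrite gt_eqF.
by lra.
Qed.

(** With T = l^(r+1), both n and 2^l are at most exp T. A tail exp(- 3 T) therefore beats 2^l and
    two factors n, one for the union over vertices and one for the target 1/n; 24 is 3 times the 8
    of Chernoff. *)
Lemma union_bound_le (l n : nat) (mu : R) : (0 < l)%N ->
  ln n%:R <= l%:R ^+ r.+1 :> R ->
  24 * (1 + e0) / (x ^+ 2 * z) <= ln l%:R ->
  mu = l%:R ^+ r * ln l%:R / (1 + e0) ->
  n%:R * (2 ^+ l * expR (- (x ^+ 2 * mu / 8 * (z * l%:R)))) <= 1 / n%:R.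
Proof.
move=> l0 hn hl ->; have /andP[h0 h1] := e001; have /andP[z0 z1] := z01.
(* For n = 0 both sides are 0, the inverse of 0 being 0. *)
case: n hn => [|n] hn; first by rewrite mul0r invr0 mulr0.
have n0 : 0 < n.+1%:R :> R by rewrite ltr0n.
have x0 : 0 < x by rewrite /x; lra.
have x2 : 0 < x ^+ 2 by exact: exprn_gt0.
set T : R := l%:R ^+ r.+1 in hn *.
have T1 : 1 <= T by apply: exprn_ege1; rewrite ler1n.
have lT : l%:R <= T.
  by rewrite /T -[leLHS]expr1; apply: ler_weXn2l => //; rewrite ler1n.
have W : 3 * T <= x ^+ 2 * (l%:R ^+ r * ln l%:R / (1 + e0)) / 8 * (z * l%:R).
  rewrite (_ : x ^+ 2 * (l%:R ^+ r * ln l%:R / (1 + e0)) / 8 * (z * l%:R) =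
    T * (x ^+ 2 * z / (8 * (1 + e0)) * ln l%:R)); last first.
    by rewrite /T [l%:R ^+ r.+1]exprS; field; lra.
  rewrite mulrC ler_wpM2l //; first by lra.
  have cp : 0 <= x ^+ 2 * z / (8 * (1 + e0)).
    by apply: divr_ge0; [exact: mulr_ge0 (ltW x2) (ltW z0)|apply: mulr_ge0; lra].
  have := ler_wpM2l cp hl.
  rewrite (_ : x ^+ 2 * z / (8 * (1 + e0)) * (24 * (1 + e0) / (x ^+ 2 * z)) = 3); last first.
    have xn : x != 0 by rewrite gt_eqF.
    have zn : z != 0 by rewrite gt_eqF.
    have en : 1 + e0 != 0 by rewrite gt_eqF //; lra.
    by field; rewrite xn zn en.
  by [].
have nT : n.+1%:R <= expR T by rewrite -[leLHS]lnK ?posrE // ler_expR.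
have tT : 2 ^+ l <= expR T.
  apply: (@le_trans _ _ (expR l%:R)); last by rewrite ler_expR.
  rewrite -[l%:R]mul1r expRM_natr; apply: lerXn2r; rewrite ?nnegrE ?expR_ge0 //.
  exact: two_le_expR1.
rewrite ler_pdivlMr //.
apply: (@le_trans _ _ (expR T * (expR T * expR (- (3 * T))) * expR T)).
  apply: ler_pM => //; first by rewrite !mulr_ge0 ?exprn_ge0 ?expR_ge0.
  apply: ler_pM => //; first by rewrite mulr_ge0 ?exprn_ge0 ?expR_ge0.
  by apply: ler_pM; rewrite ?exprn_ge0 ?expR_ge0 // ler_expR lerN2.
rewrite -!expRD expR_le1; lra.
Qed.

Lemma random_list_coloring (gamma : R) : 0 < gamma -> exists M : R, 0 < M /\
  forall (Delta n q l : nat), (1 < Delta)%N -> (0 < l)%N -> (l <= q)%N ->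
  M <= ln l%:R -> gamma / r%:R * ln Delta%:R <= ln l%:R ->
  ln n%:R <= l%:R ^+ r.+1 :> R ->
  (1 + e0) * Delta%:R <= q%:R ^+ r * ln l%:R ->
  forall (V : finType) (H : hypergraph V), #|V| = n -> uniform r.+1 H -> uncrowded H ->
  (max_degree H <= Delta)%N ->
  1 - 1 / n%:R <= Pr_lists R l (fun L : {ffun V -> {set 'I_q}} => list_colorable H L).
Proof.
move=> g0; have /andP[h0 h1] := e001; have /andP[z0 z1] := z01; have rR := r1.
have eps'01 : 0 < e0 / 16 < 1 by apply/andP; split; lra.
(* Delta is at most exp((r / gamma) lnl), and lnl <= 2 Lam after discarding colors; this gives K = 2
   r / gamma. *)
have K0 : 0 <= 2 * r%:R / gamma by rewrite divr_ge0 ?mulr_ge0 // ltW.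
have [Lam0 thr] := nibble_threshold r0 eps'01 K0.
have c0 : 0 <= 24 * (1 + e0) / (x ^+ 2 * z).
  by apply: divr_ge0; [apply: mulr_ge0; lra|exact: mulr_ge0 (sqr_ge0 x) (ltW z0)].
have b0 : 16 <= 16 / e0 by rewrite ler_pdivlMr //; lra.
(* The first term serves [ln_shrink], the second gives Lam0 <= lnl / 2 <= Lam, the third serves
   [union_bound_le]. *)
exists (16 / e0 + 2 * `|Lam0| + 24 * (1 + e0) / (x ^+ 2 * z)); split.
  by have := normr_ge0 Lam0; lra.
move=> Delta n q l D1 l0 lq Ml gl hn hq V H cV uniH uncH maxD.
have a0 := normr_ge0 Lam0.
set lnl := ln l%:R in Ml gl hn hq *.
have lR : 0 < l%:R :> R by rewrite ltr0n.
have q0 : 0 < q%:R :> R by rewrite ltr0n (leq_trans l0).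
have lnl0 : 16 <= lnl by lra.
pose mu := l%:R ^+ r * lnl / (1 + e0).
have mu0 : 0 <= mu by rewrite /mu divr_ge0 ?mulr_ge0 ?exprn_ge0 //; lra.
have muP : (max_degree H)%:R * (l%:R / q%:R) ^+ r <= mu.
  apply: (@le_trans _ _ (Delta%:R * (l%:R / q%:R) ^+ r)).
    by rewrite ler_wpM2r ?ler_nat // exprn_ge0 // divr_ge0 // ltW.
  rewrite /mu ler_pdivlMr; last by lra.
  rewrite expr_div_n (_ : Delta%:R * (l%:R ^+ r / q%:R ^+ r) * (1 + e0) =
    l%:R ^+ r * ((1 + e0) * Delta%:R) / q%:R ^+ r); last by ring.
  rewrite ler_pdivrMr ?exprn_gt0 // -mulrA ler_wpM2l ?exprn_ge0 ?(ltW lR) //.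
  by rewrite [leRHS]mulrC.
have x01 : 0 <= x <= 1 by rewrite /x; apply/andP; split; lra.
rewrite (Pr_listsE R lq); set P := list_law _ _ _.
pose few v (L : {ffun V -> {set 'I_q}}) :=
  #|good_colors H v ((1 + x) * mu) L|%:R < (1 - z) * l%:R :> R.
have main L : ~~ list_colorable H L -> exists2 v, v \in predT & few v L.
  move=> ncol; apply/exists_inP; apply: contraR ncol => /exists_inPn nfew.
  pose Lam := ln ((1 - z) * l%:R).
  have eLam : expR Lam = (1 - z) * l%:R.
    by rewrite lnK // posrE mulr_gt0 //; lra.
  have Lamge : (1 - e0 / 16) * lnl <= Lam by apply: ln_shrink => //; rewrite -/lnl; lra.
  have Lam_half : lnl / 2 <= Lam by apply: le_trans Lamge; nra.
  have Lam0P : Lam0 <= Lam by have := ler_norm Lam0; lra.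
  have [|||Phi [PhiL mono]] := thr Lam Lam0P V _ H (fun v => good_colors H v ((1 + x) * mu) L) uniH uncH.
  - apply: (@le_trans _ _ Delta%:R); first by rewrite ler_nat.
    rewrite -[leLHS]lnK ?posrE ?ltr0n ?(ltnW D1) // ler_expR.
    apply: (@le_trans _ _ (2 * r%:R / gamma * (lnl / 2))); last by rewrite ler_wpM2l.
    rewrite (_ : 2 * r%:R / gamma * (lnl / 2) = r%:R / gamma * lnl); last first.
      by field; rewrite gt_eqF.
    have := ler_wpM2l (_ : 0 <= r%:R / gamma) gl.
    rewrite mulrA (_ : r%:R / gamma * (gamma / r%:R) = 1) ?mul1r; last first.
      by field; rewrite !gt_eqF //; lra.
    by apply; rewrite divr_ge0 // ltW.
  - by move=> v; rewrite eLam leNgt; apply: nfew.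
  - move=> v c; rewrite inE => /andP[_ dc].
    apply: (@le_trans _ _ (color_degree H v L c)%:R).
      rewrite ler_nat; apply: subset_leq_card; apply/subsetP => e; rewrite !inE.
      move=> /and3P[-> -> /forall_inP h] /=; apply/forall_inP => u /h.
      by rewrite inE => /andP[].
    apply: (le_trans dc); rewrite eLam exprMn /mu.
    by apply: degree_slack => //; rewrite ?exprn_ge0 //; lra.
  apply: (list_colorable_of_coloring uniH (Phi := Phi)) => // v.
  by have := PhiL v; rewrite inE => /andP[].
have bad : Pr P (predC (fun L => list_colorable H L)) <= 1 / n%:R.
  apply: (le_trans (Pr_le_sum _ main)).
  apply: (@le_trans _ _ (\sum_(v : V) 2 ^+ l * expR (- (x ^+ 2 * mu / 8 * (z * l%:R))))).
    by apply: ler_sum => v _; exact: (Pr_few_good_colors lq uniH uncH v muP x01 mu0 (ltW z0)).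
  rewrite sumr_const cV -[_ *+ _]mulr_natl.
  by apply: union_bound_le => //; rewrite -/lnl; lra.
by rewrite PrC in bad; lra.
Qed.

End Main.

Theorem theorem1p9 (R : realType) (k : nat) (hk : (2 <= k)%N)
    (eps : R) (heps : 0 < eps) :
  exists C : R, 0 < C /\
  forall gamma : R, 0 < gamma < 1 ->
  exists Delta0 : nat,
  forall Delta n q l : nat,
    (Delta0 <= Delta)%N ->
    (l <= q)%N ->
    (1 + eps) *
      ((k%:R - 1) / gamma * (Delta%:R / ln Delta%:R)) `^ (1 / (k%:R - 1))
      <= q%:R ->
    Delta%:R `^ (gamma / (k%:R - 1)) + C * ln n%:R `^ (1 / k%:R) <= l%:R ->
  forall (V : finType) (H : hypergraph V),
    #|V| = n ->
    uniform k H ->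
    uncrowded H ->
    (max_degree H <= Delta)%N ->
    1 - 1 / n%:R <= Pr_lists R l (fun L : {ffun V -> {set 'I_q}} => list_colorable H L).
Proof.
case: k hk => [//|r] r0; rewrite ltnS in r0.
have -> : r.+1%:R - 1 = r%:R :> R by rewrite -natr1 addrK.
(* With C = 1 the hypothesis gives l^k >= log n; the constant in the tail exponent is supplied by
   log l, large once Delta is large. *)
exists 1; split=> // gamma /andP[g0 _].
have [e0 e001 e0eps] : exists2 e0 : R, 0 < e0 <= 1 & e0 <= eps.
  by exists (Num.min eps 1); rewrite ?lt_min ?heps ?ltr01 ?ge_min ?lexx ?orbT.
have [M [M0 main]] := random_list_coloring r0 e001 g0.
have rR : 0 < r%:R :> R by rewrite ltr0n.
(* Chosen so that gamma / r times log Delta reaches M; the second successor also forces Delta >=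
   2. *)
exists (Num.truncn (expR (M * r%:R / gamma))).+2 => Delta n q l DP lq hq hl.
have D1 : (1 < Delta)%N by apply: leq_trans DP.
have lnD : M * r%:R / gamma <= ln Delta%:R.
  rewrite -ler_expR lnK ?posrE ?ltr0n ?(ltnW D1) //.
  apply: (@le_trans _ _ (Num.truncn (expR (M * r%:R / gamma))).+1%:R).
    by case/andP: (truncn_itv (expR_ge0 (M * r%:R / gamma))) => _ /ltW.
  by rewrite ler_nat ltnW.
have D0 : 0 < Delta%:R :> R by rewrite ltr0n ltnW.
have pD : 0 < Delta%:R `^ (gamma / r%:R) by exact: powR_gt0.
have pn : 0 <= ln n%:R `^ (1 / r.+1%:R) :> R by exact: powR_ge0.
rewrite mul1r in hl.
have lR : 0 < l%:R :> R by lra.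
have l0 : (0 < l)%N by rewrite -(ltr0n R).
have lnl : gamma / r%:R * ln Delta%:R <= ln l%:R.
  by rewrite -ln_powR ler_ln ?posrE //; lra.
apply: main => //.
- apply: le_trans lnl; have := ler_wpM2l (_ : 0 <= gamma / r%:R) lnD.
  rewrite (_ : gamma / r%:R * (M * r%:R / gamma) = M); last by field; rewrite !gt_eqF.
  by apply; rewrite divr_ge0 // ltW.
(* At n = 0 the logarithm takes its default value 0. *)
- case: n pn hl => [|n] pn hl; first by rewrite ln0 // exprn_ge0.
  have ln0 : 0 <= ln n.+1%:R :> R by apply: ln_ge0; rewrite ler1n.
  rewrite -[leLHS](powR_invK (ltn0Sn r) ln0); apply: lerXn2r; rewrite ?nnegrE ?(ltW lR) //.
  by lra.
have := color_count_bound r0 heps g0 D1 hq lnl; apply: le_trans.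
by rewrite ler_wpM2r //; lra.
Qed.
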